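(* Let $(X,\sigma_X)$ be a finitely irreducible countable sofic shift, $(Y,\sigma_Y)$ a subshift on a countable alphabet and $\pi:X\to Y$ a one-block factor map such that $|\pi^{-1}(i)|<\infty$ for each $i\in\mathbb N$. Let $\mathcal F=\{\log f_n\}_{n=1}^\infty$ be an almost-additive sequence on $X$ with tempered variation, and let $\mathcal G=\{\log g_n\}_{n=1}^\infty$ be the sequence on $Y$ defined by $g_n(y)=\sup_{E_n(y)}\big\{\sum_{x\in E_n(y)}f_n(x)\big\}$. Then $$P_G(\mathcal F)=P(\mathcal F)=\sup_{\mu\in M(X,\sigma_X)}\Big\{h_\mu(\sigma_X)+\limsup_{n\to\infty}\frac1n\int\log f_n\,d\mu:\ \limsup_{n\to\infty}\frac1n\int\log f_n\,d\mu>-\infty\Big\}$$ $$=\sup_{\nu\in M(Y,\sigma_Y)}\Big\{h_\nu(\sigma_Y)+\limsup_{n\to\infty}\frac1n\int\log g_n\,d\nu:\ \limsup_{n\to\infty}\frac1n\int\log g_n\,d\nu>-\infty\Big\}=P(\mathcal G).$$ If $\sup f_1<\infty$, then each $\limsup_{n\to\infty}\frac1n\int\log f_n\,d\mu$ and each $\limsup_{n\to\infty}\frac1n\int\log g_n\,d\nu$ in these two variational formulas (the supremum over $\mu\in M(X,\sigma_X)$ and the supremum over $\nu\in M(Y,\sigma_Y)$) can be replaced by the corresponding $\lim$.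
   Context: Shifts. $\mathbb N=\{1,2,\dots\}$; $\mathbb N^{\mathbb N}$ carries the left shift and the cylinder topology. A subshift is a closed $X\subset\mathbb N^{\mathbb N}$ with $\sigma(X)\subseteq X$; it is a subshift on a countable alphabet if it is not contained in a full shift on a finite alphabet (its alphabet is identified with $\mathbb N$). $B_n(X)$ is the set of allowable words of length $n$ (initial words of length $n$ of points of $X$), $B_0(X)=\{\varepsilon\}$, $B(X)=\bigcup_{n\ge0}B_n(X)$, $[w]=\{x\in X:x\text{ begins with }w\}$. $X$ is irreducible if for all $u,v\in B(X)$ there is $w\in B(X)$ with $uwv\in B(X)$; finitely irreducible if there are $p\in\mathbb N$ and a finite $W_1\subset\bigcup_{n=0}^pB_n(X)$ such that for all $u,v\in B(X)$ there is $w\in W_1$ with $uwv\in B(X)$. A countable Markov shift is $\{x\in\mathbb N^{\mathbb N}:t_{x_nx_{n+1}}=1\ \forall n\}$ for a $0$-$1$ matrix with no zero row or column. A one-block factor map is a continuous surjection commuting with the shifts of the form $(\pi(x))_i=\pi(x_i)$ for a map $\pi$ on symbols. A finitely irreducible countable sofic shift is a finitely irreducible subshift on a countable alphabet which is the image of an irreducible countable Markov shift under a one-block factor map with finite preimages of each symbol. Sequences. $\mathcal F=\{\log f_n\}_{n\ge1}$ with $f_n:X\to(0,\infty)$ continuous. It is almost-additive if there is $C\ge0$ with $e^{-C}f_n(x)f_m(\sigma^nx)\le f_{n+m}(x)\le e^Cf_n(x)f_m(\sigma^nx)$ for all $n,m\in\mathbb N$, $x\in X$. It has tempered variation if $M_n=\sup\{f_n(x)/f_n(y):x_i=y_i,\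 1\le i\le n\}<\infty$ for all $n$ and $\frac1n\log M_n\to0$. For $y\in Y$, $n\in\mathbb N$, $E_n(y)$ denotes a set consisting of exactly one point from each cylinder $[x_1\dots x_n]$ of $X$ with $x_1\dots x_n\in B_n(X)$ and $\pi(x_1)\dots\pi(x_n)=y_1\dots y_n$; the supremum defining $g_n(y)$ is over all such sets. Pressure. $P(\mathcal F)=\limsup_n\frac1n\log\sum_{w\in B_n(X)}\sup_{x\in[w]}f_n(x)\in[-\infty,\infty]$ (similarly $P(\mathcal G)$ on $Y$). For a symbol $a$ of $X$, $Z_n(\mathcal F,a)=\sum_{x:\sigma^nx=x,\,x_1=a}f_n(x)$ and $P_G(\mathcal F)=\limsup_n\frac1n\log Z_n(\mathcal F,a)$ when independent of $a$ (an equality involving $P_G(\mathcal F)$ includes independence of $a$). $M(X,\sigma)$ is the set of $\sigma$-invariant Borel probability measures and $h_\mu(\sigma)$ the entropy.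
   Formalization: With sup f_1 < ∞, lim of (1/n)∫log g_n dν can fail to exist for some ν; so the formulas with lim range over measures whose limit exists and is > -∞, and existence is claimed for all μ, and for those ν with the positive part of log g_n integrable for all large n. *)

(* Defs.v *)
From HB Require Import structures.
From mathcomp Require Import all_boot all_order all_algebra.
From mathcomp Require Import all_classical all_reals all_analysis.

Set Implicit Arguments.
Unset Strict Implicit.
Unset Printing Implicit Defensive.
Import Order.TTheory GRing.Theory Num.Theory.
Import numFieldNormedType.Exports.

Local Open Scope classical_set_scope.
Local Open Scope ring_scope.

(* The alphabet is [nat] and coordinates start at 0: the x_1 x_2 ... of the
   mathematics is [x 0], [x 1], ...  As [nat] is discrete, the product topology
   is the cylinder topology. *)
Definition seqspace := prod_topology (fun _ : nat => nat).

Definition shift (x : seqspace) : seqspace := fun i => x i.+1.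

Definition subshift (X : set seqspace) := closed X /\ shift @` X `<=` X.

Definition countable_alphabet (X : set seqspace) :=
  ~ exists A : set nat, finite_set A /\ X `<=` [set x | forall i, A (x i)].

Definition words (X : set seqspace) (n : nat) : set (seq nat) :=
  [set mkseq x n | x in X].

Definition language (X : set seqspace) : set (seq nat) :=
  \bigcup_(n in [set: nat]) words X n.

Definition cylinder (X : set seqspace) (w : seq nat) : set seqspace :=
  [set x | X x /\ mkseq x (size w) = w].

Definition irreducible (X : set seqspace) :=
  forall u v, language X u -> language X v ->
    exists w, language X w /\ language X (u ++ w ++ v).

Definition finitely_irreducible (X : set seqspace) :=
  exists (p : nat) (W1 : set (seq nat)),
    [/\ (0 < p)%N, finite_set W1,
        W1 `<=` \bigcup_(n in [set n | (n <= p)%N]) words X n &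
        forall u v, language X u -> language X v ->
          exists w, W1 w /\ language X (u ++ w ++ v)].

Definition no_zero_row_or_column (t : nat -> nat -> bool) :=
  (forall i, exists j, t i j) /\ (forall j, exists i, t i j).

Definition markov_shift (t : nat -> nat -> bool) : set seqspace :=
  [set x | forall n, t (x n) (x n.+1)].

Definition factor_map (X Y : set seqspace) (F : seqspace -> seqspace) :=
  [/\ {within X, continuous F}, F @` X = Y &
      forall x, X x -> F (shift x) = shift (F x)].

Definition one_block (p : nat -> nat) (x : seqspace) : seqspace := p \o x.

Definition one_block_factor (X Y : set seqspace) (p : nat -> nat) :=
  factor_map X Y (one_block p).

(* Only symbols that occur in X count as preimages: the values of [p] at the
   other symbols are irrelevant. *)
Definition finite_preimages (X : set seqspace) (p : nat -> nat) :=
  forall i, finite_set [set a | words X 1 [:: a] /\ p a = i].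

Definition finitely_irreducible_sofic (X : set seqspace) :=
  [/\ subshift X, countable_alphabet X, finitely_irreducible X &
      exists (t : nat -> nat -> bool) (p : nat -> nat),
        [/\ no_zero_row_or_column t, irreducible (markov_shift t),
            one_block_factor (markov_shift t) X p &
            finite_preimages (markov_shift t) p]].

Definition borelspace := g_sigma_algebraType (@open seqspace).

Section Sequences.
Variable R : realType.
Implicit Types (X Y : set seqspace) (f : nat -> seqspace -> R).

(* A sequence (log f_n)_{n >= 1} is given by the f_n; [f 0] is irrelevant. *)
Definition continuous_positive X f :=
  forall n, (0 < n)%N ->
    {within X, continuous (f n)} /\ (forall x, X x -> 0 < f n x).

Definition almost_additive X f :=
  exists C : R, 0 <= C /\
    forall n m x, (0 < n)%N -> (0 < m)%N -> X x ->
      expR (- C) * (f n x * f m (iter n shift x)) <= f (n + m)%N x /\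
      f (n + m)%N x <= expR C * (f n x * f m (iter n shift x)).

Definition variation X f (n : nat) : \bar R :=
  ereal_sup [set (f n q.1 / f n q.2)%:E | q in
    [set q : seqspace * seqspace | [/\ X q.1, X q.2 &
       forall i, (i < n)%N -> q.1 i = q.2 i]]].

Definition tempered_variation X f :=
  (forall n, (0 < n)%N -> (variation X f n < +oo)%E) /\
  (fun n : nat => (n%:R^-1%:E * lne (variation X f n))%E) @ \oo --> (0 : \bar R).

(* [cylinder_transversal X p n y E]: E is one of the sets E_n(y). *)
Definition cylinder_transversal X (p : nat -> nat) (n : nat) (y : seqspace)
    (E : set seqspace) :=
  let W := [set w | words X n w /\ map p w = mkseq y n] in
  E `<=` \bigcup_(w in W) cylinder X w /\
  forall w, W w -> exists! x, (E `&` cylinder X w) x.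

(* The sequence (g_n) is kept with values in \bar R, which makes the supremum
   and the sum total; under the hypotheses of the theorem g_n is finite and
   positive on Y for n >= 1. *)
Definition image_sequence X (p : nat -> nat) f (n : nat) (y : seqspace) : \bar R :=
  ereal_sup [set (\esum_(x in E) (f n x)%:E)%E | E in cylinder_transversal X p n y].

Definition eseq f (n : nat) (x : seqspace) : \bar R := (f n x)%:E.

Implicit Type phi : nat -> seqspace -> \bar R.

(* lne +oo = +oo and lne 0 = -oo. *)
Definition pressure X phi : \bar R :=
  limn_esup (fun n : nat => (n%:R^-1%:E *
    lne (\esum_(w in words X n) ereal_sup [set phi n x | x in cylinder X w]))%E).

Definition gurevich_pressure X phi (a : nat) : \bar R :=
  limn_esup (fun n : nat => (n%:R^-1%:E *
    lne (\esum_(x in [set x | [/\ X x, iter n shift x = x & x 0%N = a]])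
           phi n x))%E).

(* Borel measures on X are identified with Borel measures on the whole
   sequence space that give X full mass. *)
Definition invariant_measure X (mu : probability borelspace R) :=
  mu X = 1%E /\
  forall A : set borelspace, measurable A -> mu (shift @^-1` A) = mu A.

(* A map to 'I_k with measurable fibres encodes a finite measurable partition;
   [join_cell P w] is the atom of P v s^-1 P v ... v s^-(n-1) P with
   itinerary w. *)
Definition join_cell (k n : nat) (P : borelspace -> 'I_k)
    (w : {ffun 'I_n -> 'I_k}) : set borelspace :=
  [set x | forall i : 'I_n, P (iter i shift x) = w i].

Definition join_entropy (mu : probability borelspace R) (k : nat)
    (P : borelspace -> 'I_k) (n : nat) : R :=
  \sum_(w : {ffun 'I_n -> 'I_k})
    - (fine (mu (join_cell P w)) * ln (fine (mu (join_cell P w)))).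

Definition partition_entropy (mu : probability borelspace R) (k : nat)
    (P : borelspace -> 'I_k) : \bar R :=
  limn (fun n : nat => (n%:R^-1 * join_entropy mu P n)%:E).

Definition entropy (mu : probability borelspace R) : \bar R :=
  ereal_sup [set h | exists (k : nat) (P : borelspace -> 'I_k),
    (forall j, measurable (P @^-1` [set j])) /\ h = partition_entropy mu P].

(* The library's integral is the integral of the positive part minus that of
   the negative part, with +oo - +oo = -oo. *)
Definition mean_log X phi (mu : probability borelspace R) (n : nat) : \bar R :=
  (n%:R^-1%:E * \int[mu]_(x in (X : set borelspace)) lne (phi n x))%E.

Definition variational_limsup X phi : \bar R :=
  ereal_sup [set (entropy mu + limn_esup (mean_log X phi mu))%E | mu in
    [set mu | invariant_measure X mu /\
              (-oo < limn_esup (mean_log X phi mu))%E]].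

(* The same formula with the limit: it ranges over the measures for which the
   limit exists in [-oo, +oo]. *)
Definition variational_lim X phi : \bar R :=
  ereal_sup [set (entropy mu + limn (mean_log X phi mu))%E | mu in
    [set mu | [/\ invariant_measure X mu, cvgn (mean_log X phi mu) &
              (-oo < limn (mean_log X phi mu))%E]]].

Definition eventually_upper_integrable X phi (mu : probability borelspace R) :=
  \forall n \near \oo,
    (\int[mu]_(x in (X : set borelspace)) maxe (lne (phi n x)) 0 < +oo)%E.

End Sequences.

(* Main.v *)
Require Import Defs.
From HB Require Import structures.
From mathcomp Require Import all_boot all_order all_algebra.
From mathcomp Require Import all_classical all_reals all_analysis.
From mathcomp Require Import measurable_realfun ring lra zify.
(* all_analysis exports another [shift], which has to be shadowed again. *)
Require Import Defs.
Import Order.TTheory GRing.Theory Num.Theory.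
Import numFieldNormedType.Exports.
Local Open Scope classical_set_scope.
Local Open Scope ring_scope.
Set Implicit Arguments.
Unset Strict Implicit.
Unset Printing Implicit Defensive.

(* Write Z_n for the sum over the words w of length n of the sup of f_n on [w].

   Upper bounds.  By the log-sum inequality, the entropy of any partition
   depending on the first n coordinates plus the integral of log phi_n is at most
   log Z_n.  Every finite Borel partition is mu-close to one depending on
   finitely many coordinates, and Gibbs' inequality against a noisy channel shows
   that the entropies per step of close partitions are close.  This gives
   h_mu + limsup (1/n) int log phi_n dmu <= P on X and on Y at once.

   Lower bounds.  Finite irreducibility, together with the irreducible Markov
   cover, lets one extend every word w of X by words from a finite list to the
   image of a loop at a fixed vertex of the cover.  Taking finitely many w that
   carry most of Z_n and one common extension yields words of one length N that
   concatenate freely inside X.  Their periodic concatenations bound the Gurevich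
   pressure from below.  The Bernoulli measure with weights proportional to the
   lower bounds of f_N on these words, averaged over N shifts, satisfies
   mu[w] <= e^{-mT} sup_[w] f_m for infinitely many m, with T close to the
   pressure.  Summing over the words above a given word of Y, the image measure
   satisfies the same bound with g_m.  Such a bound alone forces
   h + limsup (1/m) int log phi_m >= T.

   Since g_n(y) is the sum of sup_[w] f_n over the words w above y_1 ... y_n, the
   two pressures are sums of the same terms.  The limits exist by Fekete's lemma,
   as f_n and g_n are submultiplicative up to a constant. *)

(** * Upper limits, the log-sum inequality and Fekete's lemma *)

(** The alphabet is infinite, so nothing is compact: pressures and means may be infinite, log f_n
    need not be integrable, and no weak limit of measures can be relied on. Hence the lower bounds
    are proved for each real T below the pressure, by measures on finitely many symbols, and the
    upper bound compares real numbers strictly beyond the extended ones, so that no infinite values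
    are subtracted.

    On Y the sequence g_n is only shown to be submultiplicative up to a constant, since words above
    two pieces of y need not concatenate in X. The construction is therefore not repeated on Y: the
    measure built on X is pushed forward. Its entropy may drop, but the bound on the measure of
    cylinders survives and controls entropy and mean together, so entropies are never compared
    across the factor map.

    A bound on f_1 gives none on g_1, because the fibres of p are finite but not uniformly so.
    Convergence of the means on Y is therefore tied to upper integrability, which measures on
    finitely many symbols satisfy; these suffice to approach the supremum. *)

Lemma real_between (R : realType) (T : R) (p : \bar R) : (T%:E < p)%E ->
  exists2 T1 : R, T < T1 & (T1%:E < p)%E.
Proof.
case: p => [p|_|//]; last by exists (T + 1); rewrite ?ltrDl ?ltry.
rewrite lte_fin => Tp; exists ((T + p) / 2); first by rewrite midf_lt.
by rewrite lte_fin midf_lt.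
Qed.

Section LimSup.
Variable R : realType.
Implicit Types (u v : nat -> \bar R).
Local Open Scope ereal_scope.

Lemma limn_esup_inf u : limn_esup u = ereal_inf (range (esups u)).
Proof. by rewrite limn_esup_lim; apply/cvg_lim => //; exact: cvg_esups_inf. Qed.

Lemma limn_esup_ge u (c : \bar R) :
  (forall n0, exists2 n, (n0 <= n)%N & c <= u n) -> c <= limn_esup u.
Proof.
move=> h; rewrite limn_esup_inf; apply: le_ereal_inf_tmp => _ [n0 _ <-].
have [n nn0 cu] := h n0.
by apply: (le_trans cu); apply: ereal_sup_ubound; exists n.
Qed.

Lemma limn_esup_gtP u (c : \bar R) : c < limn_esup u ->
  forall n0, exists2 n, (n0 <= n)%N & c < u n.
Proof.
move=> cu n0; have : c < esups u n0.
  apply: (lt_le_trans cu); rewrite limn_esup_inf.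
  by apply: ereal_inf_lbound; exists n0.
by move=> /ereal_sup_gt[_ [n /= nn0 <-] cun]; exists n.
Qed.

Lemma limn_esup_ltP u (c : \bar R) : limn_esup u < c ->
  exists n0, forall n, (n0 <= n)%N -> u n < c.
Proof.
rewrite limn_esup_inf => /ereal_inf_lt[_ [n0 _ <-] uc].
exists n0 => n nn0; apply: le_lt_trans uc.
by apply: ereal_sup_ubound; exists n.
Qed.

Lemma le_limn_esup u v n0 : (forall n, (n0 <= n)%N -> u n <= v n) ->
  limn_esup u <= limn_esup v.
Proof.
move=> uv; rewrite [leRHS]limn_esup_inf; apply: le_ereal_inf_tmp => _ [N _ <-].
apply: (@le_trans _ _ (esups u (maxn n0 N))).
  by rewrite limn_esup_inf; apply: ereal_inf_lbound; exists (maxn n0 N).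
apply: ge_ereal_sup => _ [n /= nN <-]; rewrite geq_max in nN.
case/andP: nN => n0n Nn; apply: (le_trans (uv _ n0n)).
by apply: ereal_sup_ubound; exists n.
Qed.

Lemma eq_limn_esup u v n0 : (forall n, (n0 <= n)%N -> u n = v n) ->
  limn_esup u = limn_esup v.
Proof.
move=> uv; apply/eqP; rewrite eq_le.
by apply/andP; split; apply: (@le_limn_esup _ _ n0) => n nn0; rewrite uv.
Qed.
End LimSup.

Section LogSum.
Variable R : realType.

(** With M and B the sums of m and b, each term m ln(bM/(mB)) is at most bM/B - m because ln(1+u) <=
    u, and these bounds sum to 0. The library has ln 0 = 0, so [b] must be positive wherever [m]
    is. *)
Lemma log_sum (T : finType) (P : pred T) (m b : T -> R) :
  (forall t, P t -> 0 <= m t) -> (forall t, P t -> 0 <= b t) ->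
  (forall t, P t -> 0 < m t -> 0 < b t) -> 0 < \sum_(t | P t) m t ->
  \sum_(t | P t) m t * (ln (b t) - ln (m t)) <=
  (\sum_(t | P t) m t) *
    (ln (\sum_(t | P t) b t) - ln (\sum_(t | P t) m t)).
Proof.
move=> m0 b0 mb M0; set M := \sum_(t | P t) m t; set B := \sum_(t | P t) b t.
have [t0 Pt0 mt0] : exists2 t, P t & 0 < m t.
  apply: contrapT => h; suff : M = 0 by move=> E; rewrite -/M E ltxx in M0.
  apply: big1 => t Pt; apply/eqP; rewrite eq_le m0// andbT leNgt.
  by apply/negP => mt; apply: h; exists t.
have B0 : 0 < B.
  rewrite /B (bigD1 t0)//= ltr_pwDl ?mb//.
  by apply: sumr_ge0 => t /andP[Pt _]; exact: b0.
suff : \sum_(t | P t) m t * (ln (b t) - ln (m t) - (ln B - ln M)) <= 0.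
  under eq_bigr do rewrite mulrBr.
  by rewrite sumrB -mulr_suml subr_le0.
apply: (@le_trans _ _ (\sum_(t | P t) (b t * (M / B) - m t))); last first.
  by rewrite sumrB -mulr_suml -/B -/M mulrCA divff ?gt_eqF// mulr1 subrr.
apply: ler_sum => t Pt; have [m_gt0|] := ltP 0 (m t); last first.
  move=> m_le0; have -> : m t = 0 by apply/eqP; rewrite eq_le m_le0 m0.
  rewrite mul0r subr0 mulr_ge0 ?b0// divr_ge0 ?ltW//.
have bt := mb _ Pt m_gt0.
have MB0 : 0 < M / B by rewrite divr_gt0.
have bMB0 : 0 < b t * (M / B) by rewrite mulr_gt0.
have -> : ln (b t) - ln (m t) - (ln B - ln M) = ln (1 + (b t * (M / B) / m t - 1)).
  rewrite [1 + _]addrCA subrr addr0 ln_div ?posrE// lnM ?posrE// ln_div ?posrE//.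
  by ring.
apply: (@le_trans _ _ (m t * (b t * (M / B) / m t - 1))).
  rewrite ler_pM2l//; apply: le_ln1Dx.
  by rewrite -subr_gt0 opprK subrK divr_gt0.
by rewrite mulrBr mulr1 mulrCA divff ?gt_eqF// mulr1.
Qed.

(** The mass of [b] may be below 1, as happens for the channel of [join_entropy_close]. *)
Lemma gibbs (T : finType) (m b : T -> R) :
  (forall t, 0 <= m t) -> (forall t, 0 <= b t) ->
  (forall t, 0 < m t -> 0 < b t) -> \sum_t m t = 1 -> \sum_t b t <= 1 ->
  \sum_t - (m t * ln (m t)) <= \sum_t - (m t * ln (b t)).
Proof.
move=> m0 b0 mb M1 B1; have := @log_sum T xpredT m b; rewrite M1 ln1 subr0 mul1r.
move=> /(_ (fun t _ => m0 t) (fun t _ => b0 t) (fun t _ => mb t) ltr01) h.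
rewrite -subr_le0 -sumrB; apply: le_trans (ln_le0 B1).
rewrite (le_trans _ h)// le_eqVlt; apply/orP; left; apply/eqP.
by apply: eq_bigr => t _; ring.
Qed.

End LogSum.

Section Fekete.
Variable R : realType.
Local Open Scope ereal_scope.

Lemma fekete_bound (b : nat -> \bar R) (n0 m : nat) : (0 < m)%N -> (n0 <= m)%N ->
  (forall n, (n0 <= n)%N -> b n < +oo) ->
  (forall n k, (n0 <= n)%N -> (n0 <= k)%N -> b (n + k)%N <= b n + b k) ->
  limn_esup (fun n => n%:R^-1%:E * b n) <= m%:R^-1%:E * b m.
Proof.
move=> m0 n0m boo bD.
have mR : (0 < m%:R :> R)%R by rewrite ltr0n.
have [bm|bm] := eqVneq (b m) -oo.
  rewrite bm gt0_muleNy ?lte_fin ?invr_gt0//.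
  suff <- : limn_esup (fun _ : nat => -oo : \bar R) = -oo.
    apply: (@le_limn_esup _ _ _ (m + n0)) => n mn.
    have n_gt0 : (0 < n)%N by apply: leq_trans mn; rewrite addn_gt0 m0.
    have : b n <= -oo.
      rewrite -(subnKC (leq_trans (leq_addr n0 m) mn)).
      apply: (le_trans (bD _ _ n0m _)); last by rewrite bm addNye.
      by rewrite leq_subRL ?(leq_trans (leq_addr n0 m) mn)// (leq_trans _ mn).
    by rewrite leeNy_eq => /eqP ->; rewrite gt0_muleNy// lte_fin invr_gt0 ltr0n.
  apply: (cvg_limn_einf_sup _).2; exact: cvg_cst.
have [r br] : exists r, b m = r%:E.
  by have := boo _ n0m; move: bm; case: (b m) => // r _ _; exists r.
have [M hM] : exists M : R, (0 <= M)%R /\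
    forall k, (m <= k < m + m)%N -> b k <= M%:E.
  suff H : forall j, exists M : R, (0 <= M)%R /\
      forall k, (m <= k < m + j)%N -> b k <= M%:E by exact: H.
  elim => [|j [M [M0 hM]]].
    by exists 0%R; split => // k; rewrite addn0 ltnNge; case: leqP.
  have : b (m + j)%N < +oo by apply: boo; rewrite (leq_trans n0m)// leq_addr.
  case E : (b (m + j)%N) => [s| |] // _.
    exists (Num.max M s); split; first by rewrite le_max M0.
    move=> k /andP[mk]; rewrite addnS ltnS leq_eqVlt => /orP[/eqP ->|kj].
      by rewrite E lee_fin le_max lexx orbT.
    by apply: (le_trans (hM k _)); rewrite ?mk// lee_fin le_max lexx.
  exists M; split => // k /andP[mk]; rewrite addnS ltnS leq_eqVlt => /orP[/eqP ->|kj].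
    by rewrite E leNye.
  by apply: hM; rewrite mk.
have bq q k : (m <= k)%N -> b (q * m + k)%N <= (q%:R * r)%:E + b k.
  move=> mk; elim: q => [|q IH]; first by rewrite mul0n add0n mul0r add0e.
  rewrite mulSn -addnA; apply: (le_trans (bD _ _ n0m _)).
    by rewrite (leq_trans n0m)// (leq_trans mk)// leq_addl.
  rewrite br -natr1 mulrDl mul1r [(_ * r + r)%R]addrC EFinD -addeA.
  by rewrite leeD2l.
(* The exact share n r / m exceeds q r by (k/m) r, which is at most 2|r| in absolute value as k <
   2m; M bounds b k. *)
pose K := (M + 2 * `|r|)%R.
rewrite br -EFinM.
have lim : (fun n : nat => (m%:R^-1 * r + n%:R^-1 * K)%:E) @ \oo --> (m%:R^-1 * r)%:E.
  apply: cvg_EFin; first exact: nearW.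
  rewrite [X in _ --> X](_ : _ = m%:R^-1 * r + 0 * K)%R; last by rewrite mul0r addr0.
  apply: cvgD; first exact: cvg_cst.
  apply: cvgMr_tmp; apply/gtr0_cvgV0; last exact: cvgr_idn.
  by exists 1%N => // n /= n1; rewrite ltr0n.
rewrite -[leRHS](cvg_limn_einf_sup lim).2.
apply: (@le_limn_esup _ _ _ m) => n mn.
have n_gt0 : (0 < n)%N by exact: leq_trans mn.
have nR : (0 < n%:R :> R)%R by rewrite ltr0n.
pose q := (n %/ m).-1; pose k := (n %% m + m)%N.
have q1 : (0 < n %/ m)%N by rewrite divn_gt0.
have nE : n = (q * m + k)%N.
  rewrite {1}(divn_eq n m) -(prednK q1) mulSn /q /k; lia.
have kM : b k <= M%:E.
  by apply: hM.2; rewrite /k leq_addl addnC ltn_add2l ltn_mod.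
have k2m : (k < 2 * m)%N by rewrite /k mul2n -addnn ltn_add2r ltn_mod.
have bn : b n <= (q%:R * r + M)%:E.
  rewrite {1}nE; apply: (le_trans (bq _ _ _)); first by rewrite /k leq_addl.
  by rewrite EFinD leeD2l.
apply: (le_trans (lee_wpmul2l _ bn)); first by rewrite lee_fin invr_ge0 ltW.
rewrite -EFinM lee_fin -(@ler_pM2l _ n%:R)// mulVKf ?gt_eqF//.
rewrite mulrDr mulVKf ?gt_eqF//.
have -> : (n%:R * (m%:R^-1 * r) = q%:R * r + k%:R / m%:R * r)%R.
  by rewrite {1}nE natrD natrM; field; rewrite gt_eqF.
have : (`|k%:R / m%:R * r| <= 2 * `|r|)%R.
  rewrite normrM ler_wpM2r// ger0_norm ?divr_ge0//.
  by rewrite ler_pdivrMr// -natrM ler_nat ltnW.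
by rewrite ler_norml /K => /andP[]; lra.
Qed.

(* The constant [C] is absorbed by running Fekete on [a n + C]. *)
Lemma fekete_cvg (a : nat -> \bar R) (n0 : nat) (C : R) :
  (forall n, (n0 <= n)%N -> a n < +oo) ->
  (forall n k, (n0 <= n)%N -> (n0 <= k)%N -> a (n + k)%N <= a n + a k + C%:E) ->
  (fun n => n%:R^-1%:E * a n) @ \oo --> limn_esup (fun n => n%:R^-1%:E * a n).
Proof.
move=> aoo aD; set u := fun n => _.
pose b n := a n + C%:E.
have boo n : (n0 <= n)%N -> b n < +oo by move=> h; rewrite /b lte_add_pinfty ?ltry ?aoo.
have bD n k : (n0 <= n)%N -> (n0 <= k)%N -> b (n + k)%N <= b n + b k.
  by move=> h1 h2; rewrite /b addeA leeD2r// addeAC aD.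
(* The value +oo at small n makes [limn_esup v <= v m] true for every m, as the convergence
   criterion requires. *)
pose v n := if (n < maxn 1 n0)%N then +oo else n%:R^-1%:E * b n.
have vE n : (maxn 1 n0 <= n)%N -> v n = n%:R^-1%:E * b n.
  by move=> h; rewrite /v ltnNge h.
have vcvg : v @ \oo --> limn_esup v.
  apply: limn_esup_le_cvg => // m.
  rewrite (@eq_limn_esup _ _ (fun n => n%:R^-1%:E * b n) (maxn 1 n0))//.
  rewrite /v; case: ltnP => [_|]; first exact: leey.
  by rewrite geq_max => /andP[m1 m2]; exact: (@fekete_bound b n0).
have C0 : (fun n : nat => (- (n%:R^-1 * C))%:E) @ \oo --> 0%:E.
  apply: cvg_EFin; first exact: nearW.
  rewrite -[X in _ --> X]oppr0; apply: cvgN.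
  rewrite -[X in _ --> X](mul0r C); apply: cvgMr_tmp; apply/gtr0_cvgV0; last exact: cvgr_idn.
  by exists 1%N => // n /= n1; rewrite ltr0n.
suff H : u @ \oo --> limn_esup v by rewrite (cvg_limn_einf_sup H).2.
rewrite -[limn_esup v]adde0.
have : v \+ (fun n : nat => (- (n%:R^-1 * C))%:E) @ \oo --> limn_esup v + 0.
  by apply: cvgeD => //; rewrite fin_num_adde_defl.
apply: cvg_trans; apply: near_eq_cvg; near=> n => /=.
have h : (maxn 1 n0 <= n)%N by near: n; exists (maxn 1 n0).
rewrite vE// /u /b muleDr// ?fin_num_adde_defl// -EFinM EFinN addeK//.
Unshelve. all: by end_near. Qed.

End Fekete.

(** * Cylinders and Borel sets of the sequence space *)

Definition determined (n : nat) (A : set seqspace) :=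
  forall x y : seqspace, mkseq x n = mkseq y n -> A x -> A y.

Lemma eq_mkseqP (x y : seqspace) n :
  mkseq x n = mkseq y n <-> forall i, (i < n)%N -> x i = y i.
Proof.
split=> [xy i ilt|xy].
  by have := congr1 (nth 0%N ^~ i) xy; rewrite !nth_mkseq.
by apply: (@eq_from_nth _ 0%N); rewrite !size_mkseq// => i ilt; rewrite !nth_mkseq// xy.
Qed.

Lemma take_mkseq (x : nat -> nat) m n : (m <= n)%N -> take m (mkseq x n) = mkseq x m.
Proof.
by move=> mn; rewrite /mkseq -map_take take_iota; congr (map _ (iota _ _)); apply/minn_idPl.
Qed.

Lemma determined_le m n A : (m <= n)%N -> determined m A -> determined n A.
Proof.
by move=> mn dA x y xy; apply: dA; rewrite -(take_mkseq x mn) -(take_mkseq y mn) xy.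
Qed.

Lemma determinedC n A : determined n A -> determined n (~` A).
Proof. by move=> dA x y xy nAx Ay; apply: nAx; apply: dA Ay. Qed.

Lemma determinedU n A B : determined n A -> determined n B -> determined n (A `|` B).
Proof.
by move=> dA dB x y xy [h|h]; [left; apply: dA h|right; apply: dB h].
Qed.

Lemma iter_shiftE n (x : seqspace) i : iter n shift x i = x (n + i)%N.
Proof. by elim: n i => // n IH i /=; rewrite /shift IH addnS. Qed.

(** Cylinder of the full sequence space, where the measures live, in contrast with
    [cylinder X w]. *)
Definition cyl (w : seq nat) : set seqspace := [set x | mkseq x (size w) = w].

Lemma cyl_mkseq (x : seqspace) n : cyl (mkseq x n) x.
Proof. by rewrite /cyl /= size_mkseq. Qed.

Lemma cylE (x y : seqspace) n : cyl (mkseq x n) y <-> mkseq y n = mkseq x n.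
Proof. by rewrite /cyl /= size_mkseq. Qed.

Lemma cyl_determined w : determined (size w) (cyl w).
Proof. by move=> x y; rewrite /cyl /= => ->. Qed.

(** The sets containing a cylinder around x form a filter. Convergence in the product topology is
    tested on single coordinates, so this filter converges to x and contains every neighbourhood of
    x. *)
Lemma nbhs_cyl (x : seqspace) (U : set seqspace) : nbhs x U ->
  exists n, cyl (mkseq x n) `<=` U.
Proof.
pose F : set_system seqspace := [set U | exists n, cyl (mkseq x n) `<=` U].
have Ff : Filter F.
  split.
  - by exists 0%N.
  - move=> A B [m mA] [n nB]; exists (maxn m n) => y /cylE/esym xy; split.
      by apply: mA; apply/cylE/esym; rewrite -(take_mkseq x (leq_maxl m n)) xy take_mkseq ?leq_maxl.
    by apply: nB; apply/cylE/esym; rewrite -(take_mkseq x (leq_maxr m n)) xy take_mkseq ?leq_maxr.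
  - by move=> A B AB [n nA]; exists n; exact: (subset_trans nA).
have : F --> (x : seqspace).
  apply/cvg_sup => i A; rewrite nbhsE => -[B [[V oV VB] Bx] BA].
  exists i.+1 => y /cylE/eq_mkseqP/(_ i (ltnSn i)) xy; apply: BA.
  by move: Bx; rewrite -VB /preimage /= xy.
exact.
Qed.

Lemma cyl_open w : open (cyl w).
Proof.
have -> : cyl w = \bigcap_(i in `I_(size w)) [set x : seqspace | x i = nth 0%N w i].
  apply/seteqP; split => x.
    by move=> xw i /= ilt; rewrite -xw nth_mkseq.
  move=> h; apply: (@eq_from_nth _ 0%N); rewrite size_mkseq// => i ilt.
  by rewrite nth_mkseq// h.
elim: (size w) => [|n IH]; first by rewrite II0 bigcap_set0; exact: openT.
rewrite IIS bigcap_setU; apply: openI => //; rewrite bigcap_set1.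
have -> : [set x : seqspace | x n = nth 0%N w n] =
    (fun x : seqspace => x n) @^-1` [set nth 0%N w n] by [].
apply: open_comp => [x _|]; last exact: discrete_open.
exact: (@proj_continuous nat (fun=> nat) n).
Qed.

(** Countable enumeration, through the coding of words by numbers, of the cylinders inside [A];
    indices that code nothing suitable give the empty set. *)
Definition inner_cyl (A : set seqspace) (n : nat) : set seqspace :=
  if (unpickle n : option (seq nat)) is Some w then
    if asbool (cyl w `<=` A) then cyl w else set0 else set0.

Lemma cyl_bigcup (A : set seqspace) :
  (forall x, A x -> exists n, cyl (mkseq x n) `<=` A) ->
  A = \bigcup_n inner_cyl A n.
Proof.
move=> hA; apply/seteqP; split => x.
  move=> /hA[n nA]; exists (pickle (mkseq x n)) => //; rewrite /inner_cyl pickleK.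
  by rewrite asboolT//; exact: cyl_mkseq.
by case=> n _; rewrite /inner_cyl; case: unpickle => // w; case: asboolP => // wA /wA.
Qed.

Lemma open_cyl_bigcup (A : set seqspace) : open A ->
  A = \bigcup_n inner_cyl A n.
Proof.
by move=> oA; apply: cyl_bigcup => x Ax; apply: nbhs_cyl; exact: open_nbhs_nbhs.
Qed.

Lemma determined_cyl_bigcup n A : determined n A ->
  A = \bigcup_n inner_cyl A n.
Proof.
by move=> dA; apply: cyl_bigcup => x Ax; exists n => y /cylE/esym xy; exact: dA Ax.
Qed.

Lemma borel_cyl : (@measurable _ borelspace) = <<s range cyl >>.
Proof.
apply/seteqP; split; apply: smallest_sub.
- exact: smallest_sigma_algebra.
- move=> A oA; rewrite (open_cyl_bigcup oA).
  have sA := @smallest_sigma_algebra _ setT (range cyl).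
  case: (sA) => s0 sC sU; apply: sU => n.
  rewrite /inner_cyl; case: unpickle => // w; case: asboolP => // _.
  by apply: sub_sigma_algebra; exists w.
- exact: smallest_sigma_algebra.
- by move=> _ [w _ <-]; apply: sub_sigma_algebra; exact: cyl_open.
Qed.

Lemma measurable_cyl w : measurable (cyl w : set borelspace).
Proof. by rewrite borel_cyl; apply: sub_sigma_algebra; exists w. Qed.

Lemma measurable_determined n (A : set borelspace) : determined n A -> measurable A.
Proof.
move=> dA; rewrite (determined_cyl_bigcup dA); apply: bigcupT_measurable => k.
by rewrite /inner_cyl; case: unpickle => // w; case: asboolP => // _; exact: measurable_cyl.
Qed.

Lemma measurable_closed (A : set borelspace) : @closed seqspace A -> measurable A.
Proof.
move=> cA; rewrite -[A]setCK; apply: measurableC.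
by apply: sub_sigma_algebra; exact: closed_openC.
Qed.

Lemma measurable_fun_cyl d (T : measurableType d) (F : T -> borelspace) :
  (forall w, measurable (F @^-1` cyl w)) -> measurable_fun setT F.
Proof.
move=> h; apply: (@measurability _ _ _ _ setT F (range cyl) borel_cyl) => _ [_ [w _ <-] <-].
by rewrite setTI.
Qed.

Lemma measurable_fun_determined (F : borelspace -> borelspace) :
  (forall n, exists m, forall x y, mkseq x m = mkseq y m ->
     mkseq (F x) n = mkseq (F y) n) -> measurable_fun setT F.
Proof.
move=> h; apply: measurable_fun_cyl => w; have [m hm] := h (size w).
by apply: (@measurable_determined m) => x y /hm; rewrite /preimage /cyl /= => ->.
Qed.

Lemma measurable_iter_shift n : measurable_fun setT (iter n shift : borelspace -> borelspace).
Proof.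
apply: measurable_fun_determined => m; exists (n + m)%N => x y /eq_mkseqP xy.
by apply/eq_mkseqP => i im; rewrite !iter_shiftE xy// ltn_add2l.
Qed.

Lemma measurable_shift : measurable_fun setT (shift : borelspace -> borelspace).
Proof. exact: (measurable_iter_shift 1). Qed.

Lemma measurable_one_block p : measurable_fun setT (one_block p : borelspace -> borelspace).
Proof.
apply: measurable_fun_determined => m; exists m => x y /eq_mkseqP xy.
by apply/eq_mkseqP => i im; rewrite /one_block /= xy.
Qed.

Lemma measurable_preimage d d' (T : measurableType d) (T' : measurableType d')
  (F : T -> T') A : measurable_fun setT F -> measurable A -> measurable (F @^-1` A).
Proof. by move=> mF mA; rewrite -[X in measurable X]setTI; exact: mF. Qed.

(** Two cylinders are nested or disjoint, so cylinders together with the empty set are stable under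
    intersection and generate the Borel sets. *)
Lemma eq_measure_cyl (R : realType) (m1 m2 : {measure set borelspace -> \bar R}) :
  (forall w, m1 (cyl w) = m2 (cyl w)) -> (m1 setT < +oo)%E ->
  forall A, measurable A -> m1 A = m2 A.
Proof.
move=> m12 fin A mA.
refine (@measure_unique _ R borelspace (range cyl `|` [set set0]) (fun _ => setT)
  _ _ _ _ m1 m2 _ _ A mA).
- rewrite borel_cyl; apply/seteqP; split.
    apply: smallest_sub; first exact: smallest_sigma_algebra.
    by move=> {mA} {}A h; apply: sub_sigma_algebra; left.
  apply: smallest_sub; first exact: smallest_sigma_algebra.
  move=> {mA} {}A [h|->]; first exact: sub_sigma_algebra.
  by have [] := @smallest_sigma_algebra _ setT (range cyl).
- move=> {mA} {}A B [[u _ <-]|->]; last by move=> _; right; rewrite set0I.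
  case=> [[v _ <-]|->]; last by right; rewrite setI0.
  have inter (a b : seq nat) : (size a <= size b)%N ->
      cyl a `&` cyl b = cyl b \/ cyl a `&` cyl b = set0.
    move=> ab; have [h|h] := pselect (take (size a) b = a); [left|right].
      apply/seteqP; split => x; first by case.
      by move=> xb; split=> //; rewrite /cyl /= -h -xb take_mkseq// size_mkseq.
    apply/seteqP; split => x //= -[xa xb]; apply: h; rewrite -[in RHS]xa -xb.
    by rewrite take_mkseq// xb.
  have [uv|vu] := leqP (size u) (size v).
    by have [->|->] := inter _ _ uv; [left; exists v|right].
  by rewrite setIC; have [->|->] := inter _ _ (ltnW vu); [left; exists u|right].
- by move=> i; left; exists [::] => //; apply/seteqP; split.
- by apply/seteqP; split => // x _; exists 0%N.
- by move=> {mA} {}A [[w _ <-]//|->]; rewrite !measure0.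
- by [].
Qed.

(** * Probabilities and integrals *)

Lemma max_subN (R : realDomainType) (a : R) : a = Num.max a 0 - Num.max (- a) 0.
Proof.
have [a0|a0] := leP a 0.
  by rewrite (max_idPl _) ?oppr_ge0// sub0r opprK.
by rewrite (max_idPr _) ?subr0// oppr_le0 ltW.
Qed.

Section Probability.
Context d (T : measurableType d) (R : realType) (mu : probability T R).
Local Open Scope ereal_scope.

Definition pr (A : set T) : R := fine (mu A).

Lemma prE A : measurable A -> mu A = (pr A)%:E.
Proof.
move=> mA; rewrite /pr fineK// ge0_fin_numE//.
by apply: le_lt_trans (probability_le1 _ mA) _; rewrite ltry.
Qed.

Lemma pr_ge0 A : (0 <= pr A)%R.
Proof. by rewrite /pr fine_ge0. Qed.

Lemma pr_setT : pr setT = 1%R.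
Proof. by rewrite /pr probability_setT. Qed.

Lemma pr_set0 : pr set0 = 0%R.
Proof. by rewrite /pr measure0. Qed.

Lemma le_pr A B : measurable A -> measurable B -> A `<=` B -> (pr A <= pr B)%R.
Proof.
by move=> mA mB AB; rewrite -lee_fin -!prE//; apply: le_measure; rewrite ?inE.
Qed.

Lemma pr_le1 A : measurable A -> (pr A <= 1)%R.
Proof. by move=> mA; rewrite -pr_setT le_pr. Qed.

Lemma prU2 A B : measurable A -> measurable B -> (pr (A `|` B) <= pr A + pr B)%R.
Proof.
move=> mA mB; rewrite -lee_fin EFinD -!prE//; first exact: measureU2.
exact: measurableU.
Qed.

Lemma prC A : measurable A -> pr (~` A) = (1 - pr A)%R.
Proof.
move=> mA; apply: EFin_inj; rewrite -prE ?probability_setC//; last exact: measurableC.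
by rewrite prE.
Qed.

Lemma prU A B : measurable A -> measurable B -> A `&` B = set0 ->
  (pr (A `|` B) = pr A + pr B)%R.
Proof.
move=> mA mB AB; apply: EFin_inj; rewrite EFinD -!prE//; last exact: measurableU.
exact: measureU.
Qed.

Lemma measurable_fiber_seq (I : eqType) (tau : T -> I) A (s : seq I) : measurable A ->
  (forall i, measurable (tau @^-1` [set i])) ->
  measurable (A `&` [set x | tau x \in s]).
Proof.
move=> mA mtau; elim: s => [|i s IH].
  by rewrite (_ : [set x | _] = set0) ?setI0//; apply/seteqP; split.
rewrite (_ : _ `&` _ = (A `&` tau @^-1` [set i]) `|` (A `&` [set x | tau x \in s])).
  by apply: measurableU => //; exact: measurableI.
rewrite -setIUr; congr (_ `&` _); apply/seteqP; split => x /=; rewrite in_cons.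
  by case/orP => [/eqP|]; [left|right].
by case=> [->|->]; rewrite ?eqxx ?orbT.
Qed.

Lemma pr_fibers_seq (I : eqType) (tau : T -> I) A (s : seq I) : measurable A ->
  (forall i, measurable (tau @^-1` [set i])) -> uniq s ->
  (\sum_(i <- s) pr (A `&` tau @^-1` [set i]) = pr (A `&` [set x | tau x \in s]))%R.
Proof.
move=> mA mtau; elim: s => [|i s IH] /=.
  rewrite big_nil (_ : [set x | _] = set0) ?setI0 ?pr_set0//.
  by apply/seteqP; split.
case/andP => iNs us; rewrite big_cons IH// -prU//; first last.
- apply/seteqP; split => x //= -[[_ ->] [_ iins]]; by rewrite iins in iNs.
- exact: measurable_fiber_seq.
- exact: measurableI.
congr pr; rewrite -setIUr; congr (_ `&` _); apply/seteqP; split => x /=; rewrite in_cons.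
  by case=> [->|->]; rewrite ?eqxx ?orbT.
by case/orP => [/eqP|]; [left|right].
Qed.

Lemma pr_fibers (I : finType) (tau : T -> I) A : measurable A ->
  (forall i, measurable (tau @^-1` [set i])) ->
  (\sum_i pr (A `&` tau @^-1` [set i]) = pr A)%R.
Proof.
move=> mA mtau; rewrite pr_fibers_seq ?index_enum_uniq//.
by congr pr; apply/seteqP; split => [x []//|x Ax]; split => //=; rewrite mem_index_enum.
Qed.

Lemma pr_full A B : measurable A -> measurable B -> pr B = 1%R -> pr (A `&` B) = pr A.
Proof.
move=> mA mB B1; apply/eqP; rewrite eq_le le_pr//=; last exact: measurableI.
apply: (@le_trans _ _ (pr ((A `&` B) `|` (~` B)))).
  apply: le_pr => //; first by apply: measurableU; [exact: measurableI|exact: measurableC].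
  by move=> x Ax; have [Bx|nBx] := pselect (B x); [left|right].
apply: (le_trans (prU2 _ _)); [exact: measurableI|exact: measurableC|].
by rewrite (prC mB) B1 subrr addr0.
Qed.

Lemma ae_full A (P : T -> Prop) : measurable A -> pr A = 1%R ->
  (forall x, A x -> P x) -> {ae mu, forall x, P x}.
Proof.
move=> mA A1 AP; exists (~` A); split; first exact: measurableC.
  by rewrite prE ?prC ?A1 ?subrr//; exact: measurableC.
by move=> x /= nP Ax; apply: nP; exact: AP.
Qed.

Lemma ae_le_integral (D : set T) (u v : T -> \bar R) : measurable D ->
  measurable_fun D u -> measurable_fun D v ->
  {ae mu, forall x, D x -> u x <= v x} ->
  \int[mu]_(x in D) u x <= \int[mu]_(x in D) v x.
Proof.
move=> mD mu_ mv uv; rewrite integralE [leRHS]integralE; apply: leeB.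
  apply: ae_ge0_le_integral => //; [exact: measurable_funepos|exact: measurable_funepos|].
  case: uv => N [mN N0 h]; exists N; split=> // x /= nle; apply: h => /= uv; apply: nle => Dx.
  by rewrite !funeposE ge_max !le_max uv// lexx orbT.
apply: ae_ge0_le_integral => //; [exact: measurable_funeneg|exact: measurable_funeneg|].
case: uv => N [mN N0 h]; exists N; split=> // x /= nle; apply: h => /= uv; apply: nle => Dx.
by rewrite !funenegE ge_max !le_max leeN2 uv// lexx orbT.
Qed.

Lemma integral_cst_full (D : set T) (c : R) : measurable D -> mu D = 1 ->
  \int[mu]_(x in D) (cst c%:E) x = c%:E.
Proof. by move=> mD D1; rewrite integral_cst// -[RHS]mule1; congr (_ * _); exact: D1. Qed.

Lemma measurable_fun_fintype (I : finType) (tau : T -> I) (r : I -> \bar R) D :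
  (forall i, measurable (tau @^-1` [set i])) ->
  measurable_fun D (fun x => r (tau x)).
Proof.
move=> mtau mD A mA.
rewrite (_ : D `&` _ = D `&` [set x | tau x \in [seq i <- enum I | r i \in A]]).
  exact: measurable_fiber_seq.
by congr (_ `&` _); apply/seteqP; split => x /=;
  rewrite mem_filter mem_enum andbT inE.
Qed.

Lemma integral_fintype (I : finType) (tau : T -> I) (r : I -> R) D : measurable D ->
  (forall i, measurable (tau @^-1` [set i])) ->
  \int[mu]_(x in D) (r (tau x))%:E =
  (\sum_i r i * pr (D `&` tau @^-1` [set i]))%:E.
Proof.
move=> mD mtau.
have DE : \big[setU/set0]_(i <- index_enum I) (D `&` tau @^-1` [set i]) = D.
  rewrite -big_distrr/=; apply/seteqP; split => [x []//|x Dx]; split => //.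
  by rewrite (bigD1_seq (tau x)) ?mem_index_enum ?index_enum_uniq//=; left.
rewrite -[X in \int[mu]_(x in X) _]DE integral_bigsetU_EFin ?index_enum_uniq//=.
- rewrite -sumEFin; apply: eq_bigr => i _.
  rewrite (eq_integral (cst (r i)%:E)) ?integral_cst//.
  + by rewrite EFinM -prE//; exact: measurableI.
  + exact: measurableI.
  + by move=> x; rewrite inE => -[_ /= ->].
- by move=> i; exact: measurableI.
- by apply/trivIsetP => i j _ _ /eqP ij; apply/seteqP; split => x //= -[[_ ->] [_]].
- by rewrite DE; exact: (@measurable_fun_fintype _ _ (fun i => (r i)%:E)).
Qed.

(** Subtraction-free form of the additivity of positive and negative parts, true at the value -oo as
    well; integrating it yields [upper_integralD]. *)
Lemma funepos_leD (u v : T -> \bar R) x : u x < +oo -> v x < +oo ->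
  (fun y => u y + v y)^\+ x + (u^\- x + v^\- x) =
  (fun y => u y + v y)^\- x + (u^\+ x + v^\+ x).
Proof.
rewrite !funeposE !funenegE.
case: (u x) => [a| |] // _; case: (v x) => [b| |] // _.
- rewrite -!EFinD -!EFinN -!EFin_max -!EFinD; congr EFin.
  have := max_subN a; have := max_subN b; have := max_subN (a + b)%R; lra.
- rewrite addeNy maxNye /= !maxye. by rewrite -!EFin_max.
- rewrite addNye maxNye /= !maxye. by rewrite -!EFin_max.
- by rewrite addNye maxNye /= !maxye.
Qed.

(** The integral may be -oo. Finiteness of the positive part is what keeps integrals additive and
    below +oo. *)
Definition upper_integrable (D : set T) (u : T -> \bar R) :=
  measurable_fun D u /\ \int[mu]_(x in D) (u^\+ x) < +oo.

Lemma upper_integral_lty D u : upper_integrable D u -> \int[mu]_(x in D) u x < +oo.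
Proof.
case=> mu_ uoo; rewrite integralE.
have : 0 <= \int[mu]_(x in D) u^\- x by apply: integral_ge0.
move: uoo; have : 0 <= \int[mu]_(x in D) u^\+ x by apply: integral_ge0.
case: (\int[mu]_(x in D) u^\+ x) => [a| |]//= _ _.
by case: (\int[mu]_(x in D) u^\- x) => [b| |]//= _; rewrite ltry.
Qed.

Lemma upper_integralD D u v : measurable D ->
  (forall x, D x -> u x < +oo) -> (forall x, D x -> v x < +oo) ->
  upper_integrable D u -> upper_integrable D v ->
  \int[mu]_(x in D) (u x + v x) = \int[mu]_(x in D) u x + \int[mu]_(x in D) v x.
Proof.
move=> mD ufin vfin [mu_ uoo] [mv voo].
have muv : measurable_fun D (fun x => u x + v x) by exact: emeasurable_funD.
have uvoo : \int[mu]_(x in D) ((fun y => u y + v y)^\+ x) < +oo.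
  apply: (@le_lt_trans _ _ (\int[mu]_(x in D) (u^\+ x + v^\+ x))).
    apply: ge0_le_integral => //.
    - exact: measurable_funepos.
    - by apply: emeasurable_funD; exact: measurable_funepos.
    - move=> x Dx; rewrite !funeposE ge_max; apply/andP; split.
        by apply: leeD; rewrite le_max lexx.
      by apply: adde_ge0; rewrite le_max lexx orbT.
  rewrite ge0_integralD//; [|exact: measurable_funepos|exact: measurable_funepos].
  exact: lte_add_pinfty.
have : \int[mu]_(x in D) ((fun y => u y + v y)^\+ x + (u^\- x + v^\- x)) =
       \int[mu]_(x in D) ((fun y => u y + v y)^\- x + (u^\+ x + v^\+ x)).
  by apply: eq_integral => x; rewrite inE => Dx; apply: funepos_leD; [exact: ufin|exact: vfin].
have D3 (f g h : T -> \bar R) : measurable_fun D f -> measurable_fun D g -> measurable_fun D h ->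
    (forall x, 0 <= f x) -> (forall x, 0 <= g x) -> (forall x, 0 <= h x) ->
    \int[mu]_(x in D) (f x + (g x + h x)) =
    \int[mu]_(x in D) f x + (\int[mu]_(x in D) g x + \int[mu]_(x in D) h x).
  move=> mf mg mh f0 g0 h0; rewrite ge0_integralD//.
  - by rewrite ge0_integralD.
  - by move=> x _; exact: adde_ge0.
  - exact: emeasurable_funD.
have mp := @measurable_funepos; have mn := @measurable_funeneg.
rewrite !D3//; try (by [exact: mp | exact: mn]).
rewrite [in X in _ -> _ = X]integralE [X in _ -> _ = _ + X]integralE [X in _ -> X = _]integralE.
have p (f : T -> \bar R) : 0 <= \int[mu]_(x in D) f^\+ x by apply: integral_ge0.
have n (f : T -> \bar R) : 0 <= \int[mu]_(x in D) f^\- x by apply: integral_ge0.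
move: uoo voo uvoo (p u) (p v) (p (fun y => u y + v y)) (n u) (n v) (n (fun y => u y + v y)).
move: (\int[mu]_(x in D) u^\+ x) (\int[mu]_(x in D) v^\+ x)
  (\int[mu]_(x in D) (fun y => u y + v y)^\+ x)
  (\int[mu]_(x in D) u^\- x) (\int[mu]_(x in D) v^\- x)
  (\int[mu]_(x in D) (fun y => u y + v y)^\- x).
move=> [a| |] [b| |] [c| |] // [a'| |] [b'| |] [c'| |] //= _ _ _ _ _ _ _ _ _.
by move=> [h]; rewrite -!EFinD; congr EFin; lra.
Qed.

End Probability.

Section Invariance.
Variable R : realType.
Implicit Types mu : probability borelspace R.

Definition shift_invariant mu :=
  forall A : set borelspace, measurable A -> mu (shift @^-1` A) = mu A.

Lemma shift_invariant_iter mu n (A : set borelspace) : shift_invariant mu -> measurable A ->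
  mu (iter n shift @^-1` A) = mu A.
Proof.
move=> inv; elim: n A => // n IH A mA.
rewrite -[RHS]inv// -[RHS]IH; last exact: measurable_preimage measurable_shift mA.
by congr (mu _); apply/seteqP; split => x; rewrite /preimage /= -iterSr.
Qed.

Lemma pr_shift mu n (A : set borelspace) : shift_invariant mu -> measurable A ->
  pr mu (iter n shift @^-1` A) = pr mu A.
Proof. by move=> inv mA; rewrite /pr shift_invariant_iter. Qed.

Local Open Scope ereal_scope.

(** A change of variables gives the integral over the preimage of [S], which contains [S] and
    exceeds it by a null set. *)
Lemma ge0_integral_shift mu n (S : set borelspace) (u : borelspace -> \bar R) :
  shift_invariant mu -> measurable S -> mu S = 1 -> shift @` S `<=` S ->
  measurable_fun S u -> (forall x, S x -> 0 <= u x) ->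
  \int[mu]_(x in S) u (iter n shift x) = \int[mu]_(x in S) u x.
Proof.
move=> inv mS S1 sS mu_ u0.
pose sh : borelspace -> borelspace := iter n shift.
have mi : measurable_fun setT sh by exact: measurable_iter_shift.
have SS : S `<=` sh @^-1` S.
  move=> x Sx; rewrite /sh /preimage /=; elim: n {sh mi} => // n IH /=.
  by apply: sS; exists (iter n shift x).
have mS' : measurable (sh @^-1` S) by exact: measurable_preimage mi mS.
have muc : measurable_fun (sh @^-1` S) (u \o sh).
  have msh : measurable_fun (sh @^-1` S) sh by exact: measurable_funTS.
  by refine (measurable_comp mS _ mu_ msh); move=> _ [x Sx <-].
rewrite -[RHS](@eq_measure_integral _ _ _ _ _ (pushforward mu sh)); last first.
  move=> A mA _. exact: (shift_invariant_iter n inv mA).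
rewrite ge0_integral_pushforward//; last by move=> x; rewrite inE; exact: u0.
have SC0 : mu (~` S) = 0 by rewrite probability_setC// S1 subee.
rewrite [RHS](ge0_negligible_integral (measurableC mS))//; last by move=> x; exact: u0.
by rewrite setDE setCK setIidr.
Qed.

Lemma integral_shift mu n (S : set borelspace) (u : borelspace -> \bar R) :
  shift_invariant mu -> measurable S -> mu S = 1 -> shift @` S `<=` S ->
  measurable_fun S u ->
  \int[mu]_(x in S) u (iter n shift x) = \int[mu]_(x in S) u x.
Proof.
move=> inv mS S1 sS mu_; rewrite integralE [RHS]integralE.
have := @ge0_integral_shift mu n S u^\+ inv mS S1 sS
  (measurable_funepos mu_) (fun x _ => funepos_ge0 u x).
have := @ge0_integral_shift mu n S u^\- inv mS S1 sS
  (measurable_funeneg mu_) (fun x _ => funeneg_ge0 u x).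
by move=> h1 h2; congr (_ - _); [rewrite -h2|rewrite -h1];
  apply: eq_integral => x _; rewrite ?funeposE ?funenegE.
Qed.

End Invariance.

(** * Approximation of Borel partitions *)

Section Approximation.
Variables (R : realType) (mu : probability borelspace R).

Definition symdiff (A B : set borelspace) : set borelspace := (A `\` B) `|` (B `\` A).

Lemma measurable_symdiff A B : measurable A -> measurable B -> measurable (symdiff A B).
Proof. by move=> mA mB; apply: measurableU; exact: measurableD. Qed.

Definition approximable (A : set borelspace) := measurable A /\
  forall e : R, 0 < e -> exists n (B : set borelspace),
    determined n B /\ pr mu (symdiff A B) <= e.

Lemma approximableC A : approximable A -> approximable (~` A).
Proof.
case=> mA h; split => [|e /h[n [B [dB AB]]]]; first exact: measurableC.
exists n, (~` B); split; first exact: determinedC.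
by rewrite /symdiff !setDE !setCK [X in X `|` _]setIC [X in _ `|` X]setIC -!setDE setUC.
Qed.

Lemma approximableU A B : approximable A -> approximable B -> approximable (A `|` B).
Proof.
move=> [mA hA] [mB hB]; split => [|e e0]; first exact: measurableU.
have e2 : 0 < e / 2 by rewrite divr_gt0.
have [n [A' [dA' AA']]] := hA _ e2; have [m [B' [dB' BB']]] := hB _ e2.
have mA' := measurable_determined dA'; have mB' := measurable_determined dB'.
exists (maxn n m), (A' `|` B'); split.
  by apply: determinedU; [exact: determined_le (leq_maxl _ _) dA'|exact: determined_le (leq_maxr _ _) dB'].
rewrite (splitr e); apply: le_trans (lerD AA' BB').
have mAA' := measurable_symdiff mA mA'; have mBB' := measurable_symdiff mB mB'.
apply: le_trans (prU2 mu mAA' mBB'); apply: le_pr => //.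
- by apply: measurable_symdiff; exact: measurableU.
- exact: measurableU.
- move=> x; rewrite /symdiff /setD /setU /=; tauto.
Qed.

(** Continuity from below cuts the union at a finite stage with loss at most e/2; the finite union
    is then approximated within e/2. *)
Lemma approximable_bigcup (A : nat -> set borelspace) :
  (forall k, approximable (A k)) -> approximable (\bigcup_k A k).
Proof.
move=> hA; have mA k := (hA k).1.
have mU : measurable (\bigcup_k A k) by exact: bigcupT_measurable.
split=> // e e0; have e2 : 0 < e / 2 by rewrite divr_gt0.
pose V n := \big[setU/set0]_(k < n) A k.
have aV n : approximable (V n).
  rewrite /V; elim: n => [|n IH]; last by rewrite big_ord_recr; exact: approximableU.
  rewrite big_ord0; split => // d d0; exists 0%N, set0; split => //.
  by rewrite /symdiff setDv setU0 pr_set0 ltW.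
have mV n := (aV n).1.
have VU n : V n `<=` \bigcup_k A k by rewrite /V -bigcup_mkord => x [k _ Akx]; exists k.
have : mu \o V @ \oo --> mu (\bigcup_n V n).
  apply: nondecreasing_cvg_mu => //; first exact: bigcupT_measurable.
  by apply/nondecreasing_seqP => n; apply/subsetPset; rewrite /V big_ord_recr; left.
have -> : \bigcup_n V n = \bigcup_k A k.
  apply/seteqP; split => [x [n _ /VU]//|x [k _ Akx]].
  by exists k.+1 => //; rewrite /V big_ord_recr; right.
rewrite prE// => /fine_cvgP[_ /cvgrPdist_le /(_ _ e2)[N _ /(_ N (leqnn N))]].
rewrite /= -/(pr mu (V N)) => hN.
have [n [B [dB VB]]] := (aV N).2 _ e2.
have mB := measurable_determined dB.
exists n, B; split => //; rewrite (splitr e).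
have mD : measurable ((\bigcup_k A k) `\` V N) by exact: measurableD.
have hD : pr mu ((\bigcup_k A k) `\` V N) <= e / 2.
  have := @prU _ _ _ mu (V N) ((\bigcup_k A k) `\` V N) (mV N) mD.
  rewrite setDIK (setDUK (@VU N)).
  by move=> /(_ erefl) E; move: hN; rewrite E addrAC subrr add0r ger0_norm ?pr_ge0.
apply: le_trans (lerD hD VB).
have mVB := measurable_symdiff (mV N) mB.
apply: le_trans (prU2 mu mD mVB); apply: le_pr => //.
- exact: measurable_symdiff.
- exact: measurableU.
- move=> x; have := @VU N x; have := EM (V N x); rewrite /symdiff /setD /setU /=; tauto.
Qed.

(** The approximable sets form a sigma-algebra that contains the cylinders. *)
Lemma measurable_approximable A : measurable A -> approximable A.
Proof.
rewrite borel_cyl; apply: smallest_sub => [|_ [w _ <-]].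
  split.
  - split=> // d d0; exists 0%N, set0; split => //.
    by rewrite /symdiff setDv setU0 pr_set0 ltW.
  - by move=> B hB; rewrite setTD; exact: approximableC.
  - exact: approximable_bigcup.
split=> [|e e0]; first exact: measurable_cyl.
exists (size w), (cyl w); split; first exact: cyl_determined.
by rewrite /symdiff setDv setU0 pr_set0 ltW.
Qed.

(* On the complement of the sets [symdiff (P @^-1` [set j]) (B j)], the first
   [j] with [x \in B j] is [P x]. *)
Lemma partition_approximable k (P : borelspace -> 'I_k) (e : R) :
  (forall j, measurable (P @^-1` [set j])) -> 0 < e ->
  exists n (Q : borelspace -> 'I_k),
    (forall x y : seqspace, mkseq x n = mkseq y n -> Q x = Q y) /\
    pr mu [set x | P x != Q x] <= e.
Proof.
move=> mP e0.
have k0 : 0 < k%:R :> R by rewrite ltr0n; case: k P {mP} => // P; case: (P point).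
have ek : 0 < e / k%:R by rewrite divr_gt0.
have /choice[g hg] : forall j, exists nB : nat * set borelspace, determined nB.1 nB.2 /\
    pr mu (symdiff (P @^-1` [set j]) nB.2) <= e / k%:R.
  move=> j; have [n [B h]] := (measurable_approximable (mP j)).2 _ ek.
  by exists (n, B).
pose n := (\max_j (g j).1)%N; pose B j := (g j).2.
have dB j : determined n (B j) by apply: determined_le (hg j).1; exact: leq_bigmax.
pose Q x := odflt (P point) [pick j | x \in B j].
have mQ x y : mkseq x n = mkseq y n -> Q x = Q y.
  move=> xy; rewrite /Q; congr odflt; apply: eq_pick => j.
  by apply/idP/idP; rewrite !inE; apply: dB.
exists n, Q; split => //.
have mB j : measurable (symdiff (P @^-1` [set j]) (B j)).
  by apply: measurable_symdiff => //; exact: measurable_determined (dB j).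
have sub : [set x | P x != Q x] `<=`
    \big[setU/set0]_(j <- index_enum 'I_k) symdiff (P @^-1` [set j]) (B j).
  move=> x /= PQ; rewrite -bigcup_seq; apply: contrapT => nU.
  have xB j : x \in B j = (P x == j).
    apply/idP/eqP => [/set_mem xBj|Pxj].
      by apply: contrapT => h; apply: nU; exists j; rewrite /= ?mem_index_enum//; right.
    by apply: mem_set; apply: contrapT => h; apply: nU; exists j; rewrite /= ?mem_index_enum//; left.
  move: PQ; rewrite /Q; case: pickP => [j|h].
    by rewrite xB => /eqP ->; rewrite /= eqxx.
  by have := h (P x); rewrite xB eqxx.
have mPQ : measurable [set x | P x != Q x].
  rewrite (_ : [set x | _] = \big[setU/set0]_(j <- index_enum 'I_k)
     (P @^-1` [set j] `&` ~` (Q @^-1` [set j]))).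
    apply: bigsetU_measurable => j _; apply: measurableI => //; apply: measurableC.
    by apply: (@measurable_determined n) => x y /mQ xy; rewrite /preimage /= xy.
  rewrite -bigcup_seq; apply/seteqP; split => x /=.
    by move=> PQ; exists (P x); rewrite /= ?mem_index_enum//; split => // /esym/eqP; rewrite (negPf PQ).
  by case=> j _ [/= -> /= h]; apply/eqP => /esym.
apply: (le_trans (le_pr mu _ _ sub)) => //; first by apply: bigsetU_measurable.
apply: (@le_trans _ _ (\sum_(j : 'I_k) e / k%:R)); last first.
  by rewrite sumr_const card_ord -(mulr_natr (e / k%:R)) divfK ?gt_eqF.
have : forall s : seq 'I_k, pr mu (\big[setU/set0]_(j <- s) symdiff (P @^-1` [set j]) (B j))
   <= \sum_(j <- s) e / k%:R.
  elim=> [|j s IH]; first by rewrite !big_nil pr_set0.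
  rewrite !big_cons; apply: le_trans (lerD (hg j).2 IH); apply: prU2 => //.
  exact: bigsetU_measurable.
exact.
Qed.

End Approximation.

(** * Bernoulli measures *)

Definition pushforward_prob (R : realType) d d' (T : measurableType d)
    (T' : measurableType d') (P : probability T R) (F : T -> T')
    (mF : measurable_fun setT F) : probability T' R :=
  distribution P (HB.pack F (isMeasurableFun.Build _ _ _ _ F mF) : {mfun T >-> T'}).

Lemma pushforward_probE (R : realType) d d' (T : measurableType d)
    (T' : measurableType d') (P : probability T R) (F : T -> T')
    (mF : measurable_fun setT F) A :
  pushforward_prob P mF A = P (F @^-1` A).
Proof. by []. Qed.

Section Bernoulli.
Variables (R : realType) (q : nat -> R) (K : nat).
Hypothesis q0 : forall a, 0 <= q a.
Hypothesis qK : forall a, (K <= a)%N -> q a = 0.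
Hypothesis q1 : \sum_(a < K) q a = 1.

Let c (a : nat) : R := \sum_(i < a) q i.

Let cS a : c a.+1 = c a + q a.
Proof. by rewrite /c big_ord_recr. Qed.

Let c_le a b : (a <= b)%N -> c a <= c b.
Proof.
move=> /subnK <-; elim: (b - a)%N => // n IH; rewrite addSn cS.
by apply: (le_trans IH); rewrite lerDl.
Qed.

Let c_le1 a : c a <= 1.
Proof.
rewrite -q1 -/(c K); have [/c_le//|Ka] := leqP a K.
rewrite -(subnK (ltnW Ka)); elim: (a - K)%N => // n IH; rewrite addSn cS qK ?addr0//.
exact: leq_addl.
Qed.

(* The full-branch piecewise affine map of [0, 1[ whose branch [a] is
   [c a, c a + q a[; its itineraries are i.i.d. under Lebesgue measure. *)
Let dig (x : R) := find (fun a => x < c a.+1) (iota 0 K).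

Let dmap (x : R) := (x - c (dig x)) / q (dig x).

Let code (x : R) : seqspace := fun n => dig (iter n dmap x).

Let digP x : 0 <= x < 1 -> [/\ (dig x < K)%N, c (dig x) <= x & x < c (dig x).+1].
Proof.
move=> /andP[x0 x1].
have hd : has (fun a => x < c a.+1) (iota 0 K).
  apply/hasP; exists K.-1; last first.
    rewrite prednK; first by rewrite /c q1.
    by case: K q1 => //; rewrite big_ord0 => /esym/eqP; rewrite oner_eq0.
  rewrite mem_iota /= add0n prednK//.
  by case: K q1 => //; rewrite big_ord0 => /esym/eqP; rewrite oner_eq0.
have dK : (dig x < K)%N by rewrite /dig -[ltnRHS](size_iota 0 K) -has_find.
split => //; last by have := nth_find 0%N hd; rewrite nth_iota.
case E : (dig x) => [|a]; first by rewrite /c big_ord0.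
have aK : (a < K)%N by apply: ltn_trans dK; rewrite E.
have : (a < dig x)%N by rewrite E.
by move/(before_find 0%N); rewrite nth_iota// add0n => /negbT; rewrite -leNgt.
Qed.

Let dig_eq x a : 0 <= x < 1 -> c a <= x < c a.+1 -> dig x = a.
Proof.
move=> /digP[_ h1 h2] /andP[h3 h4]; apply/eqP; rewrite eqn_leq.
apply/andP; split; rewrite leqNgt; apply/negP => h.
  by have := c_le h; rewrite leNgt (le_lt_trans h1 h4).
by have := c_le h; rewrite leNgt (le_lt_trans h3 h2).
Qed.

Let q_dig x : 0 <= x < 1 -> 0 < q (dig x).
Proof. by move=> /digP[_ h1 h2]; have := le_lt_trans h1 h2; rewrite cS ltrDl. Qed.

Let dmap_itv x : 0 <= x < 1 -> 0 <= dmap x < 1.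
Proof.
move=> hx; have [_ h1 h2] := digP hx; have qd := q_dig hx.
rewrite /dmap; apply/andP; split; first by rewrite divr_ge0// ?subr_ge0// ltW.
by rewrite ltr_pdivrMr// mul1r ltrBlDl -cS.
Qed.

(** The points whose itinerary starts with [w] form the half-open interval of length [weight w]
    starting at [left_end w]; the fold composes the inverse branches. *)
Let left_end := foldr (fun a l => c a + q a * l) (0 : R).
Let weight (w : seq nat) : R := \prod_(a <- w) q a.

Let weight_ge0 w : 0 <= weight w.
Proof. by rewrite /weight; apply: prodr_ge0 => a _. Qed.

Let left_end_itv w : 0 <= left_end w /\ left_end w + weight w <= 1.
Proof.
elim: w => [|a w [l0 l1]] /=; first by rewrite /weight big_nil add0r.
rewrite /weight big_cons -/(weight w); split.
  by rewrite addr_ge0 ?mulr_ge0// /c sumr_ge0.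
apply: le_trans (c_le1 a.+1); rewrite cS -addrA lerD2l -mulrDr.
by rewrite -[leRHS]mulr1 ler_wpM2l.
Qed.

Let code_cyl w x : 0 <= x < 1 ->
  mkseq (code x) (size w) = w <-> left_end w <= x < left_end w + weight w.
Proof.
elim: w x => [|a w IH] x hx; first by rewrite /weight big_nil add0r /=; split.
have -> : mkseq (code x) (size (a :: w)) = dig x :: mkseq (code (dmap x)) (size w).
  rewrite /mkseq /= -[1%N]addn0 iotaDl -map_comp; congr (_ :: _).
  by apply: eq_map => i; rewrite /code /= -iterSr.
have [l0 l1] := left_end_itv w.
rewrite /weight big_cons -/(weight w) /=; split.
  case=> da /(IH _ (dmap_itv hx)); have qd := q_dig hx.
  rewrite /dmap da in qd *; rewrite ler_pdivlMr// ltr_pdivrMr//.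
  by move=> /andP[h1 h2]; apply/andP; split; lra.
move=> /andP[h1 h2].
have qa : 0 < q a.
  rewrite lt_neqAle q0 andbT eq_sym; apply/eqP => E.
  by move: h1 h2; rewrite E !mul0r !addr0 leNgt => /negbTE ->.
have da : dig x = a.
  apply: dig_eq => //; apply/andP; split.
    by apply: le_trans h1; rewrite lerDl mulr_ge0.
  apply: (lt_le_trans h2); rewrite cS -addrA lerD2l -mulrDr.
  by rewrite -[leRHS]mulr1 ler_wpM2l.
congr (_ :: _) => //; apply/(IH _ (dmap_itv hx)).
by rewrite /dmap da ler_pdivlMr// ltr_pdivrMr//; apply/andP; split; lra.
Qed.

Let code' (x : measurableTypeR R) : borelspace :=
  if 0 <= x < 1 then code x else (fun=> 0%N).

Let I01 : set (measurableTypeR R) := `[0, 1[%classic.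

Let code'_cyl w : code' @^-1` cyl w `&` I01 = `[left_end w, left_end w + weight w[%classic.
Proof.
have [l0 l1] := left_end_itv w.
apply/seteqP; split => x; rewrite /I01 /= !in_itv /=.
  by move=> [+ hx]; rewrite /cyl /= /code' hx => /code_cyl -/(_ hx).
move=> h; have hx : 0 <= x < 1.
  by case/andP: h => h1 h2; rewrite (le_trans l0 h1) (lt_le_trans h2 l1).
by split => //; rewrite /cyl /= /code' hx; apply/code_cyl.
Qed.

Let mI01 : measurable I01.
Proof. exact: measurable_itv. Qed.

Let measurable_code' : measurable_fun setT code'.
Proof.
apply: measurable_fun_cyl => w.
rewrite -[_ @^-1` _](setUIDK _ I01) code'_cyl; apply: measurableU => //.
have [h|h] := pselect (mkseq (fun=> 0%N) (size w) = w).
  rewrite (_ : _ `\` _ = ~` I01); first exact: measurableC mI01.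
  apply/seteqP; split => x; first by case.
  move=> nx; split => //; rewrite /cyl /= /code' -[X in _ = X]h; congr (mkseq _ _).
  by case: ifP => // hx; exfalso; apply: nx; rewrite /I01 /= in_itv.
have -> : code' @^-1` cyl w `\` I01 = set0; last by [].
apply/seteqP; split; last by [].
move=> x [+ nx]; rewrite /cyl /= /code'; case: ifP => hx.
  by exfalso; apply: nx; rewrite /I01 /= in_itv.
by [].
Qed.

(** The restricted Lebesgue measure already has mass 1. Normalising it supplies the probability
    structure, with the Dirac mass as the formal fallback for degenerate masses. *)
Let uniform01 : probability (measurableTypeR R) R :=
  mnormalize (mrestr (@lebesgue_measure R) mI01) (@dirac _ (measurableTypeR R) 0 R).

Let uniform01E A : uniform01 A = lebesgue_measure (A `&` I01).
Proof.
have I1 : @lebesgue_measure R I01 = 1%E.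
  by rewrite /I01 lebesgue_measure_itv /= lte_fin ltr01 -EFinB subr0.
rewrite /uniform01 /= /mnormalize /= /mrestr setTI I1 onee_eq0 /=.
by rewrite invr1 mule1.
Qed.

Lemma bernoulli_exists : exists m : probability borelspace R,
  (forall w, pr m (cyl w) = \prod_(a <- w) q a) /\
  pr m [set d | forall i, 0 < q (d i) /\ (d i < K)%N] = 1.
Proof.
exists (pushforward_prob uniform01 measurable_code'); split.
  move=> w; rewrite /pr pushforward_probE uniform01E code'_cyl lebesgue_measure_itv /= lte_fin.
  case: ltP => h; first by rewrite -EFinB /= addrAC subrr add0r.
  by apply/esym/eqP; rewrite eq_le weight_ge0 andbT; rewrite gerDl in h.
rewrite /pr pushforward_probE uniform01E (_ : _ `&` _ = I01).
  by rewrite /I01 lebesgue_measure_itv /= lte_fin ltr01 -EFinB subr0.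
apply/seteqP; split => [x []//|x hx]; split => // i.
move: hx; rewrite /I01 /= in_itv /= => hx.
have hi : 0 <= iter i dmap x < 1 by elim: i => //= i IH; exact: dmap_itv.
by rewrite /code' hx /code; split; [exact: q_dig|case: (digP hi)].
Qed.

End Bernoulli.

(** * Entropy of finite partitions *)

Section FiniteEntropy.
Context d (T : measurableType d) (R : realType) (mu : probability T R).
Implicit Types I J : finType.

Definition measurable_fibers I (tau : T -> I) :=
  forall i, measurable (tau @^-1` [set i]).

Definition Ent I (tau : T -> I) : R :=
  \sum_i - (pr mu (tau @^-1` [set i]) * ln (pr mu (tau @^-1` [set i]))).

Lemma measurable_fibers_set I (tau : T -> I) (A : set I) :
  measurable_fibers tau -> measurable (tau @^-1` A).
Proof.
move=> mtau; rewrite -[_ @^-1` _](setTI).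
rewrite (_ : setT `&` _ = setT `&` [set x | tau x \in [seq i <- enum I | i \in A]]).
  exact: measurable_fiber_seq.
by congr (_ `&` _); apply/seteqP; split => x /=; rewrite mem_filter mem_enum andbT inE.
Qed.

Lemma measurable_fibers_comp I J (tau : T -> I) (rho : I -> J) :
  measurable_fibers tau -> measurable_fibers (rho \o tau).
Proof. by move=> mtau j; rewrite comp_preimage; exact: measurable_fibers_set. Qed.

Lemma measurable_fibers_pair I J (tau : T -> I) (rho : T -> J) :
  measurable_fibers tau -> measurable_fibers rho ->
  measurable_fibers (fun x => (tau x, rho x)).
Proof.
move=> mtau mrho [i j]; rewrite (_ : _ @^-1` _ = tau @^-1` [set i] `&` rho @^-1` [set j]).
  exact: measurableI.
by apply/seteqP; split => x; [case=> <- <-|case=> /= -> ->].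
Qed.

Lemma measurable_fibers_ffun n I (tau : 'I_n -> T -> I) :
  (forall i, measurable_fibers (tau i)) ->
  measurable_fibers (fun x => [ffun i => tau i x] : {ffun 'I_n -> I}).
Proof.
move=> mtau w; rewrite (_ : _ @^-1` _ = \bigcap_(i in [set: 'I_n]) (tau i @^-1` [set w i])).
  by apply: fin_bigcap_measurable => // i _; exact: mtau.
apply/seteqP; split => x /=; first by move=> <- i _; rewrite /preimage /= ffunE.
by move=> h; apply/ffunP => i; rewrite ffunE; exact: h.
Qed.

Lemma sum_pr_fibers I (tau : T -> I) : measurable_fibers tau ->
  \sum_i pr mu (tau @^-1` [set i]) = 1.
Proof.
move=> mtau; rewrite -(pr_setT mu) -(pr_fibers mu measurableT mtau).
by apply: eq_bigr => i _; rewrite setTI.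
Qed.

Lemma pr_marginal I J (tau : T -> I) (rho : I -> J) (g : J -> R) :
  measurable_fibers tau ->
  \sum_i pr mu (tau @^-1` [set i]) * g (rho i) =
  \sum_j pr mu ((rho \o tau) @^-1` [set j]) * g j.
Proof.
move=> mtau; have mrt := measurable_fibers_comp rho mtau.
transitivity (\sum_i \sum_j pr mu (tau @^-1` [set i] `&` (rho \o tau) @^-1` [set j]) * g j).
  apply: eq_bigr => i _; rewrite (bigD1 (rho i))//= big1 => [|j /eqP ji].
    rewrite addr0; congr (pr _ _ * _); apply/esym/setIidl => x /= ->//.
  rewrite (_ : _ `&` _ = set0) ?pr_set0 ?mul0r//; apply/seteqP; split => x //= -[-> h].
  by apply: ji.
rewrite exchange_big/=; apply: eq_bigr => j _; rewrite -mulr_suml; congr (_ * _).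
rewrite -(pr_fibers mu (mrt j) mtau).
by apply: eq_bigr => i _; rewrite setIC.
Qed.

Lemma Ent_gibbs I (tau : T -> I) (b : I -> R) : measurable_fibers tau ->
  (forall i, 0 <= b i) -> (forall i, 0 < pr mu (tau @^-1` [set i]) -> 0 < b i) ->
  \sum_i b i <= 1 ->
  Ent tau <= \sum_i - (pr mu (tau @^-1` [set i]) * ln (b i)).
Proof.
move=> mtau b0 hb b1; apply: gibbs => //; last exact: sum_pr_fibers.
by move=> i; exact: pr_ge0.
Qed.

(** Entropy is the mean of minus the logarithm of the mass of the atom, and merging atoms increases
    that mass. *)
Lemma Ent_comp I J (tau : T -> I) (rho : I -> J) : measurable_fibers tau ->
  Ent (rho \o tau) <= Ent tau.
Proof.
move=> mtau; rewrite /Ent !sumrN lerN2.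
rewrite -(pr_marginal rho (fun j => ln (pr mu ((rho \o tau) @^-1` [set j])))) //.
apply: ler_sum => i _; have := pr_ge0 mu (tau @^-1` [set i]).
rewrite le_eqVlt => /orP[/eqP <-|h]; first by rewrite !mul0r.
have sub : tau @^-1` [set i] `<=` (rho \o tau) @^-1` [set rho i] by move=> x /= ->.
have le := le_pr mu (mtau i) (measurable_fibers_comp rho mtau (rho i)) sub.
by rewrite ler_pM2l// ler_ln ?posrE// (lt_le_trans h).
Qed.

Lemma Ent_ge0 I (tau : T -> I) : measurable_fibers tau -> 0 <= Ent tau.
Proof.
move=> mtau; apply: sumr_ge0 => i _; rewrite -mulrN mulr_ge0 ?pr_ge0//.
by rewrite oppr_ge0 ln_le0// pr_le1.
Qed.

(** Gibbs' inequality against the product of the two marginals. *)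
Lemma Ent_pair I J (tau : T -> I) (rho : T -> J) :
  measurable_fibers tau -> measurable_fibers rho ->
  Ent (fun x => (tau x, rho x)) <= Ent tau + Ent rho.
Proof.
move=> mtau mrho; have mp := measurable_fibers_pair mtau mrho.
pose p := fun x => (tau x, rho x); rewrite -/p in mp *.
pose b (ij : I * J) := pr mu (tau @^-1` [set ij.1]) * pr mu (rho @^-1` [set ij.2]).
have h1 ij : 0 < pr mu (p @^-1` [set ij]) -> 0 < pr mu (tau @^-1` [set ij.1]).
  move/lt_le_trans; apply; apply: le_pr => //; by move=> x /= <-.
have h2 ij : 0 < pr mu (p @^-1` [set ij]) -> 0 < pr mu (rho @^-1` [set ij.2]).
  move/lt_le_trans; apply; apply: le_pr => //; by move=> x /= <-.
apply: (le_trans (@Ent_gibbs _ p b mp _ _ _)).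
- by move=> ij; rewrite mulr_ge0 ?pr_ge0.
- by move=> ij hij; rewrite mulr_gt0 ?h1 ?h2.
- rewrite -(pair_bigA _ (fun i j => pr mu (tau @^-1` [set i]) * pr mu (rho @^-1` [set j]))) /=.
  under eq_bigr do rewrite -mulr_sumr sum_pr_fibers// mulr1.
  by rewrite sum_pr_fibers.
rewrite le_eqVlt; apply/orP; left; apply/eqP.
transitivity (\sum_ij - (pr mu (p @^-1` [set ij]) * ln (pr mu (tau @^-1` [set ij.1])) +
   pr mu (p @^-1` [set ij]) * ln (pr mu (rho @^-1` [set ij.2])))).
  apply: eq_bigr => ij _; have := pr_ge0 mu (p @^-1` [set ij]).
  rewrite le_eqVlt => /orP[/eqP <-|h]; first by rewrite !mul0r addr0.
  by rewrite /b lnM ?posrE ?h1 ?h2// mulrDr.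
rewrite sumrN big_split /= opprD.
rewrite (pr_marginal fst (fun i => ln (pr mu (tau @^-1` [set i]))))//.
rewrite (pr_marginal snd (fun i => ln (pr mu (rho @^-1` [set i]))))//.
by rewrite /Ent !sumrN.
Qed.

End FiniteEntropy.

Section JoinEntropy.
Variables (R : realType) (mu : probability borelspace R).
Hypothesis inv : shift_invariant mu.

Definition itinerary (I : finType) (P : borelspace -> I) (n : nat) (x : borelspace) :
  {ffun 'I_n -> I} := [ffun i : 'I_n => P (iter i shift x)].

Lemma measurable_fibers_shift (I : finType) (P : borelspace -> I) n :
  measurable_fibers P -> measurable_fibers (fun x : borelspace => P (iter n shift x)).
Proof.
move=> mP i; pose sh : borelspace -> borelspace := iter n shift.
rewrite -[X in measurable X]/(sh @^-1` (P @^-1` [set i])).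
exact: measurable_preimage (measurable_iter_shift n) (mP i).
Qed.

Lemma measurable_itinerary (I : finType) (P : borelspace -> I) n :
  measurable_fibers P -> measurable_fibers (itinerary P n).
Proof.
by move=> mP; apply: measurable_fibers_ffun => i; exact: measurable_fibers_shift.
Qed.

Lemma Ent_shift (I : finType) (P : borelspace -> I) n : measurable_fibers P ->
  Ent mu (fun x : borelspace => P (iter n shift x)) = Ent mu P.
Proof.
move=> mP; apply: eq_bigr => i _.
by have := pr_shift n inv (mP i); rewrite /preimage /= => ->.
Qed.

Lemma join_cellE k n (P : borelspace -> 'I_k) (w : {ffun 'I_n -> 'I_k}) :
  join_cell P w = itinerary P n @^-1` [set w].
Proof.
apply/seteqP; split => x /=.
  by move=> h; apply/ffunP => i; rewrite ffunE h.
by move=> <- i; rewrite ffunE.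
Qed.

Lemma join_entropyE k n (P : borelspace -> 'I_k) :
  join_entropy mu P n = Ent mu (itinerary P n).
Proof. by apply: eq_bigr => w _; rewrite join_cellE. Qed.

Lemma join_entropyD k (P : borelspace -> 'I_k) n m : measurable_fibers P ->
  join_entropy mu P (n + m) <= join_entropy mu P n + join_entropy mu P m.
Proof.
move=> mP; rewrite !join_entropyE.
have mn := measurable_itinerary (n := n) mP; have mm := measurable_itinerary (n := m) mP.
rewrite -(Ent_shift n mm).
have mm' := measurable_fibers_shift n mm.
apply: le_trans (Ent_pair mu mn mm').
pose rho (uv : {ffun 'I_n -> 'I_k} * {ffun 'I_m -> 'I_k}) : {ffun 'I_(n + m) -> 'I_k} :=
  [ffun i : 'I_(n + m) => match fintype.split i with inl j => uv.1 j | inr j => uv.2 j end].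
have -> : itinerary P (n + m) = rho \o
    (fun x => (itinerary P n x, itinerary P m (iter n shift x))).
  apply/funext => x; apply/ffunP => i; rewrite !ffunE.
  case: split_ordP => j ->; rewrite !ffunE /=; congr P.
  by rewrite -iterD addnC.
exact/Ent_comp/measurable_fibers_pair.
Qed.

Lemma partition_entropy_cvg k (P : borelspace -> 'I_k) : measurable_fibers P ->
  (fun n : nat => (n%:R^-1 * join_entropy mu P n)%:E) @ \oo --> partition_entropy mu P.
Proof.
move=> mP; have := @fekete_cvg R (fun n => (join_entropy mu P n)%:E) 0 0.
set l := limn_esup _; move=> h.
have {}h : (fun n : nat => (n%:R^-1 * join_entropy mu P n)%:E) @ \oo --> l.
  by apply: h => [n _|n m _ _]; rewrite ?ltry// adde0 -EFinD lee_fin join_entropyD.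
by rewrite /partition_entropy (cvg_lim _ h).
Qed.

End JoinEntropy.

(** * The upper bound of the variational principle *)

Section EntropyApproximation.
Variables (R : realType) (mu : probability borelspace R).
Hypothesis inv : shift_invariant mu.

(* Gibbs' inequality against the law of [Q] pushed through [n] independent
   copies of the channel that keeps a symbol with probability [1 - t]. *)
Lemma join_entropy_close k (P Q : borelspace -> 'I_k) (t e : R) n :
  measurable_fibers P -> measurable_fibers Q -> 0 < t < 1 ->
  pr mu [set x | P x != Q x] <= e ->
  join_entropy mu P n <=
    join_entropy mu Q n + n%:R * (- ln (1 - t) + e * ln (k%:R / t)).
Proof.
move=> mP mQ /andP[t0 t1] PQe.
have k0 : (0 < k)%N by case: k P Q mP mQ PQe => // P; case: (P point).
have kR : 1 <= k%:R :> R by rewrite ler1n.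
have kR0 : 0 < k%:R :> R by rewrite ltr0n.
(* All entries of the channel are positive, so Gibbs' inequality remains applicable where [P] and
   [Q] disagree; the weight t/k off the diagonal keeps its sums at most 1. *)
pose r (ac : 'I_k * 'I_k) : R := if ac.1 == ac.2 then 1 - t else t / k%:R.
have r0 ac : 0 < r ac by rewrite /r; case: ifP => _; rewrite ?subr_gt0// divr_gt0.
have rsum c : \sum_a r (a, c) <= 1.
  rewrite (bigD1 c)//= {1}/r /= eqxx.
  rewrite (eq_bigr (fun=> t / k%:R)); last by move=> a /negPf ac; rewrite /r /= ac.
  rewrite sumr_const -(mulr_natr (t / _)) -lerBrDl opprB addrC subrK.
  rewrite -mulrA -[leRHS]mulr1 ler_pM2l// mulrC ler_pdivrMr// mul1r ler_nat.
  by apply: leq_trans (max_card _) _; rewrite card_ord.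
pose W := {ffun 'I_n -> 'I_k}.
have miP := measurable_itinerary (n := n) mP; have miQ := measurable_itinerary (n := n) mQ.
pose tau x : W * W := (itinerary P n x, itinerary Q n x).
have mtau : measurable_fibers tau by exact: measurable_fibers_pair.
pose q (v : W) := pr mu (itinerary Q n @^-1` [set v]).
pose b (wv : W * W) := q wv.2 * \prod_(i < n) r (wv.1 i, wv.2 i).
have prod0 (wv : W * W) : 0 < \prod_(i < n) r (wv.1 i, wv.2 i) by apply: prodr_gt0.
have qpos wv : 0 < pr mu (tau @^-1` [set wv]) -> 0 < q wv.2.
  move=> h; apply: (lt_le_trans h). apply: (le_pr mu (mtau wv) (miQ wv.2)).
  by move=> x /= <-.
rewrite !join_entropyE; apply: (@le_trans _ _ (Ent mu tau)).
  by have h := Ent_comp mu (fun wv : W * W => wv.1) mtau; apply: h.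
apply: (le_trans (@Ent_gibbs _ _ _ mu _ tau b mtau _ _ _)).
- by move=> wv; apply: mulr_ge0; [exact: pr_ge0|exact/ltW/prod0].
- by move=> wv h; apply: mulr_gt0; [exact: qpos|exact: prod0].
- rewrite -(pair_bigA _ (fun w v : W => q v * \prod_(i < n) r (w i, v i))) exchange_big /=.
  rewrite -[leRHS](sum_pr_fibers mu miQ); apply: ler_sum => v _.
  rewrite -mulr_sumr -[leRHS]mulr1; apply: ler_wpM2l; first exact: pr_ge0.
  rewrite -(bigA_distr_bigA (fun (i : 'I_n) a => r (a, v i))).
  apply: prodr_ile1 => i _; rewrite rsum andbT; apply: sumr_ge0 => a _; exact: ltW.
pose g (c : bool) : R := if c then ln (1 - t) else ln (t / k%:R).
have gE ac : ln (r ac) = g (ac.1 == ac.2) by rewrite /r /g; case: ifP.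
have mPQ := measurable_fibers_pair mP mQ.
pose E := fun x => P x == Q x.
have mE : measurable_fibers E.
  exact: (measurable_fibers_comp (fun ac : 'I_k * 'I_k => ac.1 == ac.2) mPQ).
pose L := \sum_(c : bool) pr mu (E @^-1` [set c]) * g c.
(* By invariance the expected logarithm of the channel factor is the same at each time, so the n
   copies contribute n times [L]. *)
have Li (i : 'I_n) : \sum_wv pr mu (tau @^-1` [set wv]) * ln (r (wv.1 i, wv.2 i)) = L.
  pose rho (wv : W * W) := wv.1 i == wv.2 i.
  transitivity (\sum_wv pr mu (tau @^-1` [set wv]) * g (rho wv)).
    by apply: eq_bigr => wv _; rewrite gE.
  rewrite (pr_marginal mu rho g mtau); apply: eq_bigr => c _; congr (_ * _).
  rewrite -(pr_shift i inv (mE c)); congr pr; apply/seteqP; split => x;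
    by rewrite /preimage /= /rho /tau /= !ffunE.
have gF : 0 <= - ln (t / k%:R).
  rewrite oppr_ge0 ln_le0// ler_pdivrMr// mul1r; apply: le_trans kR; exact: ltW.
have gT : 0 <= - ln (1 - t) by rewrite oppr_ge0 ln_le0// gerBl ltW.
have Lle : - L <= - ln (1 - t) + e * ln (k%:R / t).
  rewrite /L big_bool /= opprD /g; apply: lerD.
    rewrite -mulrN -[leRHS]mul1r ler_wpM2r// pr_le1//.
  have -> : ln (k%:R / t) = - ln (t / k%:R) by rewrite -lnV ?posrE ?divr_gt0// invf_div.
  rewrite -mulrN ler_wpM2r//; apply: le_trans PQe; rewrite le_eqVlt; apply/orP; left.
  by apply/eqP; congr pr; apply/seteqP; split => x /=; rewrite /E /preimage /=; case: eqP.
have -> : n%:R * (- ln (1 - t) + e * ln (k%:R / t)) =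
    \sum_(i < n) (- ln (1 - t) + e * ln (k%:R / t)).
  by rewrite sumr_const card_ord mulr_natl.
apply: (@le_trans _ _ (Ent mu (itinerary Q n) + \sum_(i < n) - L)); last first.
  by rewrite lerD2l; apply: ler_sum.
rewrite le_eqVlt; apply/orP; left; apply/eqP.
have -> : Ent mu (itinerary Q n) = \sum_wv - (pr mu (tau @^-1` [set wv]) * ln (q wv.2)).
  by rewrite /Ent !sumrN (pr_marginal mu snd (fun v => ln (q v)) mtau).
rewrite -(eq_bigr _ (fun i _ => congr1 -%R (Li i))).
under [X in _ = _ + X]eq_bigr do rewrite -sumrN.
rewrite exchange_big -big_split /=; apply: eq_bigr => wv _.
have := pr_ge0 mu (tau @^-1` [set wv]); rewrite le_eqVlt => /orP[/eqP <-|h].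
  by rewrite !mul0r oppr0 add0r big1// => i _; rewrite mul0r oppr0.
rewrite /b lnM ?posrE ?qpos// mulrDr opprD; congr (_ + _).
rewrite sumrN -mulr_sumr; congr (- (_ * _)).
have : forall s : seq 'I_n, ln (\prod_(i <- s) r (wv.1 i, wv.2 i)) =
    \sum_(i <- s) ln (r (wv.1 i, wv.2 i)).
  elim=> [|i s IH]; first by rewrite !big_nil ln1.
  by rewrite !big_cons lnM ?posrE ?IH//; apply: prodr_gt0.
exact.
Qed.

End EntropyApproximation.

(** * Entropy plus mean against the partition sum at a fixed length *)

Section PartitionFunction.
Variable R : realType.
Local Open Scope ereal_scope.

Lemma le_esum_sub (T : choiceType) (A B : set T) (a : T -> \bar R) :
  (forall i, B i -> 0 <= a i) -> A `<=` B ->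
  \esum_(i in A) a i <= \esum_(i in B) a i.
Proof.
move=> a0 AB; apply: ge_ereal_sup => _ [X [finX XA] <-].
by apply: esum_ge; exists X => //; split => //; exact: subset_trans AB.
Qed.

Definition cylinder_sup (S : set seqspace) (phi : nat -> seqspace -> \bar R) n
  (w : seq nat) : \bar R := ereal_sup [set phi n x | x in cylinder S w].

Definition partition_sum (S : set seqspace) (phi : nat -> seqspace -> \bar R) n : \bar R :=
  \esum_(w in words S n) cylinder_sup S phi n w.

Lemma cylinder_sup_ub (S : set seqspace) phi n (x : seqspace) : S x ->
  phi n x <= cylinder_sup S phi n (mkseq x n).
Proof.
by move=> Sx; apply: ereal_sup_ubound; exists x => //; split => //; rewrite size_mkseq.
Qed.

Lemma cylinder_sup_ge0 (S : set seqspace) phi n (w : seq nat) :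
  (forall x, S x -> 0 <= phi n x) -> words S n w -> 0 <= cylinder_sup S phi n w.
Proof. by move=> p0 [x Sx <-]; apply: (le_trans (p0 _ Sx)); exact: cylinder_sup_ub. Qed.

Variables (mu : probability borelspace R) (S : set borelspace).
Variables (phi : nat -> seqspace -> \bar R) (n : nat).
Hypotheses (mS : measurable S) (S1 : mu S = 1).
Hypothesis phi0 : forall x, S x -> 0 < phi n x.
Hypothesis mphi : measurable_fun S (fun x : borelspace => lne (phi n x)).

(** The countably many words are grouped by the finitely many values of [tau]: z_i is the sum of the
    suprema over the words met by the fibre of i. Then phi_n(x) <= z_(tau x), so the left side is at
    most the sum of p_i (ln z_i - ln p_i), to which [log_sum] applies. As [tau] depends on the first
    n coordinates, the groups are disjoint and the z_i sum to at most the partition sum. *)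
Lemma Ent_le_partition_sum (I : finType) (tau : borelspace -> I) :
  measurable_fibers tau ->
  (forall x y : seqspace, mkseq x n = mkseq y n -> tau x = tau y) ->
  partition_sum S phi n < +oo ->
  (Ent mu tau)%:E + \int[mu]_(x in S) lne (phi n x) <= lne (partition_sum S phi n).
Proof.
move=> mtau dtau Zoo.
have phi0' x : S x -> 0 <= phi n x by move/phi0/ltW.
pose Z := partition_sum S phi n; rewrite -/Z in Zoo *.
pose U (i : I) := [set mkseq x n | x in S `&` tau @^-1` [set i]].
have UW i : U i `<=` words S n by move=> _ [x [Sx _] <-]; exists x.
pose F := cylinder_sup S phi n.
have F0 w : words S n w -> 0 <= F w by exact: cylinder_sup_ge0.
pose z i := \esum_(w in U i) F w.
have z0 i : 0 <= z i by apply: esum_ge0 => w /UW; exact: F0.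
have sumz : \sum_i z i <= Z.
  have zE i : z i = \esum_(w in words S n) (if w \in U i then F w else 0).
    by rewrite /z -{1}(setIidr (UW i)) esum_mkcondr.
  under eq_bigr do rewrite zE.
  rewrite -esum_sum; last by move=> w i Ww _; case: ifP => // _; exact: F0.
  apply: le_esum => w Ww; have [x Sx xw] := Ww.
  rewrite (bigD1 (tau x))//= big1 ?adde0.
    by case: ifP => // _; exact: F0.
  move=> i ix; case: ifPn => //; rewrite inE => -[y [Sy yi] yw].
  by move: ix; rewrite -yi (dtau y x) ?eqxx// yw xw.
have zoo i : z i \is a fin_num.
  rewrite ge0_fin_numE// (le_lt_trans _ Zoo)// (le_trans _ sumz)//.
  by rewrite (bigD1 i)//= leeDl// sume_ge0.
pose zr i := fine (z i).
have zrE i : z i = (zr i)%:E by rewrite fineK.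
have phi_z x : S x -> phi n x <= z (tau x).
  move=> Sx; apply: (le_trans (cylinder_sup_ub phi n Sx)).
  have Ux : U (tau x) (mkseq x n) by exists x.
  rewrite -/F /z; have <- := @esum_set1 _ _ (mkseq x n : seq nat) F (F0 _ (UW _ _ Ux)).
  apply: le_esum_sub => //.
  - by move=> w /UW; exact: F0.
  - by move=> _ ->.
have zr0 i x : S x -> tau x = i -> (0 < zr i)%R.
  by move=> Sx xi; rewrite -lte_fin -zrE -xi; apply: lt_le_trans (phi_z x Sx); exact: phi0.
have intle : \int[mu]_(x in S) lne (phi n x) <=
    (\sum_i ln (zr i) * pr mu (tau @^-1` [set i]))%:E.
  have S1' : pr mu S = 1%R by rewrite /pr S1.
  have -> : (\sum_i ln (zr i) * pr mu (tau @^-1` [set i]) =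
      \sum_i ln (zr i) * pr mu (S `&` tau @^-1` [set i]))%R.
    by apply: eq_bigr => i _; rewrite setIC pr_full.
  rewrite -integral_fintype//; apply: ae_le_integral => //.
    exact: (measurable_fun_fintype (fun i => (ln (zr i))%:E)).
  apply: aeW => x Sx; rewrite -lne_EFin; last exact: zr0 Sx erefl.
  rewrite -zrE lee_lne ?in_itv /= ?leey ?z0 ?phi0'//; exact: phi_z.
have zpos i : (0 < pr mu (tau @^-1` [set i]) -> 0 < zr i)%R.
  move=> h; have [x [Sx xi]] : exists x, S x /\ tau x = i.
    apply: contrapT => nex; move: h; rewrite -(pr_full (B := S)) ?/pr ?S1//.
    rewrite (_ : _ `&` _ = set0) ?measure0 ?ltxx//; apply/seteqP; split => x // [xi Sx].
    by apply: nex; exists x.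
  exact: zr0 Sx xi.
have Zfin : Z \is a fin_num.
  by rewrite ge0_fin_numE//; apply: esum_ge0 => w; exact: F0.
have sumzr : (\sum_i zr i <= fine Z)%R.
  rewrite -lee_fin -sumEFin fineK//.
  by under eq_bigr do rewrite -zrE.
have zr_ge0 i : (0 <= zr i)%R by rewrite fine_ge0.
have sumpr := sum_pr_fibers mu mtau.
have ls := @log_sum R I xpredT (fun i => pr mu (tau @^-1` [set i])) zr.
rewrite sumpr ln1 subr0 mul1r in ls.
have {}ls := ls (fun i _ => pr_ge0 _ _) (fun i _ => zr_ge0 i) (fun i _ => zpos i) ltr01.
have [i0 i0pos] : exists i, (0 < pr mu (tau @^-1` [set i]))%R.
  apply: contrapT => h; move: sumpr; rewrite big1 => [/esym/eqP|i _]; first by rewrite oner_eq0.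
  by apply/eqP; rewrite eq_le pr_ge0 andbT leNgt; apply/negP => ?; apply: h; exists i.
have sz0 : (0 < \sum_i zr i)%R.
  rewrite (bigD1 i0)//= ltr_pwDl ?zpos// sumr_ge0//.
have -> : lne Z = (ln (fine Z))%:E.
  by rewrite -lne_EFin ?fineK// (lt_le_trans sz0).
apply: (@le_trans _ _ (ln (\sum_i zr i))%:E); last first.
  by rewrite lee_fin ler_ln ?posrE// (lt_le_trans sz0).
apply: (le_trans (leeD2l _ intle)); rewrite -EFinD lee_fin; apply: le_trans ls.
rewrite le_eqVlt; apply/orP; left; apply/eqP; rewrite /Ent -big_split /=.
by apply: eq_bigr => i _; rewrite mulrBr; ring.
Qed.

End PartitionFunction.

(** Arithmetic of [partition_entropy_le], with [h] and [hq] the entropies of [P] and [Q] over n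
    steps. The m extra coordinates cost m|p - l| < n e/2, and the passage from [P] to [Q] costs at
    most n e/2. *)
Lemma entropy_rate_estimate (R : realFieldType) (h hq N n m l p e a : R) :
  0 <= n -> 0 <= m -> hq + N * l < N * p -> N = n + m -> h <= hq + n * (e / 4 + a) -> a <= e / 4 ->
  2 * m * `|p - l| < n * e -> h <= n * (p - l + e).
Proof.
move=> n0 m0 hq_lt NE hle ae; rewrite -mulrA => hm; rewrite NE in hq_lt.
have na : n * a <= n * (e / 4) by rewrite ler_wpM2l.
have mpl : m * (p - l) <= m * `|p - l| by rewrite ler_wpM2l// ler_norm.
move: hq_lt hle hm na mpl; rewrite !mulrDl !mulrDr !mulrN.
by move: (m * `|p - l|) (m * p) (m * l) (n * p) (n * l) (n * a) => ? ? ? ? ? ?; lra.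
Qed.

Lemma gap_absurd (R : realFieldType) (r : R) : 0 <= r -> r <= 0 - 2 + 1 -> False.
Proof. lra. Qed.

Lemma gap_sum (R : realFieldType) (r l p e : R) :
  r <= p + e / 3 - (l - e / 3) + e / 3 -> r + l <= p + e.
Proof. lra. Qed.

Section UpperBound.
Variable R : realType.
Local Open Scope ereal_scope.

(** Avoids subtracting infinities. If l = +oo or p = -oo, then l' and p' can be taken with p' - l' =
    -2, and e = 1 contradicts h >= 0. *)
Lemma lee_of_real_gaps (h l p : \bar R) : 0 <= h -> -oo < l -> p < +oo ->
  (forall l' p' e : R, l'%:E < l -> p < p'%:E -> (0 < e)%R -> h <= (p' - l' + e)%:E) ->
  h + l <= p.
Proof.
move=> h0 loo poo H.
have [l0 hl0] : exists l0 : R, l0%:E < l.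
  case: l loo {H} => [r _|_|//]; last by exists 0%R; rewrite ltry.
  by exists (r - 1)%R; rewrite lte_fin ltrBlDr ltrDl.
have [p0 hp0] : exists p0 : R, p < p0%:E.
  case: p poo {H} => [r _|//|_]; last by exists 0%R; rewrite ltNyr.
  by exists (r + 1)%R; rewrite lte_fin ltrDl.
have [r hr] : exists r, h = r%:E.
  have := H _ _ 1%R hl0 hp0 ltr01.
  by case: h h0 {H} => [r _ _|//|//]; exists r.
rewrite hr lee_fin in h0; rewrite hr in H *.
case: l loo H hl0 => [l _ H _|_ H _|//]; last first.
  have := H (p0 + 2)%R p0 1%R; rewrite ltry => /(_ isT hp0 ltr01).
  by rewrite lee_fin opprD addrA subrr => /(gap_absurd h0).
case: p poo hp0 H => [p _ _ H|//|_ _ H]; last first.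
  have := H (l - 1)%R (0 - 2 + (l - 1))%R 1%R; rewrite ltNyr lte_fin ltrBlDr ltrDl ltr01.
  by move=> /(_ isT isT isT); rewrite lee_fin addrK => /(gap_absurd h0).
rewrite -EFinD; apply/lee_addgt0Pr => e e0; rewrite -EFinD lee_fin.
have e3 : (0 < e / 3)%R by rewrite divr_gt0.
have := H (l - e / 3)%R (p + e / 3)%R (e / 3)%R.
rewrite !lte_fin ltrBlDr !ltrDl e3 => /(_ isT isT isT).
by rewrite lee_fin; exact: gap_sum.
Qed.

Variables (mu : probability borelspace R) (S : set borelspace).
Variable phi : nat -> seqspace -> \bar R.
Hypotheses (inv : shift_invariant mu) (mS : measurable S) (S1 : mu S = 1).
Hypothesis phi0 : forall n x, (0 < n)%N -> S x -> 0 < phi n x.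
Hypothesis mphi : forall n, (0 < n)%N ->
  measurable_fun S (fun x : borelspace => lne (phi n x)).

Lemma partition_entropy_ge0 k (P : borelspace -> 'I_k) : measurable_fibers P ->
  0 <= partition_entropy mu P.
Proof.
move=> mP; have h := partition_entropy_cvg inv mP.
rewrite -(cvg_lim _ h)//; apply: lime_ge; first by apply/cvg_ex; eexists; exact: h.
apply: nearW => n; rewrite lee_fin mulr_ge0 ?invr_ge0// join_entropyE Ent_ge0//.
exact: measurable_itinerary.
Qed.

Lemma partition_entropy_le k (P : borelspace -> 'I_k) (l' p' e : R) :
  measurable_fibers P ->
  l'%:E < limn_esup (mean_log S phi mu) -> pressure S phi < p'%:E -> (0 < e)%R ->
  partition_entropy mu P <= (p' - l' + e)%:E.
Proof.
move=> mP ll pp e0.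
(* Chosen so that - ln (1 - t) = e/4. *)
pose t := (1 - expR (- (e / 4)))%R.
have e4 : (0 < e / 4)%R by rewrite divr_gt0.
have t0 : (0 < t)%R by rewrite subr_gt0 expR_lt1 oppr_lt0.
have t1 : (t < 1)%R by rewrite gtrBl expR_gt0.
have lt : (- ln (1 - t) = e / 4)%R by rewrite /t opprB addrC subrK expRK opprK.
have k0 : (0 < k)%N by case: k P mP => // P; case: (P point).
have lk : (0 <= ln (k%:R / t))%R.
  rewrite ln_ge0// ler_pdivlMr// mul1r (le_trans (ltW t1))// ler1n//.
(* Admissible mass of the set where [P] and [Q] differ, so that d ln (k/t) <= e/4; the added 1 keeps
   the denominator positive. *)
pose d := ((e / 4) / (ln (k%:R / t) + 1))%R.
have d0 : (0 < d)%R by rewrite divr_gt0// ltr_wpDl.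
have dk : (d * ln (k%:R / t) <= e / 4)%R.
  rewrite /d -mulrA -[leRHS]mulr1 ler_pM2l// mulrC ler_pdivrMr ?ltr_wpDl// mul1r.
  by rewrite lerDl.
have [m [Q [dQ PQ]]] := partition_approximable mu mP d0.
have mQ : measurable_fibers Q.
  by move=> j; apply: (@measurable_determined m) => x y /dQ xy; rewrite /preimage /= xy.
have cv := partition_entropy_cvg inv mP.
(* The entropy rate is a limit, so it is enough to bound it along infinitely many n; negation turns
   this into a lower bound for an upper limit. *)
have cvN : (fun n : nat => - (n%:R^-1 * join_entropy mu P n)%:E) @ \oo -->
    - partition_entropy mu P by exact: cvgeN.
rewrite -leeN2 -(cvg_limn_einf_sup cvN).2; apply: limn_esup_ge => n0.
have [N1 hN1] := limn_esup_ltP pp.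
have [K hK0] : exists K, (2 * m%:R * `|p' - l'| / e < K.+1%:R :> R)%R.
  by eexists; exact: truncnS_gt.
(* At this length the mean exceeds l' and the partition sum is below e^(N p'). Itineraries of [Q] of
   length N - m depend on N coordinates, as [Q] reads m of them; K makes the m lost steps
   negligible. *)
have [N + lN] := limn_esup_gtP ll (n0 + N1 + m + K.+1).
move=> NN.
have [mN nK N1N n0n] : [/\ (m <= N)%N, (K < N - m)%N, (N1 <= N)%N & (n0 <= N - m)%N].
  by move: NN; clear => NN; split; lia.
exists (N - m)%N => //.
set n := (N - m)%N in nK n0n *.
have nmN : (n + m)%N = N by rewrite subnK.
have n0' : (0 < n)%N by exact: leq_ltn_trans nK.
have nR : (0 < n%:R :> R)%R by rewrite ltr0n.
have N0 : (0 < N)%N by rewrite -nmN addn_gt0 n0'.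
have NR : (0 < N%:R :> R)%R by rewrite ltr0n.
have hK : (2 * m%:R * `|p' - l'| / e < n%:R)%R.
  by apply: (lt_le_trans hK0); rewrite ler_nat.
have pN := hN1 N N1N.
have Zoo : partition_sum S phi N < +oo.
  rewrite ltey; apply/eqP => Z; move: pN; rewrite -/(partition_sum S phi N) Z /=.
  by rewrite gt0_muley ?lte_fin ?invr_gt0// ltNge leey.
have dQn : forall x y : seqspace, mkseq x N = mkseq y N -> itinerary Q n x = itinerary Q n y.
  move=> x y /eq_mkseqP xy; apply/ffunP => i; rewrite !ffunE; apply: dQ.
  by apply/eq_mkseqP => j jm; rewrite !iter_shiftE xy// -nmN -addnS leq_add// ltnW.
have key := @Ent_le_partition_sum R mu S phi N mS S1 (fun x => @phi0 N x N0) (mphi N0)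
  _ (itinerary Q n) (measurable_itinerary mQ) dQn Zoo.
rewrite -join_entropyE in key.
have close := join_entropy_close inv n mP mQ (introT andP (conj t0 t1)) PQ.
rewrite lt in close.
move: lN; rewrite /mean_log lte_pdivlMl// -EFinM => lN.
move: pN; rewrite lte_pdivrMl// -EFinM -/(partition_sum S phi N) => pN.
have HQ : (join_entropy mu Q n + N%:R * l' < N%:R * p')%R.
  rewrite -lte_fin EFinD; apply: le_lt_trans pN; apply: le_trans key.
  by rewrite leeD2l// ltW.
rewrite leeN2 lee_fin -(@ler_pM2l _ n%:R)// mulVKf ?gt_eqF//.
rewrite ltr_pdivrMr// in hK.
have NE : (N%:R = n%:R + m%:R :> R)%R by rewrite -nmN natrD.
exact: (entropy_rate_estimate (ltW nR) (ler0n _ m) HQ NE close dk hK).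
Qed.

Theorem entropy_le_pressure : -oo < limn_esup (mean_log S phi mu) ->
  entropy mu + limn_esup (mean_log S phi mu) <= pressure S phi.
Proof.
move=> loo; have [->|poo] := eqVneq (pressure S phi) +oo; first exact: leey.
have {}poo : pressure S phi < +oo by rewrite ltey.
set l := limn_esup _ in loo *.
have H k (P : borelspace -> 'I_k) : measurable_fibers P ->
    partition_entropy mu P + l <= pressure S phi.
  move=> mP; apply: lee_of_real_gaps => //; first exact: partition_entropy_ge0.
  by move=> l' p' e ll pp e0; exact: partition_entropy_le.
(* The entropy rate of the trivial partition is nonnegative, so l is finite once the pressure is; it
   can then be moved across before the supremum over partitions is taken. *)
pose P0 : borelspace -> 'I_1 := fun=> ord0.
have mP0 : measurable_fibers P0.
  by move=> j; apply: (@measurable_determined 0).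
have lfin : l \is a fin_num.
  rewrite fin_numE gt_eqF//=; apply/eqP => ly; have := H _ _ mP0.
  have := partition_entropy_ge0 mP0; rewrite ly.
  by case: partition_entropy => [r _| _|//]; rewrite ?addey// leye_eq => /eqP E; rewrite E in poo.
rewrite -leeBrDr//; apply: ge_ereal_sup => _ [k [P [mP ->]]].
by rewrite leeBrDr//; exact: H.
Qed.

End UpperBound.

(** * Convergence of the means and the lower bound from Gibbs-type estimates *)

Section MeanLog.
Variables (R : realType) (mu : probability borelspace R) (S : set borelspace).
Variable phi : nat -> seqspace -> \bar R.
Hypotheses (inv : shift_invariant mu) (mS : measurable S) (S1 : mu S = 1%E).
Local Open Scope ereal_scope.
Hypothesis phi0 : forall n x, (0 < n)%N -> S x -> 0 < phi n x.
Hypothesis mphi : forall n, (0 < n)%N ->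
  measurable_fun S (fun x : borelspace => lne (phi n x)).

(** By invariance, integrating the logarithm of the submultiplicative bound makes the integrals
    subadditive up to [C]. Upper integrability from some length on keeps them below +oo and allows
    the right-hand side to be split. *)
Lemma mean_log_cvg (C : R) : shift @` S `<=` S ->
  (forall n x, (0 < n)%N -> S x -> phi n x < +oo) ->
  (forall n m x, (0 < n)%N -> (0 < m)%N -> S x ->
    phi (n + m)%N x <= (expR C)%:E * (phi n x * phi m (iter n shift x))) ->
  eventually_upper_integrable S phi mu ->
  mean_log S phi mu @ \oo --> limn_esup (mean_log S phi mu).
Proof.
move=> sS phioo phiD [N0 _ hN0].
pose a n := \int[mu]_(x in S) lne (phi n x).
have sSn n x : S x -> S (iter n shift x).
  by move=> Sx; elim: n => // n IH /=; apply: sS; exists (iter n shift x).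
have lnoo n x : (0 < n)%N -> S x -> lne (phi n x) < +oo.
  move=> n0 Sx; have := phioo _ _ n0 Sx; have := phi0 n0 Sx.
  by case: (phi n x) => // r r0 _; rewrite lne_EFin ?ltry.
have ui n : (maxn N0 1 <= n)%N -> upper_integrable mu S (fun x => lne (phi n x)).
  rewrite geq_max => /andP[n1 n2]; split; first exact: mphi.
  rewrite (eq_integral (fun x : borelspace => maxe (lne (phi n x)) 0)); first exact: (hN0 n n1).
  by move=> x _; rewrite funeposE.
apply: (@fekete_cvg R a (maxn N0 1) C) => [n /ui|n m hn hm].
  exact: upper_integral_lty.
have n0 : (0 < n)%N by apply: leq_trans hn; rewrite leq_max leqnn orbT.
have m0 : (0 < m)%N by apply: leq_trans hm; rewrite leq_max leqnn orbT.
have uin := ui _ hn; have uim := ui _ hm.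
pose sh : borelspace -> borelspace := iter n shift.
have msh : measurable_fun S (fun x : borelspace => lne (phi m (sh x))).
  have mS1 : measurable_fun S sh by apply: measurable_funTS; exact: measurable_iter_shift.
  refine (measurable_comp mS _ (mphi m0) mS1).
  by move=> _ [x Sx <-]; exact: sSn.
have uims : upper_integrable mu S (fun x => lne (phi m (sh x))).
  split => //.
  pose u : borelspace -> \bar R := fun x => lne (phi m x).
  have E := @ge0_integral_shift R mu n S u^\+ inv mS S1 sS
    (measurable_funepos (mphi m0)) (fun x _ => funepos_ge0 u x).
  case: uim => _; apply: le_lt_trans; rewrite le_eqVlt; apply/orP; left; apply/eqP.
  by rewrite -[RHS]E; apply: eq_integral => x _; rewrite !funeposE.
have uic : upper_integrable mu S (cst C%:E).
  split; first exact: measurable_cst.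
  rewrite (eq_integral (cst (Num.max C 0%R)%:E)); last by move=> x _; rewrite funeposE /cst EFin_max.
  by rewrite integral_cst_full// ltry.
have Ea : a m = \int[mu]_(x in S) lne (phi m (sh x)).
  by rewrite (integral_shift n inv mS S1 sS (mphi m0)).
have Ec : C%:E = \int[mu]_(x in S) cst C%:E x by rewrite integral_cst_full.
have ui1 : upper_integrable mu S (fun x => lne (phi n x) + lne (phi m (sh x))).
  split; first by apply: emeasurable_funD; [exact: mphi|].
  apply: (@le_lt_trans _ _ (\int[mu]_(x in S)
     ((fun x => lne (phi n x))^\+ x + (fun x => lne (phi m (sh x)))^\+ x))).
    apply: ge0_le_integral => //.
    - by apply: measurable_funepos; apply: emeasurable_funD => //; exact: mphi.
    - by apply: emeasurable_funD; apply: measurable_funepos => //; exact: mphi.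
    - move=> x Sx; rewrite !funeposE ge_max; apply/andP; split.
        by apply: leeD; rewrite le_max lexx.
      by apply: adde_ge0; rewrite le_max lexx orbT.
  rewrite ge0_integralD//; [|by apply: measurable_funepos; exact: mphi|exact: measurable_funepos].
  by apply: lte_add_pinfty; [case: uin|case: uims].
rewrite {2}/a Ea Ec -upper_integralD//; first last.
- by move=> x Sx; apply: lnoo => //; exact: sSn.
- by move=> x Sx; exact: lnoo.
rewrite -upper_integralD//; first last.
- by move=> x _; exact: ltry.
- by move=> x Sx; apply: lte_add_pinfty; [exact: lnoo|apply: lnoo => //; exact: sSn].
apply: ae_le_integral => //.
- by apply: mphi; rewrite addn_gt0 n0.
- by apply: emeasurable_funD => //; apply: emeasurable_funD => //; exact: mphi.
apply: aeW => x Sx; have := phiD n m x n0 m0 Sx.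
have := phi0 n0 Sx; have := phioo _ _ n0 Sx.
have := phi0 m0 (sSn n x Sx); have := phioo _ _ m0 (sSn n x Sx).
have nm0 : (0 < n + m)%N by rewrite addn_gt0 n0.
have := phi0 nm0 Sx; have := phioo _ _ nm0 Sx; rewrite -/sh.
case: (phi n x) => // r; case: (phi m (sh x)) => // s; case: (phi (n + m)%N x) => // t.
move=> _ t0 _ s0 _ r0; rewrite !lte_fin in t0 s0 r0.
rewrite -!EFinM lee_fin !lne_EFin// -!EFinD lee_fin => h.
have -> : (ln r + ln s + C = ln (expR C * (r * s)))%R.
  by rewrite lnM ?posrE ?expR_gt0 ?mulr_gt0// lnM ?posrE// expRK addrC.
by rewrite ler_ln ?posrE ?mulr_gt0 ?expR_gt0.
Qed.

(** A measure carried by this set sees only finitely many first symbols, so a finite partition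
    already separates its cylinders. *)
Definition bounded_alphabet (K : nat) : set borelspace :=
  [set x : seqspace | forall i, (x i < K)%N].

Lemma measurable_bounded_alphabet K : measurable (bounded_alphabet K).
Proof.
rewrite (_ : bounded_alphabet K = \bigcap_n [set x : seqspace | (x n < K)%N]).
  apply: bigcapT_measurable => n; apply: (@measurable_determined n.+1).
  by move=> x y /eq_mkseqP/(_ n (ltnSn n)) /= ->.
by apply/seteqP; split => x h i; [move=> _; exact: h|exact: h i I].
Qed.

(* Integrating the hypothesis [mu [x_1 .. x_m] <= e^{-m r} phi_m x] against
   [mu] bounds the entropy of the partition by first symbol from below. *)
Lemma gibbs_measure_lower_bound (K : nat) (r : R) :
  pr mu (bounded_alphabet K) = 1%R ->
  (forall n0, exists2 m, (n0 <= m)%N & (0 < m)%N /\ forall x, S x ->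
     (pr mu (cyl (mkseq x m)))%:E <= (expR (- (m%:R * r)))%:E * phi m x) ->
  -oo < limn_esup (mean_log S phi mu) /\
  r%:E <= entropy mu + limn_esup (mean_log S phi mu).
Proof.
move=> AK hG; set L := limn_esup _; have mA := measurable_bounded_alphabet K.
have S1' : pr mu S = 1%R by rewrite /pr S1.
(* [inord] needs a successor bound; it is injective on the symbols below [K]. *)
pose P (x : borelspace) : 'I_K.+1 := inord (x 0%N).
have mP : measurable_fibers P.
  move=> j; apply: (@measurable_determined 1) => x y /eq_mkseqP/(_ 0%N (ltnSn 0)) xy.
  by rewrite /preimage /= /P xy.
pose H m := join_entropy mu P m.
have key m : (0 < m)%N -> (forall x, S x ->
     (pr mu (cyl (mkseq x m)))%:E <= (expR (- (m%:R * r)))%:E * phi m x) ->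
     (m%:R * r - H m)%:E <= \int[mu]_(x in S) lne (phi m x).
  move=> m0 hm; have mi := measurable_itinerary (n := m) mP.
  pose tau := itinerary P m; pose q w := pr mu (tau @^-1` [set w]).
  (* Among points with symbols below [K], the atom of the m-step itinerary lies in the cylinder. *)
  have cell_le x : bounded_alphabet K x -> (q (tau x) <= pr mu (cyl (mkseq x m)))%R.
    move=> Kx; rewrite /q -(pr_full (mi (tau x)) mA AK); apply: le_pr.
    - exact: measurableI.
    - exact: measurable_cyl.
    move=> y [yx Ky]; apply/cylE/eq_mkseqP => i im.
    have := congr1 (fun w : {ffun 'I_m -> 'I_K.+1} => val (w (Ordinal im))) yx.
    rewrite !ffunE /P /= !iter_shiftE addn0.
    by rewrite !inordK// ltnS ltnW.
  (* Since ln 0 = 0 in the library, the pointwise inequality could fail on null atoms; almost every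
     point avoids them. *)
  pose B := [set x | (0 < q (tau x))%R].
  have mB : measurable B by exact: (measurable_fibers_set [set w | (0 < q w)%R] mi).
  have B1 : pr mu B = 1%R.
    rewrite -(pr_fibers mu mB mi) -(sum_pr_fibers mu mi); apply: eq_bigr => w _.
    have [w0|] := ltP 0%R (q w).
      by congr pr; apply/seteqP; split => x; [case|move=> /= xw; split => //; rewrite /B /= /tau xw].
    move=> w0; have {}w0 : q w = 0%R by apply/eqP; rewrite eq_le w0 pr_ge0.
    rewrite -/(q w) w0; apply/eqP; rewrite eq_le pr_ge0 andbT -w0.
    apply: le_pr; [exact: measurableI|exact: mi|by move=> x []].
  have -> : (m%:R * r - H m)%:E =
      \int[mu]_(x in S) (ln (q (tau x)) + m%:R * r)%:E.
    rewrite (integral_fintype mu (fun w => ln (q w) + m%:R * r)%R mS mi); congr EFin.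
    rewrite /H join_entropyE /Ent -[X in (X - _)%R]mul1r -(sum_pr_fibers mu mi).
    rewrite mulr_suml sumrN opprK -big_split /=; apply: eq_bigr => w _.
    by rewrite [S `&` _]setIC pr_full// /q; ring.
  apply: ae_le_integral => //.
  - exact: (measurable_fun_fintype (fun w => (ln (q w) + m%:R * r)%:E)).
  - exact: mphi.
  apply: (@ae_full _ _ _ _ (bounded_alphabet K `&` B)).
  - exact: measurableI.
  - by rewrite setIC pr_full.
  move=> x [Kx Bx] Sx; have := hm x Sx.
  have qx : (0 < pr mu (cyl (mkseq x m)))%R by apply: lt_le_trans (cell_le x Kx).
  have := phi0 m0 Sx; case: (phi m x) => [s| |//]; last by rewrite leey.
  move=> s0; rewrite lte_fin in s0; rewrite -EFinM lee_fin => h.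
  rewrite lne_EFin// lee_fin -lerBrDr.
  have -> : (ln s - m%:R * r = ln (expR (- (m%:R * r)) * s))%R.
    by rewrite lnM ?posrE ?expR_gt0// expRK addrC.
  rewrite ler_ln ?posrE ?mulr_gt0 ?expR_gt0//.
  by apply: le_trans h; exact: cell_le.
have cv := partition_entropy_cvg inv mP.
(* Fekete's bound at length 1 makes the rate finite, so it can be subtracted from r. *)
have [h hh] : exists h : R, partition_entropy mu P = h%:E.
  have h0 := partition_entropy_ge0 inv mP.
  have : partition_entropy mu P <= (1%:R^-1)%:E * (H 1)%:E.
    rewrite -(cvg_limn_einf_sup cv).2.
    apply: (@fekete_bound R (fun n => (H n)%:E) 0 1) => // [n _|n k _ _]; first exact: ltry.
    by rewrite -EFinD lee_fin join_entropyD.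
  by move: h0; case: partition_entropy => // s _ _; exists s.
have LE : (r - h)%:E <= L.
  apply/lee_subgt0Pr => e e0; apply: limn_esup_ge => n0.
  have : limn_esup (fun n : nat => (n%:R^-1 * H n)%:E) < (h + e)%:E.
    by rewrite (cvg_limn_einf_sup cv).2 hh lte_fin ltrDl.
  move=> /limn_esup_ltP[n1 hn1].
  have [m nm [m0 hm]] := hG (maxn n0 n1); rewrite geq_max in nm.
  case/andP: nm => nm0 nm1; exists m => //.
  have mR : (0 < m%:R :> R)%R by rewrite ltr0n.
  rewrite /mean_log lee_pdivlMl//; apply: le_trans (key _ m0 hm).
  rewrite -EFinB -EFinM lee_fin.
  have := hn1 m nm1; rewrite lte_fin ltr_pdivrMl// => /ltW Hm.
  by move: Hm; rewrite !mulrDr !mulrN; move: (H m) => Hm'; lra.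
have Loo : -oo < L by apply: lt_le_trans LE; rewrite ltNyr.
split => //; have -> : r%:E = h%:E + (r - h)%:E by rewrite -EFinD addrC subrK.
by apply: leeD => //; rewrite -hh; apply: ereal_sup_ubound; exists K.+1, P.
Qed.

End MeanLog.

(** * Loops in the Markov cover and horseshoes *)

Definition concat_words (N : nat) (s : nat -> seq nat) : seqspace :=
  fun i => nth 0%N (s (i %/ N)%N) (i %% N)%N.

Lemma languageP (X : set seqspace) w :
  language X w <-> exists2 x, X x & mkseq x (size w) = w.
Proof.
split=> [[n _ [x Xx <-]]|[x Xx xw]]; first by exists x; rewrite ?size_mkseq.
by exists (size w) => //; exists x.
Qed.

Lemma mkseq_cat (x : seqspace) m n :
  mkseq x (m + n) = mkseq x m ++ mkseq (iter m shift x) n.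
Proof.
apply: (@eq_from_nth _ 0%N); first by rewrite size_cat !size_mkseq.
move=> i; rewrite size_mkseq => ilt; rewrite nth_mkseq// nth_cat size_mkseq.
case: ltnP => im; first by rewrite nth_mkseq.
by rewrite nth_mkseq ?ltn_subLR// iter_shiftE subnKC.
Qed.

Lemma markov_path (t : nat -> nat -> bool) (e : nat) (z : seq nat) :
  language (markov_shift t) (e :: z) -> path t e z.
Proof.
move=> /languageP[x Mx xz]; apply/(pathP 0%N) => i iz.
have nthz j : (j < (size z).+1)%N -> nth 0%N (e :: z) j = x j.
  by move=> jz; rewrite -xz nth_mkseq.
have E1 := nthz i (ltnW iz); have E2 : nth 0%N z i = x i.+1 := nthz i.+1 iz.
by rewrite E1 E2; exact: Mx.
Qed.

(* A good word is the image of a loop of the Markov cover at a fixed vertex above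
   [a]; only finitely many words [uv] are needed since [a] has finitely many
   preimages and [W1] is finite. *)
Lemma sofic_loops (X : set seqspace) (a : nat) :
  finitely_irreducible_sofic X -> words X 1 [:: a] ->
  exists (good : set (seq nat)) (D : seq (seq nat * seq nat)),
  [/\ forall s, good s -> nth 0%N s 0 = a,
      forall w, language X w -> exists2 uv, uv \in D & good (uv.1 ++ w ++ uv.2) &
      forall N (s : nat -> seq nat), (0 < N)%N ->
        (forall i, good (s i) /\ size (s i) = N) -> X (concat_words N s)].
Proof.
move=> [_ _ [p1 [W1 [_ finW1 _ hW1]]] [t [p [_ irr [_ surj _] fin]]]] [x0 Xx0 x0a].
pose M := markov_shift t; rewrite -/M in irr surj fin.
have lift x : X x -> exists2 y, M y & one_block p y = x.
  by rewrite -surj => -[y My yx]; exists y.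
have Mshift y n : M y -> M (iter n shift y).
  by move=> My i; rewrite !iter_shiftE addnS; exact: My.
have [y0 My0 y0x] := lift _ Xx0; pose ah := y0 0%N.
have x00 : x0 0%N = a by case: x0a.
have pah : p ah = a by rewrite -x00 -y0x.
pose A := [set al | words M 1 [:: al] /\ p al = a].
have letterM y n : M y -> words M 1 [:: y n].
  by move=> My; exists (iter n shift y); [exact: Mshift|rewrite /mkseq /= iter_shiftE addn0].
have langM y n : M y -> language M [:: y n] by move=> My; exists 1%N => //; exact: letterM.
have Alang al : A al -> language M [:: al] by case=> h _; exists 1%N.
have /choice[c1 hc1] : forall al, exists c, A al -> path t ah (rcons c al).
  move=> al; have [Aal|nA] := pselect (A al); last by exists [::].
  have [c [_ hc]] := irr _ _ (langM _ 0%N My0) (Alang _ Aal).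
  by exists c => _; rewrite -cats1; exact: markov_path hc.
have /choice[c2 hc2] : forall be, exists c, A be -> path t be (rcons c ah).
  move=> be; have [Abe|nA] := pselect (A be); last by exists [::].
  have [c [_ hc]] := irr _ _ (Alang _ Abe) (langM _ 0%N My0).
  by exists c => _; rewrite -cats1; exact: markov_path hc.
(* The returning vertex [ah] is left out of the word: it is the first letter of the next loop. *)
pose good : set (seq nat) :=
  [set s | exists2 r, s = map p (ah :: r) & path t ah (rcons r ah)].
(* A word w is first extended in X to a w1 w w2 a. Its lift starts and ends at vertices above a,
   which [c1] and [c2] join to [ah]; the extra outer letter a is the image of [ah] itself. *)
pose Dset := [set ((a :: map p (c1 q.1.1)) ++ a :: q.2.1, q.2.2 ++ a :: map p (c2 q.1.2))
  | q in (A `*` A) `*` (W1 `*` W1)].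
have finA : finite_set A by exact: fin.
have finD : finite_set Dset by apply: finite_image; do ![apply: finite_setX => //].
have [D DE] : exists D : seq (seq nat * seq nat), Dset = [set` D] by exact/finite_seqP.
exists good, D; split.
- by move=> _ [r -> _].
- move=> w Xw.
  have Xa : language X [:: a] by exists 1%N => //; exists x0.
  have [w1 [W1w1 h1]] := hW1 _ _ Xa Xw.
  have [w2 [W1w2 /languageP[x Xx xE]]] := hW1 _ _ h1 Xa.
  have [y My yx] := lift _ Xx.
  pose z := [:: a] ++ w1 ++ w.
  pose n := (size (z ++ w2)).+1.
  have zsz : size ((z ++ w2) ++ [:: a]) = n by rewrite size_cat addn1.
  rewrite [X in mkseq _ (size X)]catA [in RHS]catA -/z zsz in xE.
  pose rest := mkseq (iter 1 shift y) n.-1.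
  have yE : mkseq y n = y 0%N :: rest by have := mkseq_cat y 1 n.-1; rewrite add1n.
  have pyE : map p (mkseq y n) = (z ++ w2) ++ [:: a].
    by rewrite -xE -yx /mkseq -map_comp.
  have Ay0 : A (y 0%N).
    split; first exact: letterM.
    by have := congr1 (nth 0%N ^~ 0%N) pyE; rewrite yE.
  have lastE : last (y 0%N) rest = y n.-1.
    rewrite -[last _ _]/(last 0%N (y 0%N :: rest)) -yE (last_nth 0%N) size_mkseq.
    by rewrite /n /= -[nth _ _ _]/(nth 0%N (mkseq y n) n.-1) nth_mkseq.
  have Ayn : A (y n.-1).
    split; first exact: letterM.
    have E : last 0%N (map p (y 0%N :: rest)) = p (y n.-1).
      by rewrite -lastE -(last_map p).
    by rewrite -E -yE pyE last_cat.
  have pathy : path t (y 0%N) rest.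
    by apply: markov_path; rewrite -yE; exists n => //; exists y.
  exists ((a :: map p (c1 (y 0%N))) ++ a :: w1, w2 ++ a :: map p (c2 (y n.-1))).
    suff : Dset ((a :: map p (c1 (y 0%N))) ++ a :: w1, w2 ++ a :: map p (c2 (y n.-1))).
      by rewrite DE.
    by exists ((y 0%N, y n.-1), (w1, w2)).
  exists (c1 (y 0%N) ++ mkseq y n ++ c2 (y n.-1)).
    have -> : map p (ah :: c1 (y 0%N) ++ mkseq y n ++ c2 (y n.-1)) =
        a :: map p (c1 (y 0%N)) ++ ((z ++ w2) ++ [:: a]) ++ map p (c2 (y n.-1)).
      by rewrite -pyE -!map_cat -pah.
    by move: (y n.-1) => be; rewrite /z /= -!catA.
  rewrite rcons_cat rcons_cat yE cat_cons -cat_rcons cat_path (hc1 _ Ay0) last_rcons.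
  by rewrite cat_path lastE hc2// andbT.
- move=> N s N0 gs.
  have /choice[r hr] : forall i, exists r, s i = map p (ah :: r) /\ path t ah (rcons r ah).
    by move=> i; have [[r h1 h2] _] := gs i; exists r.
  have szr i : size (ah :: r i) = N by have [_ <-] := gs i; rewrite (hr i).1 size_map.
  pose y : seqspace := fun i => nth 0%N (ah :: r (i %/ N)%N) (i %% N)%N.
  have My : M y.
    move=> i; rewrite /y; set q := (i %/ N)%N; set j := (i %% N)%N.
    have jN : (j < N)%N by rewrite ltn_mod.
    have := (hr q).2; move=> /(pathP 0%N)/(_ j).
    have szr' : (size (r q)).+1 = N by rewrite -(szr q).
    rewrite size_rcons szr' => /(_ jN).
    have -> : nth 0%N (ah :: rcons (r q) ah) j = nth 0%N (ah :: r q) j.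
      by rewrite -rcons_cons nth_rcons [size _]szr jN.
    have iE : i.+1 = (q * N + j.+1)%N by rewrite addnS -divn_eq.
    have [jN1|jN1] := ltnP j.+1 N.
      rewrite iE divnMDl// modnMDl divn_small// addn0 modn_small//.
      by rewrite nth_rcons ifT// -ltnS szr'.
    (* After the last letter of a block comes [ah], the head of the next loop. *)
    have {}jN1 : j.+1 = N by apply/eqP; rewrite eqn_leq jN.
    rewrite iE jN1 -mulSnr mulnK// modnMl /=.
    by rewrite nth_rcons -ltnS szr' jN1 ltnn -eqSS szr' jN1 eqxx.
  rewrite -surj; exists y => //; apply/funext => i; rewrite /one_block /= /y /concat_words.
  rewrite (hr (i %/ N)%N).1 (nth_map 0%N)//.
  by have := szr (i %/ N)%N; move=> /= ->; rewrite ltn_mod.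
Qed.

(** * Lower bounds for almost-additive sequences of tempered variation *)

Section AlmostAdditive.
Variables (R : realType) (X : set seqspace) (f : nat -> seqspace -> R).
Hypotheses (hf : continuous_positive X f) (haa : almost_additive X f).
Hypotheses (htv : tempered_variation X f) (sX : shift @` X `<=` X).

Lemma iter_shift_mem n x : X x -> X (iter n shift x).
Proof. by move=> Xx; elim: n => // n IH /=; apply: sX; exists (iter n shift x). Qed.

Lemma f_gt0 n x : (0 < n)%N -> X x -> 0 < f n x.
Proof. by move=> n0; exact: (hf n0).2. Qed.

Lemma variation_ub n x y : (0 < n)%N -> X x -> X y -> mkseq x n = mkseq y n ->
  f n x <= fine (variation X f n) * f n y.
Proof.
move=> n0 Xx Xy /eq_mkseqP xy.
have ub : ((f n x / f n y)%:E <= variation X f n)%E.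
  by apply: ereal_sup_ubound; exists (x, y).
have vfin : variation X f n \is a fin_num.
  by apply: fin_real; rewrite htv.1// andbT; apply: lt_le_trans ub; rewrite ltNyr.
by rewrite -(fineK vfin) lee_fin ler_pdivrMr ?f_gt0// in ub.
Qed.

Lemma variation_ge1 n x : (0 < n)%N -> X x -> 1 <= fine (variation X f n).
Proof.
move=> n0 Xx; have := variation_ub n0 Xx Xx erefl.
by rewrite -{1}[f n x]mul1r ler_pM2r ?f_gt0.
Qed.

Lemma variation_log_small (d : R) : 0 < d -> X !=set0 ->
  exists n0, forall n, (n0 <= n)%N -> ln (fine (variation X f n)) <= n%:R * d.
Proof.
move=> d0 [x0 Xx0]; have /cvg_limn_einf_sup[_ hs] := htv.2.
have : (limn_esup (fun n : nat => n%:R^-1%:E * lne (variation X f n)) < d%:E)%E.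
  by rewrite hs lte_fin.
move=> /limn_esup_ltP[n0 h]; exists (maxn 1 n0) => n; rewrite geq_max => /andP[n1 /h].
have v1 := variation_ge1 n1 Xx0.
have vfin : variation X f n \is a fin_num.
  apply: fin_real; rewrite htv.1// andbT ltNye; apply/eqP => v.
  by move: v1; rewrite v ler10.
have nR : 0 < n%:R :> R by rewrite ltr0n.
rewrite -(fineK vfin) lne_EFin ?(lt_le_trans ltr01)//.
by rewrite -EFinM lte_fin ltr_pdivrMl// => /ltW.
Qed.

(** Only finitely many first symbols are concerned, and on each of them the value of f_1 at one
    point controls all others, as the first variation is finite. *)
Lemma f1_lower K : exists2 c : R, 0 < c <= 1 & forall x, X x -> (x 0%N < K)%N -> c <= f 1 x.
Proof.
elim: K => [|K [c /andP[c0 c1] hc]]; first by exists 1; rewrite ?ltr01//=.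
have [[y [Xy yK]]|nex] := pselect (exists y, X y /\ y 0%N = K); last first.
  exists c; first by rewrite c0.
  move=> x Xx; rewrite ltnS leq_eqVlt => /orP[/eqP xK|]; last exact: hc.
  by exfalso; apply: nex; exists x.
have M0 : 0 < fine (variation X f 1).
  exact: lt_le_trans (variation_ge1 (ltn0Sn 0) Xy).
have fy := f_gt0 (ltn0Sn 0) Xy.
exists (Num.min c (f 1 y / fine (variation X f 1))).
  by rewrite lt_min c0 divr_gt0//= ge_min c1.
move=> x Xx; rewrite ltnS leq_eqVlt => /orP[/eqP xK|xK]; last by rewrite ge_min hc.
rewrite ge_min; apply/orP; right; rewrite ler_pdivrMr// mulrC.
by apply: variation_ub => //; rewrite /mkseq /= xK yK.
Qed.

(* Letters below [K] at the two ends of a word change [f] by a bounded factor. *)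
Lemma edge_lower K : exists2 c : R, 0 < c <= 1 & forall r n r' x, X x -> (0 < n)%N ->
  (forall i, (i < r)%N -> (x i < K)%N) -> (forall i, (i < r')%N -> (x (r + n + i)%N < K)%N) ->
  c ^+ (r + r') * f n (iter r shift x) <= f (r + n + r')%N x.
Proof.
have [C [C0 hC]] := haa; have [c /andP[c0 c1] hc] := f1_lower K.
have e0 : 0 < expR (- C) :> R by exact: expR_gt0.
have e1 : expR (- C) <= 1 :> R by rewrite expR_le1 oppr_le0.
(* Removing one letter costs [c] for its own value and e^(-C) for almost-additivity. *)
pose g := c * expR (- C).
have g0 : 0 < g by rewrite mulr_gt0.
have pre r n x : X x -> (0 < n)%N -> (forall i, (i < r)%N -> (x i < K)%N) ->
    g ^+ r * f n (iter r shift x) <= f (r + n)%N x.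
  elim: r n x => [|r IH] n x Xx n0 hx; first by rewrite expr0 mul1r.
  have Xs : X (shift x) by exact: (iter_shift_mem 1).
  have rn0 : (0 < r + n)%N by rewrite addn_gt0 n0 orbT.
  have := (hC 1%N (r + n)%N x (ltn0Sn 0) rn0 Xx).1.
  rewrite addnA; apply: le_trans.
  rewrite exprS iterSr -mulrA [X in X * _]mulrC -mulrA ler_pM2l//.
  apply: ler_pM.
  - exact: ltW.
  - by rewrite mulr_ge0 ?exprn_ge0 ?ltW// f_gt0//; exact: iter_shift_mem.
  - by apply: hc => //; exact: hx.
  - by apply: IH => // i ir; exact: hx.
have suf r n x : X x -> (0 < n)%N -> (forall i, (i < r)%N -> (x (n + i)%N < K)%N) ->
    g ^+ r * f n x <= f (n + r)%N x.
  elim: r => [|r IH] Xx n0 hx; first by rewrite expr0 mul1r addn0.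
  have nr0 : (0 < n + r)%N by rewrite addn_gt0 n0.
  have := (hC (n + r)%N 1%N x nr0 (ltn0Sn 0) Xx).1.
  rewrite -addnA addn1; apply: le_trans.
  rewrite exprS -mulrA [X in X * _]mulrC -mulrA ler_pM2l// mulrC.
  apply: ler_pM.
  - by rewrite mulr_ge0 ?exprn_ge0 ?ltW// f_gt0.
  - exact: ltW.
  - by apply: IH => // i ir; apply: hx; exact: ltnW.
  - by apply: hc; [exact: iter_shift_mem|rewrite iter_shiftE addn0; exact: hx].
exists g; first by rewrite g0 /= /g -[leRHS]mul1r ler_pM// ltW.
move=> r n r' x Xx n0 hr hr'.
apply: le_trans (suf r' (r + n)%N x Xx _ hr'); last by rewrite addn_gt0 n0 orbT.
by rewrite addnC exprD -mulrA ler_pM2l ?exprn_gt0//; exact: pre.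
Qed.

Lemma blocks_lower : exists2 C : R, 0 <= C & forall N k x, (0 < N)%N -> (0 < k)%N -> X x ->
  \prod_(i < k) (expR (- C) * f N (iter (i * N) shift x)) <= f (k * N)%N x.
Proof.
have [C [C0 hC]] := haa; exists C => // N k x N0.
elim: k => // k IH _ Xx; case: k IH => [_|k IH].
  rewrite big_ord_recl big_ord0 mulr1 mul0n mul1n -[leRHS]mul1r ler_pM2r ?f_gt0//.
  by rewrite expR_le1 oppr_le0.
have kN0 : (0 < k.+1 * N)%N by rewrite muln_gt0.
rewrite big_ord_recr [in leRHS]mulSnr; apply: le_trans (hC _ _ x kN0 N0 Xx).1.
rewrite [leLHS]mulrCA ler_pM2l ?expR_gt0// ler_pM2r; first exact: IH.
by apply: f_gt0 => //; exact: iter_shift_mem.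
Qed.

End AlmostAdditive.

(** * Horseshoes of words that concatenate freely *)

Section Horseshoe.
Variables (R : realType) (X : set seqspace) (f : nat -> seqspace -> R).
Hypotheses (hX : finitely_irreducible_sofic X).
Hypotheses (hf : continuous_positive X f) (haa : almost_additive X f).
Hypotheses (htv : tempered_variation X f).

Lemma esum_gtP (T : choiceType) (A : set T) (a : T -> \bar R) (c : \bar R) :
  (c < \esum_(i in A) a i)%E -> exists s : seq T,
    [/\ uniq s, forall i, i \in s -> A i & (c < \sum_(i <- s) a i)%E].
Proof.
move=> /ereal_sup_gt[_ [S [finS SA] <-]] cS.
have [s SE] : exists s : seq T, S = [set` s] by exact/finite_seqP.
have sS i : i \in undup s <-> S i by rewrite mem_undup SE.
exists (undup s); split; [exact: undup_uniq|by move=> i /sS /SA|].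
rewrite fsbig_seq ?undup_uniq// (_ : [set` undup s] = S)//.
by apply/seteqP; split => i /sS.
Qed.

Lemma pigeonhole_sum (S D : eqType) (s : seq S) (ds : seq D) (d : S -> D) (F : S -> R) (c : R) :
  (forall w, w \in s -> d w \in ds) -> (forall w, w \in s -> 0 <= F w) ->
  0 < c -> c < \sum_(w <- s) F w ->
  exists2 e, e \in ds & c / (size ds)%:R <= \sum_(w <- s | d w == e) F w.
Proof.
move=> dds F0 c0 cs; apply: contrapT => nex.
have lt e : e \in ds -> \sum_(w <- s | d w == e) F w <= c / (size ds)%:R.
  by move=> eds; rewrite leNgt; apply/negP => h; apply: nex; exists e => //; exact: ltW.
have : \sum_(w <- s) F w <= \sum_(e <- ds) \sum_(w <- s | d w == e) F w.
  rewrite (exchange_big_dep xpredT)//= big_seq [leRHS]big_seq; apply: ler_sum => w ws.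
  have dw := dds w ws; rewrite (big_rem (d w)) //= eqxx lerDl.
  by apply: sumr_ge0 => e _; exact: F0.
apply/negP; rewrite -ltNge; apply: (fun h => le_lt_trans h cs).
have sz : 0 < (size ds)%:R :> R.
  rewrite ltr0n; case: ds dds {nex lt} => // dds.
  case: s dds F0 cs => [|w s] dds _ cs; first by rewrite big_nil ltNge ltW in cs.
  by have := dds w (mem_head _ _).
rewrite big_seq; apply: (@le_trans _ _ (\sum_(e <- ds | e \in ds) c / (size ds)%:R)).
  by apply: ler_sum => e /lt.
by rewrite -big_seq big_const_seq count_predT iter_addr_0 -(mulr_natr (c / _)) divfK ?gt_eqF.
Qed.

Lemma cylinder_sup_le n w x : (0 < n)%N -> cylinder X w x -> size w = n ->
  (cylinder_sup X (eseq f) n w <= (fine (variation X f n) * f n x)%:E)%E.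
Proof.
move=> n0 [Xx xw] wn; apply: ge_ereal_sup => _ [y [Xy yw] <-].
by rewrite /eseq lee_fin; apply: (variation_ub hf htv) => //; rewrite -wn yw xw.
Qed.

Lemma cylinder_sup_fin n w : (0 < n)%N -> words X n w ->
  exists2 r, 0 < r & cylinder_sup X (eseq f) n w = r%:E.
Proof.
move=> n0 [x Xx xw].
have h1 := @cylinder_sup_ub R X (eseq f) n x Xx; rewrite xw in h1.
have h2 : (cylinder_sup X (eseq f) n w <= (fine (variation X f n) * f n x)%:E)%E.
  by apply: cylinder_sup_le; rewrite -?xw ?size_mkseq//; split => //; rewrite size_mkseq.
move: h1 h2; rewrite /eseq; case: cylinder_sup => // r; rewrite !lee_fin => h1 _.
by exists r => //; apply: lt_le_trans h1; exact: (f_gt0 hf).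
Qed.

(** [b s] bounds f_N from below at every point of X starting with s, so it can be used whatever
    follows s. The gap between T and the pressure pays for the extension of words, for the choice of
    one extension and for the variation of f. *)
Lemma horseshoe (a : nat) (T : R) : words X 1 [:: a] ->
  (T%:E < pressure X (eseq f))%E -> forall n0, exists N (L : seq (seq nat)) (b : seq nat -> R),
  [/\ (n0 <= N)%N, (0 < N)%N, uniq L & expR (N%:R * T) <= \sum_(s <- L) b s] /\
  (forall s, s \in L -> [/\ size s = N, nth 0%N s 0 = a, 0 < b s &
     forall x, X x -> mkseq x N = s -> b s <= f N x]) /\
  (forall g : nat -> seq nat, (forall i, g i \in L) -> X (concat_words N g)).
Proof.
move=> Xa TP n0.
have [[_ sX] _ _ _] := hX.
have X0 : X !=set0 by case: Xa => x Xx _; exists x.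
have [good [D [good_a Dgood good_concat]]] := sofic_loops hX Xa.
(* Above every letter occurring in the finite list of extensions, so that [edge_lower] handles the
   added prefixes and suffixes. *)
pose K := (\max_(uv <- D) \max_(i <- uv.1 ++ uv.2) i).+1.
have DK uv i : uv \in D -> i \in uv.1 ++ uv.2 -> (i < K)%N.
  move=> uvD iuv; rewrite /K ltnS.
  have h1 : (i <= \max_(j <- uv.1 ++ uv.2) j)%N.
    by rewrite (@leq_bigmax_seq _ _ xpredT (fun j : nat => j)).
  apply: (leq_trans h1).
  by rewrite (@leq_bigmax_seq _ _ xpredT (fun q : seq nat * seq nat => \max_(j <- q.1 ++ q.2) j)%N).
have [c /andP[c0 c1] edge] := edge_lower hf haa htv sX K.
pose l := (\max_(uv <- D) (size uv.1 + size uv.2))%N.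
have Dl uv : uv \in D -> (size uv.1 + size uv.2 <= l)%N.
  by move=> uvD; rewrite /l (@leq_bigmax_seq _ _ xpredT (fun q : seq nat * seq nat => size q.1 + size q.2)%N).
have D0 : 0 < (size D)%:R :> R.
  rewrite ltr0n; have [x Xx _] := Xa.
  have [uv uvD _] := Dgood [::] (ex_intro2 _ _ 0%N I (ex_intro2 _ _ x Xx erefl)).
  by case: (D) uvD.
have [T1 TT1 T1P] := real_between TP.
(* Half of the gap n (T1 - T) pays for the variation ln M, the other half for [E]. *)
pose d := (T1 - T) / 2.
have d0 : 0 < d by rewrite divr_gt0// subr_gt0.
have [n1 hn1] := variation_log_small hf htv d0 X0.
(* Costs that do not grow with n: the length added by the extension, the pigeonhole factor 1/|D| and
   the factor [c] of each added letter. *)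
pose E := l%:R * `|T| + ln (size D)%:R - l%:R * ln c.
have [n2 hn2] : exists n2, E / d < n2.+1%:R by eexists; exact: truncnS_gt.
have [n nn nT1] := limn_esup_gtP T1P (n0 + n1 + n2.+1).
have [n0n n1n n2n] : [/\ (n0 <= n)%N, (n1 <= n)%N & (n2.+1 <= n)%N].
  by move: nn; clear => nn; split; lia.
have n_gt0 : (0 < n)%N by exact: leq_trans n2n.
have nR : 0 < n%:R :> R by rewrite ltr0n.
have nE : E < n%:R * d.
  by rewrite -ltr_pdivrMr//; apply: (lt_le_trans hn2); rewrite ler_nat.
set M := fine (variation X f n).
have M1 : 1 <= M by have [x Xx] := X0; exact: (variation_ge1 hf htv n_gt0 Xx).
have M0 : 0 < M by exact: lt_le_trans M1.
have lnMle := hn1 n n1n; rewrite -/M in lnMle.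
have Zn : ((expR (n%:R * T1))%:E < partition_sum X (eseq f) n)%E.
  rewrite ltNge; apply/negP => Zle; move: nT1; rewrite /= -/(partition_sum X (eseq f) n).
  rewrite lte_pdivlMl// -EFinM ltNge => /negP; apply.
  have -> : (n%:R * T1)%:E = lne (expR (n%:R * T1))%:E by rewrite lne_EFin ?expR_gt0// expRK.
  rewrite lee_lne ?in_itv /= ?leey ?andbT//.
  apply: esum_ge0 => w; apply: cylinder_sup_ge0 => x Xx.
  by rewrite /eseq lee_fin ltW// (f_gt0 hf).
have [s [us sW sumF]] := esum_gtP Zn.
pose F := cylinder_sup X (eseq f) n.
have Fle w x : cylinder X w x -> size w = n -> (F w <= (M * f n x)%:E)%E.
  exact: cylinder_sup_le.
have Ffin w : w \in s -> exists2 r, 0 < r & F w = r%:E.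
  by move=> /sW; exact: cylinder_sup_fin.
pose Fr w := fine (F w).
have FrE w : w \in s -> F w = (Fr w)%:E by move=> /Ffin[r _ h]; rewrite /Fr h.
have Fr0 w : w \in s -> 0 < Fr w by move=> /Ffin[r r0 h]; rewrite /Fr h.
have sumFr : expR (n%:R * T1) < \sum_(w <- s) Fr w.
  rewrite -lte_fin -sumEFin; apply: (lt_le_trans sumF).
  by rewrite big_seq [leRHS]big_seq; apply: lee_sum => w ws; rewrite -FrE.
have /choice[dd hdd] : forall w, exists uv, w \in s -> uv \in D /\ good (uv.1 ++ w ++ uv.2).
  move=> w; have [ws|nws] := boolP (w \in s); last by exists ([::], [::]).
  have [uv h1 h2] : exists2 uv, uv \in D & good (uv.1 ++ w ++ uv.2).
    by apply: Dgood; exists n => //; exact: sW.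
  by exists uv.
(* A single extension for all words gives them one common length and keeps w -> [ext w]
   injective. *)
have [uv uvD suv] := pigeonhole_sum (fun w ws => (hdd w ws).1) (fun w ws => ltW (Fr0 w ws))
  (expR_gt0 _) sumFr.
pose u : seq nat := uv.1; pose v : seq nat := uv.2.
pose ext (w : seq nat) : seq nat := u ++ w ++ v.
pose core (t : seq nat) : seq nat := take n (drop (size u) t).
have szs w : w \in s -> size w = n by move=> /sW[x _ <-]; rewrite size_mkseq.
have coreK w : w \in s -> core (ext w) = w.
  by move=> ws; rewrite /core /ext drop_size_cat// -(szs w ws) take_size_cat.
pose L := [seq ext w | w <- s & dd w == uv].
(* Dividing by M passes from the supremum over the cylinder of the core to the value at any of its
   points; c^l pays for the added letters. *)
pose b t := c ^+ l * (Fr (core t) / M).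
pose N := (size u + n + size v)%N.
exists N, L, b.
have Lin (t : seq nat) : t \in L -> exists2 w, w \in s & t = ext w /\ good t.
  move=> /mapP[w]; rewrite mem_filter => /andP[/eqP dw ws] ->; exists w => //; split => //.
  by have := (hdd w ws).2; rewrite dw.
have szL w : w \in s -> size (ext w) = N.
  by move=> ws; rewrite /ext !size_cat (szs w ws) addnA.
split; [split|split].
- by rewrite /N -addnA (leq_trans n0n)// addnCA leq_addr.
- by rewrite /N -addnA addn_gt0 addn_gt0 n_gt0 orbT.
- rewrite map_inj_in_uniq ?filter_uniq// => w1 w2; rewrite !mem_filter => /andP[_ w1s] /andP[_ w2s] w12.
  by rewrite -(coreK w1)// w12 coreK.
- rewrite /L big_map big_filter.
  have -> : \sum_(w <- s | dd w == uv) b (ext w) =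
      c ^+ l / M * \sum_(w <- s | dd w == uv) Fr w.
    rewrite mulr_sumr big_seq_cond [RHS]big_seq_cond; apply: eq_bigr => w /andP[ws _].
    by rewrite /b coreK// mulrA [RHS]mulrAC.
  apply: (@le_trans _ _ (c ^+ l / M * (expR (n%:R * T1) / (size D)%:R))); last first.
    by rewrite ler_pM2l// divr_gt0 ?exprn_gt0.
  have cl0 : 0 < c ^+ l by exact: exprn_gt0.
  rewrite -[leLHS]lnK ?posrE ?expR_gt0// -[leRHS]lnK; last first.
    by rewrite posrE mulr_gt0 ?divr_gt0 ?expR_gt0.
  rewrite ler_expR expRK lnM ?posrE ?divr_gt0 ?expR_gt0//.
  rewrite ln_div ?posrE// ln_div ?posrE ?expR_gt0// expRK lnXn//.
  have szuv : (size u + size v <= l)%N by exact: Dl.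
  have NT : N%:R * T <= n%:R * T + l%:R * `|T|.
    rewrite /N addnAC addnC natrD mulrDl lerD2l.
    apply: (le_trans (ler_norm _)); rewrite normrM ler_wpM2r// ger0_norm// ler_nat//.
  apply: (le_trans NT); rewrite -(mulr_natl (ln c)).
  move: nE lnMle; rewrite /E /d mulrA mulrBr.
by move: (l%:R * `|T|) (l%:R * ln c) (n%:R * T1) (n%:R * T) => ? ? ? ?; lra.
- move=> t /Lin[w ws [-> gt]]; split.
  + exact: szL.
  + exact: good_a.
  + by rewrite /b coreK// mulr_gt0 ?exprn_gt0 ?divr_gt0 ?Fr0.
  + move=> x Xx xt; rewrite /b coreK//.
    have xi i : (i < N)%N -> x i = nth 0%N (ext w) i by move=> iN; rewrite -xt nth_mkseq.
    have ku i : (i < size u)%N -> (x i < K)%N.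
      move=> iu; rewrite xi; last by rewrite /N -addnA ltn_addr.
      rewrite /ext nth_cat iu; apply: (DK uv) => //.
      by rewrite mem_cat mem_nth.
    have kv i : (i < size v)%N -> (x (size u + n + i)%N < K)%N.
      move=> iv; rewrite xi; last by rewrite /N ltn_add2l.
      rewrite /ext catA nth_cat size_cat (szs w ws) ifN; last by rewrite -leqNgt leq_addr.
      rewrite addKn.
      by apply: (DK uv) => //; rewrite mem_cat mem_nth ?orbT.
    apply: le_trans (edge (size u) n (size v) x Xx n_gt0 ku kv).
    have Xs : X (iter (size u) shift x) by exact: iter_shift_mem.
    have sw : mkseq (iter (size u) shift x) n = w.
      rewrite -[RHS](coreK w ws) /core -xt /N -addnA mkseq_cat.
      by rewrite drop_size_cat ?size_mkseq// mkseq_cat take_size_cat ?size_mkseq.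
    apply: ler_pM.
    * by rewrite exprn_ge0 ?ltW.
    * by rewrite divr_ge0 ?ltW ?Fr0.
    * by apply: ler_wiXn2l => //; [exact: ltW|exact: Dl].
    * rewrite ler_pdivrMr// mulrC -lee_fin -FrE//; apply: Fle; last exact: szs.
      by split => //; rewrite (szs w ws).
- move=> g gL; apply: good_concat; first by rewrite /N -addnA addn_gt0 addn_gt0 n_gt0 orbT.
  by move=> i; have [w ws [-> gt]] := Lin _ (gL i); split => //; exact: szL.
Qed.

End Horseshoe.

(** * Gurevich pressure *)

Lemma lee_real_below (R : realType) (p x : \bar R) :
  (forall T : R, (T%:E < p)%E -> (T%:E <= x)%E) -> (p <= x)%E.
Proof.
case: p => [p||] H; last exact: leNye.
  apply/lee_subgt0Pr => e e0; rewrite -EFinB; apply: H.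
  by rewrite lte_fin ltrBlDr ltrDl.
case: x H => [x||] H //.
  by have := H (x + 1) (ltry _); rewrite lee_fin gerDl ler10.
by have := H 0 (ltry _); rewrite leNgt ltNyr.
Qed.

Lemma lne_le (R : realType) (x y : \bar R) : (0 <= x)%E -> (x <= y)%E -> (lne x <= lne y)%E.
Proof.
by move=> x0 xy; rewrite lee_lne// in_itv /= leey andbT//; exact: le_trans xy.
Qed.

Lemma mkseq_concat_words N (g : nat -> seq nat) i : (0 < N)%N -> (forall i, size (g i) = N) ->
  mkseq (iter (i * N) shift (concat_words N g)) N = g i.
Proof.
move=> N0 gN; apply: (@eq_from_nth _ 0%N); first by rewrite size_mkseq gN.
move=> r; rewrite size_mkseq => rN; rewrite nth_mkseq// iter_shiftE /concat_words.
by rewrite divnMDl// divn_small// addn0 modnMDl modn_small.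
Qed.

Lemma iter_shift_concat_words N (g : nat -> seq nat) i : (0 < N)%N ->
  iter (i * N) shift (concat_words N g) = concat_words N (fun j => g (i + j)%N).
Proof.
move=> N0; apply/funext => r; rewrite iter_shiftE /concat_words.
by rewrite divnMDl// modnMDl.
Qed.

Section Gurevich.
Variables (R : realType) (X : set seqspace) (f : nat -> seqspace -> R).
Hypotheses (hX : finitely_irreducible_sofic X).
Hypotheses (hf : continuous_positive X f) (haa : almost_additive X f).
Hypotheses (htv : tempered_variation X f).

Lemma gurevich_pressureE a : words X 1 [:: a] ->
  gurevich_pressure X (eseq f) a = pressure X (eseq f).
Proof.
move=> Xa; pose Per n := [set x | [/\ X x, iter n shift x = x & x 0%N = a]].
have f0 n x : (0 < n)%N -> X x -> (0 <= eseq f n x)%E.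
  by move=> n0 Xx; rewrite /eseq lee_fin ltW// (f_gt0 hf).
apply/eqP; rewrite eq_le; apply/andP; split.
  apply: (@le_limn_esup _ _ _ 1) => n n0; apply: lee_wpmul2l.
    by rewrite lee_fin invr_ge0.
  apply: lne_le; first by apply: esum_ge0 => x [Xx _ _]; exact: f0.
  pose F := cylinder_sup X (eseq f) n.
  (* A point of period n is determined by its first n symbols, so the sum over periodic points is
     dominated by the sum over words. *)
  have inj : set_inj (Per n) (fun x => mkseq x n).
    move=> x y /set_mem[_ xx _] /set_mem[_ yy _] /eq_mkseqP xy.
    have per (z : seqspace) : iter n shift z = z -> forall i, z i = z (i %% n)%N.
      move=> zz i; rewrite {1}(divn_eq i n); elim: (i %/ n)%N => // q IH.
      by rewrite mulSn -addnA -iter_shiftE zz.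
    by apply/funext => i; rewrite (per _ xx) (per _ yy) xy// ltn_mod.
  apply: (@le_trans _ _ (\esum_(x in Per n) F (mkseq x n))).
    by apply: le_esum => x [Xx _ _]; exact: cylinder_sup_ub.
  rewrite -(esum_image _ _ F inj); apply: le_esum_sub.
    by move=> w; apply: cylinder_sup_ge0 => x; exact: f0.
  by move=> _ [x [Xx _ _] <-]; exists x.
apply: lee_real_below => T TP; apply: limn_esup_ge => n0.
have [N [L [b [[nN N0 uL sumL] [hL cL]]]]] := horseshoe hX hf haa htv Xa TP n0.
exists N => //; have NR : 0 < N%:R :> R by rewrite ltr0n.
rewrite lee_pdivlMl// -EFinM.
have -> : (N%:R * T)%:E = lne (expR (N%:R * T))%:E by rewrite lne_EFin ?expR_gt0// expRK.
apply: lne_le; first by rewrite lee_fin expR_ge0.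
pose per (s : seq nat) : seqspace := concat_words N (fun=> s).
have perE s : s \in L -> mkseq (per s) N = s.
  move=> /hL[sN _ _ _]; have := @mkseq_concat_words N (fun=> s) 0 N0 (fun=> sN).
  by rewrite mul0n.
apply: (@le_trans _ _ (\sum_(s <- L) (b s)%:E)%E); first by rewrite sumEFin lee_fin.
apply: (@le_trans _ _ (\sum_(s <- L) eseq f N (per s))%E).
  rewrite big_seq [leRHS]big_seq; apply: lee_sum => s sL; rewrite /eseq lee_fin.
  by have [_ _ _] := hL s sL; apply; [exact: cL|exact: perE].
rewrite -(big_map per xpredT (eseq f N)).
apply: esum_ge; exists [set` map per L].
  split; first exact: finite_seq.
  move=> _ /mapP[s sL ->]; have [sN sa _ _] := hL s sL; split.
  - by apply: cL.
  - by have := @iter_shift_concat_words N (fun=> s) 1 N0; rewrite mul1n.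
  - by rewrite /per /concat_words mod0n.
rewrite -fsbig_seq// map_inj_in_uniq// => s1 s2 s1L s2L s12.
by rewrite -(perE s1)// s12 perE.
Qed.

End Gurevich.

(** * The horseshoe measure *)

Lemma average_probability (R : realType) d (T : measurableType d)
    (P : nat -> probability T R) (N : nat) : (0 < N)%N ->
  exists mu : probability T R, forall A, measurable A ->
    pr mu A = (\sum_(j < N) pr (P j) A) / N%:R.
Proof.
move=> N0; have NR : 0 < N%:R :> R by rewrite ltr0n.
have E1 : (\sum_(j < N) P j setT = N%:R%:E)%E.
  rewrite (eq_bigr (fun=> 1%:E)); last by move=> j _; rewrite probability_setT.
  by rewrite sumEFin sumr_const card_ord.
exists (mnormalize (msum P N) (P 0%N)) => A mA.
rewrite /pr /= /mnormalize /= /msum E1 eqe gt_eqF//=.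
rewrite (eq_bigr (fun j : 'I_N => (pr (P j) A)%:E)); last by move=> j _; rewrite prE.
by rewrite sumEFin -EFinM.
Qed.

Section BernoulliInvariance.
Variables (R : realType) (q : nat -> R) (K : nat) (m : probability borelspace R).
Hypothesis q1 : \sum_(a < K) q a = 1.
Hypothesis mcyl : forall w, pr m (cyl w) = \prod_(a <- w) q a.
Hypothesis mK : pr m (bounded_alphabet K) = 1.

Lemma bernoulli_invariant : shift_invariant m.
Proof.
suff H (A : set borelspace) : measurable A -> pushforward_prob m measurable_shift A = m A.
  by move=> A /H.
apply: eq_measure_cyl => [w|]; last first.
  exact: (le_lt_trans (probability_le1 _ measurableT) (ltry _)).
have ms : measurable (shift @^-1` cyl w : set borelspace).
  exact: measurable_preimage measurable_shift (measurable_cyl w).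
have mh (a : nat) : measurable ((fun x : borelspace => x 0%N) @^-1` [set a] : set borelspace).
  apply: (@measurable_determined 1) => x y /eq_mkseqP/(_ 0%N (ltnSn 0)) xy.
  by rewrite /preimage /= xy.
transitivity (m (shift @^-1` cyl w)); first by [].
rewrite prE// [RHS]prE; last exact: measurable_cyl.
congr EFin; rewrite -(pr_full ms (measurable_bounded_alphabet K) mK).
(* Up to a null set the first symbol is one of finitely many, so cylinder masses can be summed over
   it. *)
have -> : pr m (shift @^-1` cyl w `&` bounded_alphabet K) =
    pr m (shift @^-1` cyl w `&` [set x : borelspace | x 0%N \in iota 0 K]).
  apply/eqP; rewrite eq_le; apply/andP; split.
    apply: le_pr.
    - by apply: measurableI => //; exact: measurable_bounded_alphabet.
    - exact: (@measurable_fiber_seq _ _ _ (fun x : borelspace => x 0%N)).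
    - by move=> x [xw xK]; split => //=; rewrite mem_iota add0n /= xK.
  rewrite (pr_full ms (measurable_bounded_alphabet K) mK); apply: le_pr => //.
    exact: (@measurable_fiber_seq _ _ _ (fun x : borelspace => x 0%N)).
rewrite -(@pr_fibers_seq _ _ _ m _ (fun x : borelspace => x 0%N))// ?iota_uniq//.
have E a : pr m (shift @^-1` cyl w `&` (fun x : borelspace => x 0%N) @^-1` [set a]) =
    q a * \prod_(a <- w) q a.
  have mkseqS (x : seqspace) n : mkseq x n.+1 = x 0%N :: mkseq (shift x) n.
    exact: (mkseq_cat x 1 n).
  rewrite -[RHS](big_cons _ _ a w xpredT q) -mcyl; congr pr; apply/seteqP; split => x.
    by case=> xw xa; rewrite /cyl /= mkseqS xw xa.
  rewrite /cyl /= => xw.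
  by move: xw; rewrite mkseqS => -[xa xw].
under eq_bigr do rewrite E.
have := q1; rewrite -(big_mkord xpredT q) /index_iota subn0 => iq1.
by rewrite -mulr_suml iq1 mul1r mcyl.
Qed.

End BernoulliInvariance.

(** * Shift-averaged laws of independent blocks *)

Section ConcatenationMeasure.
Variables (R : realType) (X : set seqspace) (N : nat) (L : seq (seq nat)) (b : seq nat -> R).
Hypotheses (cX : closed X) (sX : shift @` X `<=` X) (N0 : (0 < N)%N) (uL : uniq L).
Hypotheses (sizeL : forall s, s \in L -> size s = N) (b0 : forall s, s \in L -> 0 < b s).
Hypothesis L0 : (0 < size L)%N.
Hypothesis concatX : forall g : nat -> seq nat, (forall i, g i \in L) -> X (concat_words N g).

Let B := \sum_(s <- L) b s.
(** Digits are positions in [L], so that blocks become the symbols of a Bernoulli measure. *)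
Let q (a : nat) : R := if (a < size L)%N then b (nth [::] L a) / B else 0.
Let concat (d : borelspace) : borelspace := concat_words N (fun i => nth [::] L (d i)).

Let B0 : 0 < B.
Proof.
rewrite /B; case: (L) L0 b0 => // s l _ b0'; rewrite big_cons ltr_pwDl//.
  by apply: b0'; rewrite mem_head.
rewrite big_seq; apply: sumr_ge0 => t tl; apply/ltW/b0'.
by rewrite in_cons tl orbT.
Qed.

Let q_ge0 a : 0 <= q a.
Proof. by rewrite /q; case: ifP => // aL; rewrite divr_ge0 ?ltW// b0// mem_nth. Qed.

Let q_out a : (size L <= a)%N -> q a = 0.
Proof. by rewrite /q leqNgt => /negbTE ->. Qed.

Let q_sum : \sum_(a < size L) q a = 1.
Proof.
under eq_bigr => a _ do rewrite /q ltn_ord.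
rewrite -mulr_suml (_ : \sum_(i < size L) _ = B) ?divff ?gt_eqF//.
by rewrite /B (big_nth [::]) big_mkord.
Qed.

Let measurable_concat : measurable_fun setT concat.
Proof.
apply: measurable_fun_determined => n; exists n => x y /eq_mkseqP xy.
apply/eq_mkseqP => i i_n; rewrite /concat /concat_words xy//.
by apply: leq_ltn_trans i_n; exact: leq_div.
Qed.

Let valid : set borelspace := bounded_alphabet (size L).

Let concat_mem d : valid d -> forall i, nth [::] L (d i) \in L.
Proof. by move=> vd i; rewrite mem_nth//; exact: vd. Qed.

(** A window of length (k+1)N at offset j < N contains the blocks 1, ..., k entirely. A word seen
    there fixes their digits, since [L] has no repetition and all blocks have length N, so its
    probability is at most the product of k weights. The bound [z] is required at every offset
    because [mu] averages over them. *)
Lemma concatenation_measure (K : nat) :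
  (forall s i, s \in L -> i \in s -> (i < K)%N) ->
  exists mu : probability borelspace R,
  [/\ invariant_measure X mu, pr mu (bounded_alphabet K) = 1 &
   forall (k : nat) (w : seq nat) (z : R), size w = (k.+1 * N)%N -> 0 <= z ->
   (forall j (g : nat -> seq nat), (j < N)%N -> (forall i, g i \in L) ->
      mkseq (iter j shift (concat_words N g)) (k.+1 * N) = w ->
      \prod_(i < k) b (g i.+1) / B ^+ k <= z) ->
   pr mu (cyl w) <= z].
Proof.
move=> LK.
have [m [mcyl mvalid]] := bernoulli_exists q_ge0 q_out q_sum.
have mva : measurable valid by exact: measurable_bounded_alphabet.
have valid1 : pr m valid = 1.
  apply/eqP; rewrite eq_le pr_le1//= -mvalid; apply: le_pr => //.
    rewrite (_ : [set d | _] = \bigcap_i [set d : seqspace | 0 < q (d i) /\ (d i < size L)%N]).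
      apply: bigcapT_measurable => i; apply: (@measurable_determined i.+1).
      by move=> x y /eq_mkseqP/(_ i (ltnSn i)) /= ->.
    by apply/seteqP; split => x h i; [move=> _; exact: h|exact: h i I].
  by move=> d h i; have [] := h i.
have minv := bernoulli_invariant q_sum mcyl valid1.
pose mu0 := pushforward_prob m measurable_concat.
pose nu j := pushforward_prob mu0 (measurable_iter_shift j).
have NR : 0 < N%:R :> R by rewrite ltr0n.
have nuE j (A : set borelspace) : measurable A ->
    pr (nu j) A = pr m (concat @^-1` (iter j shift @^-1` A)).
  by [].
have [mu muE] := average_probability nu N0.
have mcA (A : set borelspace) j : measurable A ->
    measurable (concat @^-1` (iter j shift @^-1` A) : set borelspace).
  move=> mA; apply: (measurable_preimage measurable_concat).
  exact: (measurable_preimage (measurable_iter_shift j) mA).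
have full (A : set borelspace) : measurable A ->
    (forall d j, valid d -> A (iter j shift (concat d))) -> pr mu A = 1.
  move=> mA h; rewrite muE// (eq_bigr (fun=> 1)); last first.
    move=> j _; rewrite nuE//; apply/eqP; rewrite eq_le; apply/andP; split.
      by apply: pr_le1; exact: mcA.
    apply: (@le_trans _ _ (pr m valid)); first by rewrite valid1.
    by apply: le_pr; [exact: mva|exact: mcA|move=> d vd; exact: h].
  by rewrite sumr_const card_ord divff// gt_eqF.
have concatX' d j : valid d -> X (iter j shift (concat d)).
  move=> vd; apply: iter_shift_mem => //; apply: concatX; exact: concat_mem.
have mX : measurable (X : set borelspace) by exact: measurable_closed.
exists mu; split.
- split; first by rewrite prE// full.
  move=> A mA.
  have msA : measurable (shift @^-1` A : set borelspace).
    exact: measurable_preimage measurable_shift mA.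
  rewrite prE// [RHS]prE//; congr EFin; rewrite !muE//; congr (_ / _).
  pose a j := pr m (concat @^-1` (iter j shift @^-1` A)).
  (* Shifting the sequence by N shifts the digits by one, which preserves the Bernoulli law; hence a
     shift only permutes the terms of the average cyclically. *)
  have aN : a N = a 0%N.
    rewrite /a -[RHS](pr_shift 1 minv); last exact: (mcA A 0%N mA).
    congr pr; apply/seteqP; split => d; rewrite /preimage /= /concat;
      by have := @iter_shift_concat_words N (fun i => nth [::] L (d i)) 1 N0; rewrite mul1n => ->.
  transitivity (\sum_(j < N) a j.+1); first by [].
  transitivity (\sum_(j < N) a j); last by [].
  have : \sum_(j < N.+1) a j = \sum_(j < N.+1) a j by [].
  rewrite [LHS]big_ord_recl [RHS]big_ord_recr /= aN [RHS]addrC => /addrI <-.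
  by apply: eq_bigr.
- apply: full; first exact: measurable_bounded_alphabet.
  move=> d j vd i; rewrite iter_shiftE /concat /concat_words.
  have gL := concat_mem vd ((j + i) %/ N)%N.
  by apply: (LK _ _ gL); rewrite mem_nth// sizeL// ltn_mod.
- move=> k w z wsz z0 hz.
  have mw := measurable_cyl w.
  rewrite muE// ler_pdivrMr// mulr_natr.
  apply: (@le_trans _ _ (\sum_(j < N) z)); last by rewrite sumr_const card_ord.
  apply: ler_sum => j _; rewrite nuE//.
  set Ej := concat @^-1` _; have mEj : measurable (Ej : set borelspace) by exact: mcA.
  rewrite -(pr_full mEj mva valid1).
  (* Either the window cannot be realised and the mass is 0, or one realisation d determines the
     digits 1, ..., k of all the others. *)
  have [[d [dE vd]]|nex] := pselect (exists d, Ej d /\ valid d); last first.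
    rewrite (_ : _ `&` _ = set0) ?pr_set0//; apply/seteqP; split => x // [xE vx].
    by apply: nex; exists x.
  apply: le_trans (hz j _ (ltn_ord j) (concat_mem vd) _); last first.
    by move: dE; rewrite /Ej /preimage /cyl /= wsz.
  pose v := mkseq (shift d) k.
  have -> : \prod_(i < k) b (nth [::] L (d i.+1)) / B ^+ k = pr m (cyl v).
    have -> : pr m (cyl v) = \prod_(i < k) q (shift d i).
      by rewrite mcyl /v /mkseq big_map -(big_mkord xpredT (fun i => q (shift d i))) /index_iota subn0.
    rewrite [RHS](eq_bigr (fun i => b (nth [::] L (d (nat_of_ord i).+1)) / B)); last first.
      by move=> i _; rewrite /q /shift (vd i.+1 : (d i.+1 < size L)%N).
    by rewrite prodf_div prodr_const card_ord.
  rewrite -(pr_shift 1 minv (measurable_cyl v)).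
  apply: le_pr; [exact: measurableI| |].
    exact: (measurable_preimage measurable_shift (measurable_cyl v)).
  move=> d' [d'E vd']; rewrite /preimage /= /v; apply/cylE/eq_mkseqP => i ik.
  rewrite /shift.
  have gE : nth [::] L (d' i.+1) = nth [::] L (d i.+1).
    rewrite -(@mkseq_concat_words N (fun i => nth [::] L (d' i)) i.+1 N0); last first.
      by move=> i'; rewrite sizeL// concat_mem.
    rewrite -[RHS](@mkseq_concat_words N (fun i => nth [::] L (d i)) i.+1 N0); last first.
      by move=> i'; rewrite sizeL// concat_mem.
    apply/eq_mkseqP => r rN; rewrite !iter_shiftE.
    have : mkseq (iter j shift (concat d')) (k.+1 * N) = mkseq (iter j shift (concat d)) (k.+1 * N).
      by move: d'E dE; rewrite /Ej /preimage /cyl /= wsz => -> ->.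
    move/eq_mkseqP/(_ (i.+1 * N + r - j)%N); rewrite !iter_shiftE.
    have jle : (j <= i.+1 * N + r)%N.
      apply: (leq_trans (ltnW (ltn_ord j))); rewrite mulSn -addnA; exact: leq_addr.
    rewrite subnKC//; apply; rewrite ltn_subLR//.
    have h1 : (i.+1 * N + r < i.+2 * N)%N by rewrite [X in (_ < X)%N]mulSnr ltn_add2l.
    apply: (leq_trans h1); apply: leq_trans (leq_addl _ _).
    by rewrite leq_mul2r ltnS ik orbT.
  apply/eqP; rewrite -(nth_uniq [::] _ _ uL); [by rewrite gE|exact: vd'|exact: vd].
Qed.

End ConcatenationMeasure.

Section HorseshoeMeasure.
Variables (R : realType) (X : set seqspace) (f : nat -> seqspace -> R).
Hypotheses (hX : finitely_irreducible_sofic X).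
Hypotheses (hf : continuous_positive X f) (haa : almost_additive X f).
Hypotheses (htv : tempered_variation X f).

Lemma sofic_nonempty : X !=set0.
Proof.
have [_ cX _ _] := hX; apply/set0P; apply/eqP => X0; apply: cX.
by exists set0; split => //; rewrite X0.
Qed.

Lemma horseshoe_measure (T : R) : (T%:E < pressure X (eseq f))%E ->
  exists (mu : probability borelspace R) (K : nat),
  [/\ invariant_measure X mu, pr mu (bounded_alphabet K) = 1 &
   forall n0, exists2 m, (n0 <= m)%N & (0 < m)%N /\ forall w, words X m w ->
     ((pr mu (cyl w))%:E <= (expR (- (m%:R * T)))%:E * cylinder_sup X (eseq f) m w)%E].
Proof.
move=> TP; have [[cX sX] _ _ _] := hX; have [x0 Xx0] := sofic_nonempty.
have Xa : words X 1 [:: x0 0%N] by exists x0.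
have [T1 TT1 T1P] := real_between TP.
have [C C0 hC] := blocks_lower hf haa sX.
(* Almost-additivity loses a factor e^C per block; with N (T1 - T) >= C + 1 a factor e per block is
   still gained. *)
have [N0 hN0] : exists N0, (C + 1) / (T1 - T) < N0.+1%:R by eexists; exact: truncnS_gt.
have [N [L [b [[nN N_gt0 uL sumL] [hL cL]]]]] := horseshoe hX hf haa htv Xa T1P N0.+1.
have NR : 0 < N%:R :> R by rewrite ltr0n.
have TT0 : 0 < T1 - T by rewrite subr_gt0.
have NC : C + 1 <= N%:R * (T1 - T).
  rewrite -ler_pdivrMr//; apply: (le_trans (ltW hN0)); rewrite ler_nat//.
pose K := (\max_(s <- L) \max_(i <- s) i).+1.
have LK s i : s \in L -> i \in s -> (i < K)%N.
  move=> sL ils; rewrite /K ltnS.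
  have h1 : (i <= \max_(j <- s) j)%N by rewrite (@leq_bigmax_seq _ _ xpredT (fun j : nat => j)).
  apply: (leq_trans h1).
  by rewrite (@leq_bigmax_seq _ _ xpredT (fun q : seq nat => \max_(j <- q) j)%N).
have b0 s : s \in L -> 0 < b s by move=> /hL[].
have sL s : s \in L -> size s = N by move=> /hL[].
have B0 : 0 < \sum_(s <- L) b s by apply: lt_le_trans sumL; exact: expR_gt0.
have L0 : (0 < size L)%N.
  by rewrite lt0n; apply/eqP => /size0nil L0; rewrite L0 big_nil ltxx in B0.
have [mu [imu muK hmu]] := concatenation_measure cX sX N_gt0 uL sL b0 L0 cL LK.
have [c /andP[c0 c1] edge] := edge_lower hf haa htv sX K.
exists mu, K; split => // n0.
(* A window of k + 1 blocks carries only k weights: the gain e^k has to cover the remaining e^(NT)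
   and the edge factor c^(-N). *)
have [k0 hk0] : exists k0, N%:R * T - N%:R * ln c < k0.+1%:R by eexists; exact: truncnS_gt.
pose k := (n0 + k0.+1)%N.
have k_gt0 : (0 < k)%N by rewrite /k addnS.
have kN0 : (0 < k * N)%N by rewrite muln_gt0 k_gt0.
exists (k.+1 * N)%N.
  by apply: leq_trans (leq_pmulr _ N_gt0); rewrite /k -addSn; exact: (leq_trans (leqnSn _) (leq_addr _ _)).
split; first by rewrite muln_gt0 N_gt0.
move=> w Xw; set m := (k.+1 * N)%N.
have m0 : (0 < m)%N by rewrite muln_gt0 N_gt0.
have wm : size w = m by have [x _ <-] := Xw; rewrite size_mkseq.
have [F F0 FE] := cylinder_sup_fin hf htv m0 Xw; rewrite FE -EFinM lee_fin.
apply: (hmu k w _ wm); first by rewrite mulr_ge0 ?expR_ge0 ?ltW.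
move=> j g jN gL gw; set B := \sum_(s <- L) b s.
set x := iter j shift (concat_words N g) in gw.
have Xg : X (concat_words N g) by exact: cL.
have Xx : X x by exact: iter_shift_mem.
have xK i : (x i < K)%N.
  rewrite /x iter_shiftE /concat_words; apply: (LK _ _ (gL ((j + i) %/ N)%N)).
  by rewrite mem_nth// sL// ltn_mod.
have fxF : f m x <= F.
  by rewrite -lee_fin -FE -gw; exact: (cylinder_sup_ub (eseq f) m Xx).
(* The window is the end of a block, k full blocks and the start of another; the N letters at the
   two ends are charged to [edge]. *)
have mE : m = (N - j + k * N + j)%N.
  by rewrite addnAC subnK ?(ltnW jN)// -mulSn.
have := edge (N - j)%N (k * N)%N j x Xx kN0 (fun i _ => xK i) (fun i _ => xK _).
rewrite -mE subnK ?(ltnW jN)//.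
have -> : iter (N - j) shift x = concat_words N (fun i => g i.+1).
  rewrite /x -iterD subnK ?(ltnW jN)//.
  by have := @iter_shift_concat_words N g 1 N_gt0; rewrite mul1n.
set y := concat_words N _; move=> hy.
have Xy : X y by apply: cL => i; exact: gL.
have := hC N k y N_gt0 k_gt0 Xy; rewrite big_split /= prodr_const card_ord => hyb.
have hb : \prod_(i < k) b (g i.+1) <= \prod_(i < k) f N (iter (i * N) shift y).
  apply: ler_prod => i _; rewrite ltW ?b0//=; have [_ _ _ h] := hL _ (gL i.+1).
  apply: h; first exact: iter_shift_mem.
  by rewrite /y mkseq_concat_words// => i'; rewrite sL.
have Pb : c ^+ N * (expR (- C) ^+ k * \prod_(i < k) b (g i.+1)) <= F.
  apply: le_trans fxF; apply: le_trans hy; rewrite ler_pM2l ?exprn_gt0//.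
  by apply: le_trans hyb; rewrite ler_pM2l// exprn_gt0// expR_gt0.
rewrite ler_pdivrMr ?exprn_gt0//.
have cN0 : 0 < c ^+ N * expR (- C) ^+ k by rewrite mulr_gt0 ?exprn_gt0 ?expR_gt0.
rewrite -(ler_pM2l cN0) -mulrA; apply: (le_trans Pb).
rewrite [leRHS](_ : _ = c ^+ N * expR (- C) ^+ k * expR (- (m%:R * T)) * B ^+ k * F); last by ring.
rewrite -[leLHS]mul1r ler_pM2r//.
have Bk : expR (N%:R * T1) ^+ k <= B ^+ k by apply: lerXn2r => //; rewrite nnegrE ?expR_ge0 ?ltW.
apply: (@le_trans _ _ (c ^+ N * expR (- C) ^+ k * expR (- (m%:R * T)) * expR (N%:R * T1) ^+ k)); last first.
  by rewrite ler_pM2l// mulr_gt0 ?expR_gt0.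
rewrite -(lnK (c0 : c \is Num.pos)) -!expRM_natl -!expRD -[leLHS]expR0 ler_expR.
have kE : N%:R * T - N%:R * ln c <= k%:R.
  by apply: (le_trans (ltW hk0)); rewrite ler_nat /k leq_addl.
have mR : m%:R = k%:R * N%:R + N%:R :> R by rewrite /m mulSnr natrD natrM.
have : k%:R <= k%:R * (N%:R * (T1 - T) - C).
  by rewrite -[leLHS]mulr1 ler_wpM2l//; move: NC; lra.
rewrite mR; move: kE; rewrite !mulrBr !mulrDl !mulrA !mulrN.
by move: (N%:R * ln c) (N%:R * T) (k%:R * N%:R * T1) (k%:R * N%:R * T) (k%:R * C) => *; lra.
Qed.

End HorseshoeMeasure.

(** * The image sequence *)

Section ImageSequence.
Variables (R : realType) (X Y : set seqspace) (p : nat -> nat) (f : nat -> seqspace -> R).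
Hypotheses (sX : shift @` X `<=` X).
Hypotheses (hp : one_block_factor X Y p) (hfin : finite_preimages X p).
Hypotheses (hf : continuous_positive X f) (haa : almost_additive X f).
Hypotheses (htv : tempered_variation X f).

Let G := image_sequence X p f.
Let F n := cylinder_sup X (eseq f) n.
Let Fr n w : R := fine (F n w).
Let W n (y : seqspace) := [set w | words X n w /\ map p w = mkseq y n].

Let Fr_gt0 n w : (0 < n)%N -> words X n w -> 0 < Fr n w.
Proof. by move=> n0 Xw; have [r r0 h] := cylinder_sup_fin hf htv n0 Xw; rewrite /Fr /F h. Qed.

Let FE n w : (0 < n)%N -> words X n w -> F n w = (Fr n w)%:E.
Proof. by move=> n0 Xw; have [r r0 h] := cylinder_sup_fin hf htv n0 Xw; rewrite /Fr /F h. Qed.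

Lemma map_mkseq_one_block (x : seqspace) n : map p (mkseq x n) = mkseq (one_block p x) n.
Proof. by rewrite /mkseq -map_comp. Qed.

Lemma finite_words_over (A : set nat) n : finite_set A ->
  finite_set [set w : seq nat | size w = n /\ forall i, i \in w -> A i].
Proof.
move=> finA; elim: n => [|n IH].
  rewrite (_ : [set w | _] = [set [::]]); first exact: finite_set1.
  by apply/seteqP; split => w /=; [case=> /size0nil ->|move=> ->].
apply: sub_finite_set (finite_image2 cons finA IH) => -[[]//|a w [[wn] wA]].
exists a; first by apply: wA; rewrite mem_head.
by exists w => //; split => // i iw; apply: wA; rewrite in_cons iw orbT.
Qed.

Lemma finite_fiber n y : finite_set (W n y).
Proof.
pose A := \bigcup_(i in `I_n) [set a | words X 1 [:: a] /\ p a = y i].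
have finA : finite_set A by apply: bigcup_finite => // i _; exact: hfin.
apply: sub_finite_set (@finite_words_over A n finA) => w [[x Xx <-]].
rewrite map_mkseq_one_block => /eq_mkseqP xy; split; first by rewrite size_mkseq.
move=> _ /mapP[i + ->]; rewrite mem_iota add0n => /= i_n; exists i => //; split.
  exists (iter i shift x); first exact: iter_shift_mem.
  by rewrite /mkseq /= iter_shiftE addn0.
exact: xy.
Qed.

Lemma fiber_seq n y : exists s : seq (seq nat), uniq s /\ forall w, w \in s <-> W n y w.
Proof.
have /finite_seqP[s sE] := finite_fiber n y.
by exists (undup s); split; [exact: undup_uniq|move=> w; rewrite mem_undup sE].
Qed.

Lemma transversal_exists n y (g : seq nat -> seqspace) :
  (forall w, W n y w -> cylinder X w (g w)) ->
  cylinder_transversal X p n y (g @` W n y).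
Proof.
move=> hg; split=> [_ [w Ww <-]|w Ww]; first by exists w => //; exact: hg.
exists (g w); split; first by split; [exists w|exact: hg].
move=> _ [[w' Ww' <-] [_ gw']]; have [_ g'w'] := hg _ Ww'.
suff : w' = w by move=> ->.
rewrite -gw' -[LHS]g'w'; congr (mkseq _ _).
have [[x _ xw'] _] := Ww'; have [[x' _ x'w] _] := Ww.
by rewrite -xw' -x'w !size_mkseq.
Qed.

(** The points of a transversal are chosen independently in finitely many cylinders, so the supremum
    of the sums is the sum of the suprema. *)
Lemma image_sequenceE n y (s : seq (seq nat)) : (0 < n)%N -> uniq s ->
  (forall w, w \in s <-> W n y w) -> G n y = (\sum_(w <- s) Fr n w)%:E.
Proof.
move=> n0 us sW; apply/eqP; rewrite eq_le; apply/andP; split.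
  apply: ge_ereal_sup => _ [E [EW hE] <-].
  have EX x : E x -> X x /\ W n y (mkseq x n).
    move=> /EW[w Ww [Xx xw]]; split => //; have [[x' _ x'w] _] := Ww.
    by move: xw; rewrite -[in size w]x'w size_mkseq => ->.
  have inj : set_inj E (fun x => mkseq x n).
    move=> x x' /set_mem Ex /set_mem Ex' xx'.
    have [Xx Wx] := EX _ Ex; have [Xx' Wx'] := EX _ Ex'.
    have [z [_ hz]] := hE _ Wx.
    rewrite -(hz x); last by split => //; split => //; rewrite size_mkseq.
    by apply: hz; split => //; split => //; rewrite size_mkseq xx'.
  apply: (@le_trans _ _ (\esum_(x in E) F n (mkseq x n))%E).
    by apply: le_esum => x /EX[Xx _]; exact: (cylinder_sup_ub (eseq f) n Xx).
  rewrite -(esum_image _ _ (F n) inj).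
  apply: (@le_trans _ _ (\esum_(w in [set` s]) F n w)%E).
    apply: le_esum_sub => [w /= /sW[Xw _]|_ [x Ex <-]].
      by rewrite FE// lee_fin ltW// Fr_gt0.
    by apply/sW; exact: (EX x Ex).2.
  rewrite esum_fset; last 2 first.
  - exact: finite_seq.
  - by move=> w; rewrite inE => /= /sW[Xw _]; rewrite FE// lee_fin ltW// Fr_gt0.
  rewrite -fsbig_seq// -sumEFin big_seq [leRHS]big_seq.
  by apply: lee_sum => w /sW[Xw _]; rewrite FE.
apply/lee_subgt0Pr => e e0.
(* Each word may miss its supremum by d; the successor avoids dividing by 0 when there is no word
   above y. *)
pose d := e / (size s).+1%:R.
have d0 : 0 < d by rewrite divr_gt0.
have /choice[g hg] : forall w, exists x, W n y w -> cylinder X w x /\ Fr n w - d <= f n x.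
  move=> w; have [Ww|nW] := pselect (W n y w); last by exists (fun=> 0%N).
  have : ((Fr n w - d)%:E < F n w)%E by rewrite (FE n0 Ww.1) lte_fin gtrBl.
  by move=> /ereal_sup_gt[_ [x wx <-] /ltW h]; exists x => _; split => //; rewrite -lee_fin.
apply: (@le_trans _ _ (\esum_(x in g @` W n y) (f n x)%:E)%E); last first.
  apply: ereal_sup_ubound; exists (g @` W n y) => //; apply: transversal_exists => w Ww.
  exact: (hg w Ww).1.
have gK w : W n y w -> mkseq (g w) n = w.
  move=> Ww; have [[_ gw] _] := hg _ Ww; have [[x _ xw] _] := Ww.
  by move: gw; rewrite -[in size w]xw size_mkseq.
apply: (@le_trans _ _ (\sum_(w <- s) (f n (g w))%:E)%E).
  rewrite -EFinB sumEFin lee_fin lerBlDr.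
  apply: (@le_trans _ _ (\sum_(w <- s) (f n (g w) + d))).
    rewrite big_seq [leRHS]big_seq; apply: ler_sum => w /sW Ww.
    by rewrite -lerBlDr; exact: (hg w Ww).2.
  rewrite big_split /= lerD2l big_const_seq count_predT iter_addr_0 -(mulr_natr d).
  rewrite /d -mulrA -[leRHS]mulr1 ler_pM2l// mulrC ler_pdivrMr// mul1r.
  by rewrite ler_nat leqnSn.
rewrite -(big_map g xpredT (fun x => (f n x)%:E)).
apply: esum_ge; exists [set` map g s].
  split; first exact: finite_seq.
  by move=> _ /mapP[w /sW Ww ->]; exists w.
rewrite -fsbig_seq// map_inj_in_uniq// => w1 w2 /sW W1 /sW W2 g12.
by rewrite -(gK _ W1) g12 gK.
Qed.

Lemma image_sequence_determined n y y' : mkseq y n = mkseq y' n -> G n y = G n y'.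
Proof. by move=> yy'; rewrite /G /image_sequence /cylinder_transversal yy'. Qed.

Lemma image_sequence_fin n y : (0 < n)%N -> Y y -> exists2 r, 0 < r & G n y = r%:E.
Proof.
move=> n0 Yy; have [s [us sW]] := fiber_seq n y.
exists (\sum_(w <- s) Fr n w); last exact: image_sequenceE.
have [x Xx xy] : exists2 x, X x & one_block p x = y.
  by have [_ surj _] := hp; move: Yy; rewrite -surj => -[x Xx <-]; exists x.
have ws : mkseq x n \in s.
  by apply/sW; split; [exists x|rewrite map_mkseq_one_block xy].
rewrite (big_rem (mkseq x n))//= ltr_pwDl//; first by apply: Fr_gt0 => //; exists x.
rewrite big_seq; apply: sumr_ge0 => w /mem_rem /sW[Xw _].
by rewrite ltW// Fr_gt0.
Qed.

Lemma ler_sum_sub (I : eqType) (r1 r2 : seq I) (h : I -> R) :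
  uniq r1 -> uniq r2 -> {subset r1 <= r2} -> (forall i, i \in r2 -> 0 <= h i) ->
  \sum_(i <- r1) h i <= \sum_(i <- r2) h i.
Proof.
move=> u1 u2 r12 h0.
rewrite (perm_big [seq i <- r2 | i \in r1]); last first.
  apply: uniq_perm => //; first exact: filter_uniq.
  by move=> i; rewrite mem_filter; case: (boolP (i \in r1)) => //= /r12 ->.
rewrite big_filter big_mkcond big_seq [leRHS]big_seq; apply: ler_sum => i /h0 hi.
by case: ifP.
Qed.

(** Cutting at n maps the words above y injectively into pairs of words above its two pieces. The
    map need not be onto, as such pairs need not concatenate in X, so this gives an upper bound
    only. *)
Lemma image_sequence_submultiplicative : exists C : R, forall n m y,
  (0 < n)%N -> (0 < m)%N -> Y y ->
  (G (n + m) y <= (expR C)%:E * (G n y * G m (iter n shift y)))%E.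
Proof.
have [C [_ hC]] := haa; exists C => n m y n0 m0 Yy.
have nm0 : (0 < n + m)%N by rewrite addn_gt0 n0.
have [s [us sW]] := fiber_seq (n + m) y.
have [s1 [us1 s1W]] := fiber_seq n y.
have [s2 [us2 s2W]] := fiber_seq m (iter n shift y).
rewrite (image_sequenceE nm0 us sW) (image_sequenceE n0 us1 s1W) (image_sequenceE m0 us2 s2W).
rewrite -!EFinM lee_fin.
pose tk w : seq nat * seq nat := (take n w, drop n w).
have split_word w : words X (n + m) w -> words X n (take n w) /\ words X m (drop n w).
  move=> [x Xx <-]; rewrite mkseq_cat take_size_cat ?drop_size_cat ?size_mkseq//.
  by split; [exists x|exists (iter n shift x) => //; exact: iter_shift_mem].
apply: (@le_trans _ _ (\sum_(w <- s) expR C * (Fr n (take n w) * Fr m (drop n w)))).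
  rewrite big_seq [leRHS]big_seq; apply: ler_sum => w /sW[Xw _].
  have [Xw1 Xw2] := split_word _ Xw.
  rewrite -lee_fin -FE//; apply: ge_ereal_sup => _ [x [Xx xw] <-].
  have wn : size w = (n + m)%N by have [x' _ <-] := Xw; rewrite size_mkseq.
  rewrite wn mkseq_cat in xw.
  have Xs : X (iter n shift x) by exact: iter_shift_mem.
  rewrite /eseq lee_fin; apply: le_trans (hC _ _ _ n0 m0 Xx).2 _.
  rewrite ler_pM2l ?expR_gt0//; apply: ler_pM.
  - exact/ltW/(f_gt0 hf).
  - exact/ltW/(f_gt0 hf).
  - rewrite -lee_fin -FE// -xw take_size_cat ?size_mkseq//.
    exact: (cylinder_sup_ub (eseq f) n Xx).
  - rewrite -lee_fin -FE// -xw drop_size_cat ?size_mkseq//.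
    exact: (cylinder_sup_ub (eseq f) m Xs).
rewrite -mulr_sumr ler_pM2l ?expR_gt0//.
rewrite -(big_map tk xpredT (fun uv => Fr n uv.1 * Fr m uv.2)).
have -> : (\sum_(u <- s1) Fr n u) * (\sum_(v <- s2) Fr m v) =
    \sum_(uv <- [seq (u, v) | u <- s1, v <- s2]) Fr n uv.1 * Fr m uv.2.
  rewrite big_allpairs mulr_suml; apply: eq_bigr => u _.
  by rewrite mulr_sumr.
apply: ler_sum_sub.
- rewrite map_inj_uniq// => w1 w2 [h1 h2].
  by rewrite -(cat_take_drop n w1) h1 h2 cat_take_drop.
- by rewrite allpairs_uniq// => -[u v] [u' v'] _ _.
- move=> _ /mapP[w /sW[Xw pw] ->]; have [Xw1 Xw2] := split_word _ Xw.
  move: pw; rewrite mkseq_cat => pw.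
  apply/allpairsP; exists (take n w, drop n w); split => //=.
    apply/s1W; split => //.
    by rewrite map_take pw take_size_cat ?size_mkseq.
  apply/s2W; split => //.
  by rewrite map_drop pw drop_size_cat ?size_mkseq.
- move=> _ /allpairsP[[u v] [/= /s1W[Xu _] /s2W[Xv _] ->]] /=.
  by rewrite mulr_ge0// ltW// Fr_gt0.
Qed.

(** g_n depends on n coordinates only, so its supremum over a cylinder of Y is its value there; the
    words of X are then grouped by their images. *)
Lemma pressure_image : pressure Y G = pressure X (eseq f).
Proof.
apply: (@eq_limn_esup _ _ _ 1) => n n0; congr (_ * lne _)%E.
have [_ surj _] := hp.
pose fib v := [set w | words X n w /\ map p w = v].
have F0 w : words X n w -> (0 <= F n w)%E by move=> Xw; rewrite FE// lee_fin ltW// Fr_gt0.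
transitivity (\esum_(v in words Y n) \esum_(w in fib v) F n w)%E.
  apply: eq_esum => v Yv; have [y Yy yv] := Yv.
  have [s [us sW]] := fiber_seq n y.
  have Gy : G n y = (\esum_(w in fib v) F n w)%E.
    rewrite (image_sequenceE n0 us sW) (_ : fib v = [set` s]); last first.
      by apply/seteqP; split => w /=; [move=> h; apply/sW; rewrite /W yv|move/sW; rewrite /W yv].
    rewrite esum_fset; last 2 first.
    - exact: finite_seq.
    - by move=> w; rewrite inE => /= /sW[Xw _]; exact: F0.
    rewrite -fsbig_seq// -sumEFin big_seq [RHS]big_seq.
    by apply: eq_bigr => w /sW[Xw _]; rewrite FE.
  rewrite -Gy; apply/eqP; rewrite eq_le; apply/andP; split.
    apply: ge_ereal_sup => _ [y' [Yy' y'v] <-].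
    rewrite (@image_sequence_determined n y' y)// yv -[RHS]y'v.
    by rewrite -yv size_mkseq.
  by apply: ereal_sup_ubound; exists y => //; split => //; rewrite -yv size_mkseq.
rewrite esum_esum; last by move=> v w _ [Xw _]; exact: F0.
symmetry; apply: (reindex_esum _ _ (fun vw : seq nat * seq nat => vw.2)).
split.
- by move=> [v w] /= [_ [Xw _]].
- move=> [v w] [v' w'] /set_mem[/= _ [_ vE]] /set_mem[/= _ [_ vE']] ww'.
  by rewrite -vE -vE' ww'.
- move=> w Xw; exists (map p w, w) => //=; split; last by split.
  have [x Xx <-] := Xw; rewrite map_mkseq_one_block; exists (one_block p x) => //.
  by rewrite -surj; exists x.
Qed.

End ImageSequence.

(** * Variational formulas *)

Section Integrability.
Variable R : realType.

Lemma measurable_fun_determined_ereal n (D : set borelspace) (u : borelspace -> \bar R) :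
  (forall x y : seqspace, mkseq x n = mkseq y n -> u x = u y) -> measurable_fun D u.
Proof.
move=> du mD A mA; apply: measurableI => //; apply: (@measurable_determined n) => x y xy.
by rewrite /preimage /= (du _ _ xy).
Qed.

Lemma within_continuous_measurable (X : set seqspace) (g : seqspace -> R) : closed X ->
  {within X, continuous g} -> measurable_fun (X : set borelspace) (g : borelspace -> R).
Proof.
move=> cX /continuousP gc.
apply: (@measurability _ _ _ _ _ _ _ (RGenOpens.measurableE R)) => _ [_ [a [b ->]] <-].
have oab : open (`]a, b[%classic : set R) by exact: interval_open.
have /open_subspaceP[V oV VE] := gc _ oab.
rewrite setIC -VE; apply: measurableI; last exact: measurable_closed.
exact: sub_sigma_algebra.
Qed.

Variables (mu : probability borelspace R) (S : set borelspace) (phi : nat -> seqspace -> \bar R).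
Hypothesis mS : measurable S.
Local Open Scope ereal_scope.

Lemma upper_integrable_of_bound (M : nat -> R) :
  (forall n, (0 < n)%N -> measurable_fun S (fun x : borelspace => lne (phi n x))) ->
  (forall n, (0 < n)%N -> {ae mu, forall x, S x -> lne (phi n x) <= (M n)%:E}) ->
  eventually_upper_integrable S phi mu.
Proof.
move=> mphi hM; exists 1%N => // n /= n0.
apply: (@le_lt_trans _ _ (\int[mu]_(x in S) cst (Num.max (M n) 0%R)%:E x)).
  apply: ae_le_integral => //.
  - by apply: measurable_maxe; [exact: mphi|exact: measurable_cst].
  - have [N [mN N0 hN]] := hM n n0; exists N; split => // x nx; apply: hN => h; apply: nx => Sx.
    by rewrite /cst EFin_max ge_max !le_max h// lexx orbT.
rewrite integral_cst//; apply: lte_mul_pinfty; rewrite ?lee_fin ?le_max ?lexx ?orbT//.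
exact: (le_lt_trans (probability_le1 _ mS) (ltry _)).
Qed.

Lemma bounded_alphabet_upper_integrable K : pr mu (bounded_alphabet K) = 1%R ->
  (forall n x, (0 < n)%N -> S x -> phi n x < +oo) ->
  (forall n (x y : seqspace), mkseq x n = mkseq y n -> phi n x = phi n y) ->
  eventually_upper_integrable S phi mu.
Proof.
move=> K1 phioo dphi.
have /choice[M hM] : forall n, exists M : R, (0 < n)%N ->
    forall x, S x -> bounded_alphabet K x -> lne (phi n x) <= M%:E.
  move=> n; have [n0|] := ltnP 0 n; last by case: n => // _; exists 0%R.
  (* Only finitely many words of length n use symbols below [K]; padding each by zeros gives a point
     at which to read off the value of phi_n. *)
  pose y (w : {ffun 'I_n -> 'I_K}) : seqspace :=
    fun i => if insub i is Some j then val (w j) else 0%N.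
  pose r w : R := fine (maxe (lne (phi n (y w))) 0).
  exists (\big[Num.max/0%R]_w r w) => _ x Sx xK.
  pose w : {ffun 'I_n -> 'I_K} := [ffun i : 'I_n => Ordinal (xK i)].
  have xy : phi n x = phi n (y w).
    apply: dphi; apply/eq_mkseqP => i i_n; rewrite /y insubT ffunE//.
  have := phioo n x n0 Sx; rewrite xy => oo.
  have rE : (r w)%:E = maxe (lne (phi n (y w))) 0.
    rewrite /r fineK// ge0_fin_numE ?le_max ?lexx ?orbT//.
    rewrite gt_max ltry andbT.
    case: (phi n (y w)) oo => // s _; have [s0|s0] := ltP 0%R s.
      by rewrite lne_EFin// ltry.
    by rewrite le0_lneNy ?lee_fin// ltNyr.
  apply: (@le_trans _ _ (r w)%:E); first by rewrite rE le_max lexx.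
  by rewrite lee_fin; exact: le_bigmax.
apply: (@upper_integrable_of_bound M) => n n0.
  by apply: (@measurable_fun_determined_ereal n) => x y /dphi ->.
apply: (ae_full (measurable_bounded_alphabet K) K1) => x xK Sx.
exact: hM.
Qed.

End Integrability.

Section Main.
Variables (R : realType) (X Y : set seqspace) (p : nat -> nat) (f : nat -> seqspace -> R).
Hypotheses (hX : finitely_irreducible_sofic X) (hY : subshift Y).
Hypotheses (hp : one_block_factor X Y p) (hfin : finite_preimages X p).
Hypotheses (hf : continuous_positive X f) (haa : almost_additive X f).
Hypotheses (htv : tempered_variation X f).

Let F := eseq f.
Let G := image_sequence X p f.

Let cX : closed X. Proof. by have [[]] := hX. Qed.
Let sX : shift @` X `<=` X. Proof. by have [[]] := hX. Qed.
Let sY : shift @` Y `<=` Y. Proof. by have [] := hY. Qed.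
Let mX : measurable (X : set borelspace). Proof. exact: measurable_closed. Qed.
Let mY : measurable (Y : set borelspace). Proof. by have [cY _] := hY; exact: measurable_closed. Qed.

Let F_gt0 n x : (0 < n)%N -> X x -> (0 < F n x)%E.
Proof. by move=> n0 Xx; rewrite /F /eseq lte_fin (f_gt0 hf). Qed.

Let G_gt0 n y : (0 < n)%N -> Y y -> (0 < G n y)%E.
Proof.
move=> n0 Yy; have [r r0 GE] := image_sequence_fin sX hp hfin hf htv n0 Yy.
by rewrite /G GE lte_fin.
Qed.

Let G_lty n y : (0 < n)%N -> Y y -> (G n y < +oo)%E.
Proof.
move=> n0 Yy; have [r r0 GE] := image_sequence_fin sX hp hfin hf htv n0 Yy.
by rewrite /G GE ltry.
Qed.

Let measurable_F n : (0 < n)%N ->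
  measurable_fun (X : set borelspace) (fun x : borelspace => lne (F n x)).
Proof.
move=> n0; apply: (@eq_measurable_fun _ _ _ _ _ (fun x : borelspace => (ln (f n x))%:E)).
  by move=> x; rewrite inE => Xx; rewrite /F /eseq lne_EFin// (f_gt0 hf).
apply/measurable_EFinP; apply: (measurableT_comp (@measurable_ln R)).
exact: (within_continuous_measurable cX (hf n0).1).
Qed.

Let measurable_G n : (0 < n)%N ->
  measurable_fun (Y : set borelspace) (fun y : borelspace => lne (G n y)).
Proof.
move=> _; apply: (@measurable_fun_determined_ereal _ n) => x y xy.
by rewrite /G (image_sequence_determined _ _ _ xy).
Qed.

Let pressure_G : pressure Y G = pressure X F.
Proof. exact: pressure_image. Qed.

Lemma mean_log_F_cvg (mu : probability borelspace R) : has_ubound (f 1%N @` X) ->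
  invariant_measure X mu -> mean_log X F mu @ \oo --> limn_esup (mean_log X F mu).
Proof.
move=> [b hb] [muX inv]; have [C [C0 hC]] := haa.
apply: (@mean_log_cvg R mu X F inv mX muX F_gt0 measurable_F C sX).
- by move=> n x _ _; rewrite ltry.
- by move=> n m x n0 m0 Xx; rewrite /F /eseq -!EFinM lee_fin; exact: (hC _ _ _ n0 m0 Xx).2.
have fb x : X x -> f 1 x <= b by move=> Xx; apply: hb; exists x.
have [x0 Xx0] := sofic_nonempty hX.
have b0 : 0 < b by apply: lt_le_trans (fb _ Xx0); exact: (f_gt0 hf).
(* Almost-additivity and f_1 <= b give f_n <= (e^C b)^n by induction. *)
apply: (@upper_integrable_of_bound R mu X F mX (fun n => ln ((expR C * b) ^+ n))) => // n n0.
have Cb0 : 0 < expR C * b by rewrite mulr_gt0// expR_gt0.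
apply: aeW => x Xx; rewrite /F /eseq lne_EFin ?(f_gt0 hf)// lee_fin.
rewrite ler_ln ?posrE ?(f_gt0 hf) ?exprn_gt0//.
have C1 : 1 <= expR C by rewrite -[leLHS]expR0 ler_expR.
case: n n0 => // n _; elim: n x Xx => [|n IH] x Xx.
  rewrite expr1; apply: (le_trans (fb _ Xx)).
  by rewrite -[leLHS]mul1r ler_pM2r.
have := (hC 1%N n.+1 x isT isT Xx).2; rewrite add1n => /le_trans; apply.
rewrite exprS -mulrA ler_pM2l ?expR_gt0//; apply: ler_pM.
- exact/ltW/(f_gt0 hf).
- by apply/ltW/(f_gt0 hf) => //; exact: (iter_shift_mem sX 1).
- exact: fb.
- by apply: IH; exact: (iter_shift_mem sX 1).
Qed.

Lemma mean_log_G_cvg (nu : probability borelspace R) :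
  invariant_measure Y nu -> eventually_upper_integrable Y G nu ->
  mean_log Y G nu @ \oo --> limn_esup (mean_log Y G nu).
Proof.
move=> [nuY inv]; have [C hC] := image_sequence_submultiplicative Y sX hfin hf haa htv.
exact: (@mean_log_cvg R nu Y G inv mY nuY G_gt0 measurable_G C sY G_lty hC).
Qed.

Lemma variational_limsup_le_F : (variational_limsup X F <= pressure X F)%E.
Proof.
apply: ge_ereal_sup => _ [mu [[muX inv] loo] <-].
exact: (entropy_le_pressure inv mX muX F_gt0 measurable_F loo).
Qed.

Lemma variational_limsup_le_G : (variational_limsup Y G <= pressure X F)%E.
Proof.
rewrite -pressure_G; apply: ge_ereal_sup => _ [nu [[nuY inv] loo] <-].
exact: (entropy_le_pressure inv mY nuY G_gt0 measurable_G loo).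
Qed.

Lemma good_measure_F (T : R) : (T%:E < pressure X F)%E ->
  exists mu : probability borelspace R, [/\ invariant_measure X mu,
    (-oo < limn_esup (mean_log X F mu))%E &
    (T%:E <= entropy mu + limn_esup (mean_log X F mu))%E].
Proof.
move=> TP.
have [T1 TT1 T1P] := real_between TP.
have [mu [K [[muX inv] muK hmu]]] := horseshoe_measure hX hf haa htv T1P.
exists mu; suff [h1 h2] : (-oo < limn_esup (mean_log X F mu))%E /\
  (T%:E <= entropy mu + limn_esup (mean_log X F mu))%E by split.
(* Tempered variation turns the supremum over [w] into the value at any of its points. *)
apply: (gibbs_measure_lower_bound inv mX muX F_gt0 measurable_F muK) => n0.
have d0 : 0 < T1 - T by rewrite subr_gt0.
have [n1 hn1] := variation_log_small hf htv d0 (sofic_nonempty hX).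
have [m nm [m0 hm]] := hmu (maxn n0 n1); rewrite geq_max in nm.
case/andP: nm => nm0 nm1; exists m => //; split => // x Xx.
have Xw : words X m (mkseq x m) by exists x.
apply: (le_trans (hm _ Xw)).
have cx : cylinder X (mkseq x m) x by split => //; rewrite size_mkseq.
have Fle := cylinder_sup_le hf htv m0 cx (size_mkseq _ _).
apply: (le_trans (lee_wpmul2l _ Fle)); first by rewrite lee_fin expR_ge0.
rewrite /F /eseq -!EFinM lee_fin mulrA ler_pM2r ?(f_gt0 hf)//.
have M0 : 0 < fine (variation X f m) by apply: lt_le_trans (variation_ge1 hf htv m0 Xx).
rewrite -[X in _ * X <= _](lnK (M0 : _ \is Num.pos)) -expRD ler_expR.
by have := hn1 m nm1; rewrite mulrBr; lra.
Qed.

(** In contrast with X, no margin below the pressure is spent on variation, because g_m is a sum of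
    the very suprema that bound the cylinders. The measure has finitely many symbols, whence its
    upper integrability. *)
Lemma good_measure_G (T : R) : (T%:E < pressure X F)%E ->
  exists nu : probability borelspace R, [/\ invariant_measure Y nu,
    eventually_upper_integrable Y G nu,
    (-oo < limn_esup (mean_log Y G nu))%E &
    (T%:E <= entropy nu + limn_esup (mean_log Y G nu))%E].
Proof.
move=> TP.
have [mu [K [[muX inv] muK hmu]]] := horseshoe_measure hX hf haa htv TP.
have muX1 : pr mu X = 1 by rewrite /pr muX.
have [_ surj _] := hp.
have XY x : X x -> Y (one_block p x) by move=> Xx; rewrite -surj; exists x.
pose nu := pushforward_prob mu (measurable_one_block p).
have nuE (A : set borelspace) : nu A = mu (one_block p @^-1` A) by [].
have mpre (A : set borelspace) : measurable A -> measurable (one_block p @^-1` A : set borelspace).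
  exact: measurable_preimage (measurable_one_block p).
have nu_full (A : set borelspace) (B : set borelspace) : measurable A -> measurable B -> pr mu B = 1 ->
    (forall x, B x -> A (one_block p x)) -> pr nu A = 1.
  move=> mA mB B1 BA; apply/eqP; rewrite eq_le pr_le1//= -B1; apply: le_pr => //.
  exact: mpre.
have nuY1 : pr nu Y = 1 by apply: nu_full mX muX1 XY.
have nuY : nu Y = 1%E by rewrite prE// nuY1.
have invnu : shift_invariant nu.
  by move=> A mA; rewrite !nuE -(inv _ (mpre _ mA)).
pose K' := (\max_(i < K) p i).+1.
have nuK : pr nu (bounded_alphabet K') = 1.
  apply: nu_full (measurable_bounded_alphabet K) muK _; first exact: measurable_bounded_alphabet.
  move=> x xK i; rewrite /one_block /= /K' ltnS.
  exact: (@leq_bigmax _ (fun i : 'I_K => p i) (Ordinal (xK i))).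
exists nu; suff [h1 h2] : (-oo < limn_esup (mean_log Y G nu))%E /\
  (T%:E <= entropy nu + limn_esup (mean_log Y G nu))%E.
  split => //; apply: (bounded_alphabet_upper_integrable mY nuK G_lty) => n x y xy.
  by rewrite /G (image_sequence_determined _ _ _ xy).
apply: (gibbs_measure_lower_bound invnu mY nuY G_gt0 measurable_G nuK) => n0.
have [m nm [m0 hm]] := hmu n0; exists m => //; split => // y Yy.
have [s [us sW]] := fiber_seq sX hfin m y.
rewrite /G (image_sequenceE hf htv m0 us sW) -EFinM lee_fin mulr_sumr.
have mpc : measurable (one_block p @^-1` cyl (mkseq y m) : set borelspace).
  by apply: mpre; exact: measurable_cyl.
have sub : one_block p @^-1` cyl (mkseq y m) `&` X `<=` \big[setU/set0]_(w <- s) cyl w.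
  move=> x [/cylE xy Xx]; rewrite -bigcup_seq; exists (mkseq x m); last exact: cyl_mkseq.
  by apply/sW; split; [exists x|rewrite map_mkseq_one_block].
have mU : measurable (\big[setU/set0]_(w <- s) cyl w : set borelspace).
  by apply: bigsetU_measurable => w _; exact: measurable_cyl.
apply: (@le_trans _ _ (pr mu (\big[setU/set0]_(w <- s) cyl w))).
  rewrite -[leLHS]/(pr mu (one_block p @^-1` cyl (mkseq y m))) -(pr_full mpc mX muX1).
  by apply: le_pr => //; exact: measurableI.
apply: (@le_trans _ _ (\sum_(w <- s) pr mu (cyl w))).
  elim: (s) => [|w r IH]; first by rewrite !big_nil pr_set0.
  rewrite !big_cons; apply: (le_trans (prU2 _ _ _)); first exact: measurable_cyl.
    by apply: bigsetU_measurable => w' _; exact: measurable_cyl.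
  by rewrite lerD2l.
rewrite big_seq [leRHS]big_seq; apply: ler_sum => w /sW[Xw _].
have := hm w Xw; have [r r0 ->] := cylinder_sup_fin hf htv m0 Xw.
by rewrite -EFinM lee_fin.
Qed.

Lemma variational_principle : [/\ pressure X F = variational_limsup X F,
  variational_limsup X F = variational_limsup Y G &
  variational_limsup Y G = pressure Y G].
Proof.
have hF : pressure X F = variational_limsup X F.
  apply/eqP; rewrite eq_le variational_limsup_le_F andbT; apply: lee_real_below => T TP.
  have [mu [inv loo Tle]] := good_measure_F TP.
  by apply: (le_trans Tle); apply: ereal_sup_ubound; exists mu.
have hG : pressure X F = variational_limsup Y G.
  apply/eqP; rewrite eq_le variational_limsup_le_G andbT; apply: lee_real_below => T TP.
  have [nu [inv _ loo Tle]] := good_measure_G TP.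
  by apply: (le_trans Tle); apply: ereal_sup_ubound; exists nu.
by split; [exact: hF|rewrite -hF -hG|rewrite -hG pressure_G].
Qed.

Lemma variational_lim_le (S : set seqspace) (phi : nat -> seqspace -> \bar R) :
  (variational_lim S phi <= variational_limsup S phi)%E.
Proof.
apply: ge_ereal_sup => _ [mu [inv cv loo] <-].
rewrite -(is_cvg_limn_esupE cv) in loo *.
by apply: ereal_sup_ubound; exists mu.
Qed.

Lemma variational_lim_ge (S : set seqspace) (phi : nat -> seqspace -> \bar R)
    (mu : probability borelspace R) (T : R) :
  invariant_measure S mu -> mean_log S phi mu @ \oo --> limn_esup (mean_log S phi mu) ->
  (-oo < limn_esup (mean_log S phi mu))%E ->
  (T%:E <= entropy mu + limn_esup (mean_log S phi mu))%E ->
  (T%:E <= variational_lim S phi)%E.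
Proof.
move=> inv cv loo Tle; apply: (le_trans Tle); rewrite -(cvg_lim _ cv)// in loo *.
by apply: ereal_sup_ubound; exists mu => //; split => //; apply/cvg_ex; eexists; exact: cv.
Qed.

(** The formula with limits ranges over fewer measures, which gives one inequality; the measures
    approaching the pressure have convergent means, which gives the other. *)
Lemma variational_principle_lim : has_ubound (f 1%N @` X) ->
  pressure X F = variational_lim X F /\ variational_lim X F = variational_lim Y G.
Proof.
move=> hb; have [PF FG GP] := variational_principle.
have hF : pressure X F = variational_lim X F.
  apply/eqP; rewrite eq_le [X in _ && X](_ : _ = true) ?andbT; last first.
    by rewrite PF variational_lim_le.
  apply: lee_real_below => T TP; have [mu [inv loo Tle]] := good_measure_F TP.
  exact: variational_lim_ge inv (mean_log_F_cvg hb inv) loo Tle.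
split; first exact: hF.
rewrite -hF; apply/eqP; rewrite eq_le; apply/andP; split.
  apply: lee_real_below => T TP; have [nu [inv ui loo Tle]] := good_measure_G TP.
  exact: variational_lim_ge inv (mean_log_G_cvg inv ui) loo Tle.
by rewrite PF FG variational_lim_le.
Qed.

End Main.

Unset Implicit Arguments.

Theorem theorem6p2 (R : realType) (X Y : set seqspace) (p : nat -> nat)
    (f : nat -> seqspace -> R)
    (hX : finitely_irreducible_sofic X)
    (hY : subshift Y) (hYc : countable_alphabet Y)
    (hp : one_block_factor X Y p) (hfin : finite_preimages X p)
    (hf : continuous_positive X f) (haa : almost_additive X f)
    (htv : tempered_variation X f) :
  let F := eseq f in
  let G := image_sequence X p f in
  [/\ forall a : nat, words X 1 [:: a] -> gurevich_pressure X F a = pressure X F,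
      pressure X F = variational_limsup X F,
      variational_limsup X F = variational_limsup Y G &
      variational_limsup Y G = pressure Y G] /\
  (has_ubound (f 1%N @` X) ->
    [/\ pressure X F = variational_lim X F,
        variational_lim X F = variational_lim Y G,
        forall mu : probability borelspace R, invariant_measure X mu ->
          mean_log X F mu @ \oo --> limn_esup (mean_log X F mu) &
        forall nu : probability borelspace R, invariant_measure Y nu ->
          eventually_upper_integrable Y G nu ->
          mean_log Y G nu @ \oo --> limn_esup (mean_log Y G nu)]).
Proof.
move=> F G.
have [PF FG GP] := variational_principle hX hY hp hfin hf haa htv.
split.
  by split; [move=> a; exact: gurevich_pressureE|exact: PF|exact: FG|exact: GP].
move=> hb; have [PFl FGl] := variational_principle_lim hX hY hp hfin hf haa htv hb.
split; [exact: PFl|exact: FGl| |].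
  by move=> mu; exact: (mean_log_F_cvg hX hf haa hb).
by move=> nu; exact: (mean_log_G_cvg hX hY hp hfin hf haa htv).
Qed.
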